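(* Let $N\ge 3$ be an integer, let $p_S:=\frac{N+2}{N-2}$, and let $f:[0,\infty)\to\mathbb{R}$ satisfy the following four conditions: (1) $f\in C^1[0,\infty)\cap C^2(0,\infty)$, $f(0)=0$ and $f'(0)=0$; (2) $f'(u)>0$ and $f''(u)>0$ for all $u>0$; (3) $g(u):=\log f(u)$ is convex for large $u>0$ and $\lim_{u\to\infty}\frac{g''(u)}{g'(u)^2}=0$; (4) $uf(u)-(p_S+1)\int_0^u f(s)\,ds\ge 0$ for all $u\ge 0$. Then the problem $$\begin{cases}\Delta u+f(u)=0, & x\in\mathbb{R}^N\setminus\{0\},\\ u(x)\ge 0, & x\in\mathbb{R}^N\setminus\{0\},\\ u(x)\ \text{is radial},\\ u(x)\to\infty\ \text{ as }\ |x|\to 0,\end{cases}$$ has a unique solution $u^*\in C^2(\mathbb{R}^N\setminus\{0\})$. Moreover, $u^*\in\mathcal{L}^1_{ul}(\mathbb{R}^N)$, and $$u^*(x)=F^{-1}\left[\frac{|x|^2}{2N-4}(1+o(1))\right]\quad\text{as } |x|\to 0,$$ where $F^{-1}$ is the inverse function of $F(u):=\int_u^\infty\frac{ds}{f(s)}$, $u>0$.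
   Context: For $x\in\mathbb{R}^N$ and $\rho>0$, $B(x,\rho)=\{y\in\mathbb{R}^N:|x-y|<\rho\}$. The space $L^1_{ul}(\mathbb{R}^N)$ consists of all $u\in L^1_{loc}(\mathbb{R}^N)$ with $\|u\|_{L^1_{ul}(\mathbb{R}^N)}:=\sup_{z\in\mathbb{R}^N}\int_{B(z,1)}|u(x)|\,dx<\infty$. The space $\mathcal{L}^1_{ul}(\mathbb{R}^N)$ is the closure in $L^1_{ul}(\mathbb{R}^N)$ of the space $BUC(\mathbb{R}^N)$ of bounded uniformly continuous functions. The solution $u^*$ is called the singular solution. *)

(* Defs.v *)
From HB Require Import structures.
From mathcomp Require Import all_boot all_order all_algebra.
From mathcomp Require Import all_classical all_reals all_analysis.
Set Implicit Arguments.
Unset Strict Implicit.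
Unset Printing Implicit Defensive.
Import Order.TTheory GRing.Theory Num.Theory.
Import numFieldNormedType.Exports.
Local Open Scope ring_scope.
Local Open Scope classical_set_scope.

(* The measurable space R^n: the product sigma-algebra on row vectors, i.e.
   the one generated by the coordinates (as for tuples in the library), which
   is the Borel sigma-algebra. *)
Definition measure_rV_display : measure_display.
Proof. exact: default_measure_display. Qed.

Section measurable_rV.
Context {R : realType} (n : nat).

Let coord : 'I_n -> 'rV[R]_n -> measurableTypeR R := fun i x => x ord0 i.

Let rV_set0 : g_sigma_preimage coord set0.
Proof. exact: sigma_algebra0. Qed.

Let rV_setC A : g_sigma_preimage coord A -> g_sigma_preimage coord (~` A).
Proof. exact: sigma_algebraC. Qed.

Let rV_bigcup (F : _^nat) : (forall i, g_sigma_preimage coord (F i)) ->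
  g_sigma_preimage coord (\bigcup_i (F i)).
Proof. exact: sigma_algebra_bigcup. Qed.

HB.instance Definition _ := @isMeasurable.Build measure_rV_display
  'rV[R]_n (g_sigma_preimage coord) rV_set0 rV_setC rV_bigcup.

End measurable_rV.

Section measurable_rV_lemmas.
Context {R : realType}.

Lemma measurable_coord n (i : 'I_n) :
  measurable_fun [set: 'rV[R]_n]
    (fun x : 'rV[R]_n => x ord0 i : measurableTypeR R).
Proof.
move=> _ Y mY; rewrite setTI; apply: sub_sigma_algebra => /=.
rewrite -bigcup_seq/=; exists i => /=; first by rewrite mem_index_enum.
by exists Y => //; rewrite setTI.
Qed.

Lemma measurable_fun_rV d (T : measurableType d) n (f : T -> 'rV[R]_n) :
  (forall i, measurable_fun [set: T]
     (fun x => f x ord0 i : measurableTypeR R)) ->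
  measurable_fun [set: T] f.
Proof.
move=> mf _ A mA; rewrite setTI.
have : image_set_system setT f measurable A.
  apply: smallest_sub mA.
    exact/sigma_algebra_image/sigma_algebra_measurable.
  rewrite -bigcup_seq; apply: bigcup_sub => i _ _ [B mB <-].
  by rewrite /image_set_system/= !setTI -[X in measurable X]setTI; exact: mf.
by rewrite /image_set_system/= setTI.
Qed.

Definition rV_cons n (p : measurableTypeR R * 'rV[R]_n) : 'rV[R]_n.+1 :=
  \row_i oapp (fun j => p.2 ord0 j) p.1 (unlift ord0 i).

Definition rV_uncons n (x : 'rV[R]_n.+1) : measurableTypeR R * 'rV[R]_n :=
  (x ord0 ord0, \row_i x ord0 (lift ord0 i)).

Lemma rV_consK n : cancel (@rV_cons n) (@rV_uncons n).
Proof.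
move=> [x v]; rewrite /rV_uncons /rV_cons/=; congr (_, _).
  by rewrite mxE unlift_none.
by apply/rowP => i; rewrite !mxE liftK.
Qed.

Lemma measurable_rV_cons n : measurable_fun setT (@rV_cons n).
Proof.
apply: measurable_fun_rV => i; under eq_fun do rewrite mxE.
case: unliftP => [j _|_] /=; last exact: measurable_fst.
exact: (measurableT_comp (measurable_coord j) measurable_snd).
Qed.

Lemma measurable_rV_uncons n : measurable_fun setT (@rV_uncons n).
Proof.
apply/measurable_fun_pairP; split; first exact: measurable_coord.
apply: measurable_fun_rV => i; under eq_fun do rewrite mxE.
exact: measurable_coord.
Qed.

End measurable_rV_lemmas.

(* Lebesgue measure on R^n: the n-fold product of the Lebesgue measure on R,
   carried to row vectors one coordinate at a time. *)
Section lebesgue_cons.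
Context {R : realType} (n : nat).
Variable mu : {sigma_finite_measure set 'rV[R]_n -> \bar R}.

Definition lebesgue_cons : set 'rV[R]_n.+1 -> \bar R :=
  pushforward (lebesgue_measure \x mu)%E (@rV_cons R n).

Let mcons := @measurable_rV_cons R n.

Let lebesgue_cons0 : lebesgue_cons set0 = 0%E.
Proof. exact: measure0. Qed.

Let lebesgue_cons_ge0 A : (0 <= lebesgue_cons A)%E.
Proof. exact: measure_ge0. Qed.

Let lebesgue_cons_sigma_additive : semi_sigma_additive lebesgue_cons.
Proof. exact: measure_semi_sigma_additive. Qed.

HB.instance Definition _ := isMeasure.Build _ _ _ lebesgue_cons
  lebesgue_cons0 lebesgue_cons_ge0 lebesgue_cons_sigma_additive.

Let lebesgue_cons_sigma_finite : sigma_finite setT lebesgue_cons.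
Proof.
have /sigma_finiteP[F [TF ndF Foo]] := sigma_finiteT (@lebesgue_measure R).
have /sigma_finiteP[G [TG ndG Goo]] := sigma_finiteT mu.
exists (fun k => @rV_uncons R n @^-1` (F k `*` G k)).
  rewrite -preimage_bigcup (_ : \bigcup_k _ = setT) ?preimage_setT//.
  rewrite -setXTT TF TG; apply/seteqP; split=> [z [k _ [Fk Gk]]|[x y]].
    by split; exists k.
  move=> [/= [k _ Fkx] [l _ Gly]]; exists (maxn k l) => //; split.
  - by have /subsetPset := ndF _ _ (leq_maxl k l); exact.
  - by have /subsetPset := ndG _ _ (leq_maxr k l); exact.
move=> k; have [mF Fk] := Foo k; have [mG Gk] := Goo k; split.
  rewrite -[X in measurable X]setTI; apply: measurable_rV_uncons => //.
  exact: measurableX.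
rewrite /lebesgue_cons /pushforward -comp_preimage.
rewrite (_ : _ \o _ = id) ?preimage_id; last first.
  by apply/funext => x; exact: rV_consK.
by rewrite product_measure1E// lte_mul_pinfty// ge0_fin_numE.
Qed.

HB.instance Definition _ := Measure_isSigmaFinite.Build _ _ _ lebesgue_cons
  lebesgue_cons_sigma_finite.

End lebesgue_cons.

Fixpoint lebesgue_rV {R : realType} (n : nat) :
    {sigma_finite_measure set 'rV[R]_n -> \bar R} :=
  match n with
  | 0 => dirac (0 : 'rV[R]_0)
  | n'.+1 => lebesgue_cons (lebesgue_rV n')
  end.

Lemma lebesgue_rV_box {R : realType} n (A : 'I_n -> set (measurableTypeR R)) :
  (forall i, measurable (A i)) ->
  lebesgue_rV n [set x : 'rV[R]_n | forall i, A i (x ord0 i)] =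
  (\prod_(i < n) lebesgue_measure (A i))%E.
Proof.
elim: n A => [|n ih] A mA.
  by rewrite big_ord0/= diracE mem_set// => -[].
rewrite big_ord_recl -ih//= /lebesgue_cons /pushforward -product_measure1E//.
- congr (_ _); apply/seteqP; split=> [[x v] /= h|[x v] /= [Ax Av] i].
    split=> [|i]; first by have := h ord0; rewrite mxE unlift_none.
    by have := h (lift ord0 i); rewrite mxE liftK.
  by rewrite mxE; case: unliftP => [j ->|->].
- rewrite [X in measurable X](_ : _ = \bigcap_(i in [set: 'I_n])
    ((fun v : 'rV[R]_n => v ord0 i : measurableTypeR R) @^-1` A (lift ord0 i))).
    apply: fin_bigcap_measurable => // i _; rewrite -[X in measurable X]setTI.
    exact: measurable_coord.
  by apply/seteqP; split=> v /= h i; [move=> _; exact: h|exact: (h i)].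
Qed.

Section derivatives.
Context {R : realType}.

(* Derivative relative to a set, so that on [0, +oo[ the values of f at negative
   arguments play no role and the derivative at 0 is the right derivative. *)
Definition derivable_within (D : set R) (f : R -> R) (x : R) :=
  cvg ((f y - f x) / (y - x) @[y --> within (D `\ x) (nbhs x)]).

Definition derive_within (D : set R) (f : R -> R) (x : R) : R :=
  lim ((f y - f x) / (y - x) @[y --> within (D `\ x) (nbhs x)]).

Definition C1_within (D : set R) (f : R -> R) :=
  (forall x, D x -> derivable_within D f x) /\
  {within D, continuous (derive_within D f)}.

(* for D open *)
Definition C2_line (D : set R) (f : R -> R) :=
  forall x, D x -> [/\ derivable f x 1, derivable f^`() x 1 &
                       {for x, continuous f^`(2)}].

Definition basis_rV n (i : 'I_n) : 'rV[R]_n := delta_mx ord0 i.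

(* for D open *)
Definition C2_space n (D : set 'rV[R]_n) (u : 'rV[R]_n -> R) :=
  forall x, D x ->
  [/\ {for x, continuous u},
      forall i, derivable u x (basis_rV i) /\
        {for x, continuous ('D_(basis_rV i) u)} &
      forall i j, derivable ('D_(basis_rV j) u) x (basis_rV i) /\
        {for x, continuous ('D_(basis_rV i) ('D_(basis_rV j) u))}].

Definition laplacian n (u : 'rV[R]_n -> R) (x : 'rV[R]_n) : R :=
  \sum_(i < n) 'D_(basis_rV i) ('D_(basis_rV i) u) x.

End derivatives.

Section uniformly_local_L1.
Context {R : realType} {n : nat}.
Implicit Types (u : 'rV[R]_n -> R) (x z : 'rV[R]_n).

(* The library's norm `|x| on row vectors is the sup norm; it induces the same
   topology and uniformity as the Euclidean one. *)
Definition enorm x : R := Num.sqrt (\sum_(i < n) x ord0 i ^+ 2).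

Definition eball z (r : R) : set 'rV[R]_n := [set y | enorm (z - y) < r].

Definition L1_loc u :=
  measurable_fun [set: 'rV[R]_n] u /\
  forall K, compact K -> (\int[lebesgue_rV n]_(x in K) `|u x|%:E < +oo)%E.

Definition L1_ul_norm u : \bar R :=
  ereal_sup (range (fun z => \int[lebesgue_rV n]_(x in eball z 1) `|u x|%:E)%E).

Definition L1_ul u := L1_loc u /\ (L1_ul_norm u < +oo)%E.

Definition BUC u := bounded_fun u /\ unif_continuous u.

Definition L1_ul_closure_BUC u := L1_ul u /\
  forall e : R, 0 < e ->
    exists2 v : 'rV[R]_n -> R, BUC v & (L1_ul_norm (u \- v)%R < e%:E)%E.

End uniformly_local_L1.

Definition sobolev_exponent (R : realType) (N : nat) : R :=
  (N%:R + 2) / (N%:R - 2).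

(* Only the values of u off the origin are constrained: for x != 0 the
   derivatives at x are determined by u on a neighbourhood avoiding 0. *)
Record singular_solution (R : realType) (N : nat) (f : R -> R)
    (u : 'rV[R]_N -> R) : Prop := {
  singular_C2 : C2_space [set x | x != 0] u ;
  singular_eq : forall x, x != 0 -> laplacian u x + f (u x) = 0 ;
  singular_ge0 : forall x, x != 0 -> 0 <= u x ;
  singular_radial : forall x y, x != 0 -> y != 0 -> enorm x = enorm y ->
    u x = u y ;
  singular_oo : u x @[x --> (0 : 'rV[R]_N)^'] --> +oo }.

Definition tail_integral (R : realType) (f : R -> R) (u : R) : R :=
  \int[lebesgue_measure]_(s in `[u, +oo[) (f s)^-1.

(* Inverse of tail_integral f on ]0, +oo[; only its values on the image of that
   interval are meaningful. *)
Definition tail_integral_inv (R : realType) (f : R -> R) : R -> R :=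
  'pinv_(fun=> 0) `]0, +oo[ (tail_integral f).

(* Main.v *)
(* Write [u x = U (ln |x|)] and [k = N - 2]; the equation becomes
   [U'' + k U' + e^{2s} f U = 0] with [U -> +oo] as [s -> -oo]. In the variables
   [E = e^{2s} / (2 k F U)] and [y = - U' / (f U * F U)] it reads
   [E' = E (2 - y)], [y' = k (2 E - y) - (1 - f'(U) F U) y^2]. The hypotheses on
   [ln f] give [f' F <= 1] and [f' F -> 1], so this is a vanishing perturbation of
   an autonomous system with equilibrium (1, 2), for which [lyap] is a strict
   Lyapunov function. Hence [E -> 1] along every singular solution, which is the
   claimed asymptotics. The difference of two solutions near the equilibrium
   solves a linear equation for which a quadratic form decays exponentially:
   bounded at -oo, it must vanish (uniqueness), and the solutions started at
   [s = - n] from the equilibrium form a Cauchy sequence (existence).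
   Positivity for all [s] comes from the Pohozaev functional, which is where (4)
   enters, and membership in the closure of BUC from the logarithmic growth of
   [u] at the origin and from truncating [|x|] below. *)
Require Import Defs.
From mathcomp Require Import all_boot all_order all_algebra.
From mathcomp Require Import all_classical all_reals all_analysis.
From mathcomp Require Import measurable_realfun.
From mathcomp Require Import ring lra.
Set Implicit Arguments.
Unset Strict Implicit.
Unset Printing Implicit Defensive.
Import Order.TTheory GRing.Theory Num.Theory.
Import numFieldNormedType.Exports.
Local Open Scope ring_scope.
Local Open Scope classical_set_scope.

(** * Calculus on the line *)

Section calculus.
Context {R : realType}.
Implicit Types (f g h : R -> R) (x a b : R).

(** The equilibrium attracts as [s] increases, so estimates are read backward: a quantity that
    decays forward must grow toward -oo, where an a priori bound excludes it. Two obstacles shape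
    the argument. First, the estimates on [lyap] hold on [0 < E <= 3], [0 <= y <= 7], so these
    bounds come first: the one on [E] from integrating the flux [r^{N-1} u_r] and then the
    derivative of [F U], the one on [y] from its own equation. Second, [lyap] is unbounded on that
    region because of [- ln E], so sliding toward [E = 0] has to be excluded separately, by the
    blow-up of [U]. For the difference of two solutions the bound at -oo uses no rate in [E -> 1]:
    [ln (F U)] is known up to a bounded error, and [f F <= C] turns this into a bounded error on
    [U]. The sign of [U] is unknown until the Pohozaev argument, so the equation is first solved
    with [f] extended by zero to negative arguments. *)

Lemma der_eq f x a b : is_derive x 1 f a -> a = b -> is_derive x 1 f b.
Proof. by move=> fa <-. Qed.

Lemma der_cst x a : is_derive x (1 : R) (fun=> a) 0.
Proof. exact: is_derive_cst. Qed.

Lemma der_id x : is_derive x (1 : R) (fun y : R => y) 1.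
Proof. exact: is_derive_id. Qed.

Lemma derD f g x a b : is_derive x 1 f a -> is_derive x 1 g b ->
  is_derive x 1 (fun y => f y + g y) (a + b).
Proof. by move=> ? ?; apply: is_deriveD. Qed.

Lemma derN f x a : is_derive x 1 f a -> is_derive x 1 (fun y => - f y) (- a).
Proof. by move=> ?; apply: is_deriveN. Qed.

Lemma derB f g x a b : is_derive x 1 f a -> is_derive x 1 g b ->
  is_derive x 1 (fun y => f y - g y) (a - b).
Proof. by move=> ? ?; apply: is_deriveB. Qed.

Lemma derM f g x a b : is_derive x 1 f a -> is_derive x 1 g b ->
  is_derive x 1 (fun y => f y * g y) (a * g x + f x * b).
Proof.
move=> fa gb; have H := is_deriveM fa gb.
rewrite (_ : (fun y => f y * g y) = f * g)//.
by apply: is_derive_eq; rewrite /GRing.scale/= addrC [g x * a]mulrC.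
Qed.

Lemma derZ (c : R) f x a : is_derive x 1 f a ->
  is_derive x 1 (fun y => c * f y) (c * a).
Proof. by move=> fa; have := derM (der_cst x c) fa; rewrite mul0r add0r. Qed.

Lemma derV f x a : is_derive x 1 f a -> f x != 0 ->
  is_derive x 1 (fun y => (f y)^-1) (- (a / f x ^+ 2)).
Proof.
move=> fa fx; have H := is_deriveV fx fa.
by apply: is_derive_eq; rewrite /GRing.scale/= mulNr mulrC.
Qed.

Lemma der_comp f g x a b : is_derive (g x) 1 f a -> is_derive x 1 g b ->
  is_derive x 1 (fun y => f (g y)) (a * b).
Proof. by move=> ? ?; apply: is_derive1_comp. Qed.

Lemma derX2 f x a : is_derive x 1 f a ->
  is_derive x 1 (fun y => f y ^+ 2) (2 * f x * a).
Proof.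
move=> fa; have H := derM fa fa; rewrite (_ : (fun y => _) = fun y => f y * f y).
  by apply: der_eq H _; ring.
by apply/funext => y; rewrite expr2.
Qed.

Lemma der_exp f x a : is_derive x 1 f a ->
  is_derive x 1 (fun y => expR (f y)) (expR (f x) * a).
Proof. by move=> fa; apply: der_comp. Qed.

Lemma der_expZ (c : R) x :
  is_derive x 1 (fun y => expR (c * y)) (c * expR (c * x)).
Proof.
apply: der_eq (der_exp (derZ c (der_id x))) _.
by rewrite mulr1 mulrC.
Qed.

Lemma der_ln f x a : 0 < f x -> is_derive x 1 f a ->
  is_derive x 1 (fun y => ln (f y)) (a / f x).
Proof.
move=> fx fa; apply: der_eq; last first.
  2: by apply: der_comp fa; exact: is_derive1_ln.
by rewrite mulrC.
Qed.

Lemma der_continuous f x a : is_derive x 1 f a -> {for x, continuous f}.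
Proof.
by move=> [fx _]; apply/differentiable_continuous/derivable1_diffP.
Qed.

Lemma mvt (f df : R -> R) a b : a < b ->
  (forall x, a <= x <= b -> {for x, continuous f}) ->
  (forall x, a < x < b -> is_derive x 1 f (df x)) ->
  exists2 c, a < c < b & f b - f a = df c * (b - a).
Proof.
move=> ab cf dfab; have fd x : x \in `]a, b[%R -> is_derive x 1 f (df x).
  by rewrite in_itv/= => /dfab.
have fc : {within `[a, b], continuous f}.
  by apply: continuous_in_subspaceT => x; rewrite inE/= in_itv/=; exact: cf.
have [c cab e] := MVT ab fd fc.
by exists c => //; move: cab; rewrite in_itv.
Qed.

Lemma der_mono f df a b : a <= b ->
  (forall x, a <= x <= b -> is_derive x 1 f (df x)) ->
  (forall x, a < x < b -> 0 <= df x) -> f a <= f b.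
Proof.
rewrite le_eqVlt => /orP[/eqP-> //|ab] fd df0.
have [x h|x /andP[? ?]|c cab e] := @mvt f df a b ab.
- exact: der_continuous (fd x h).
- by apply: fd; rewrite !ltW.
by rewrite -subr_ge0 e mulr_ge0 ?df0 ?subr_ge0 ?ltW.
Qed.

Lemma der_compare f g df dg a b : a <= b ->
  (forall x, a <= x <= b -> is_derive x 1 f (df x)) ->
  (forall x, a <= x <= b -> is_derive x 1 g (dg x)) ->
  (forall x, a < x < b -> df x <= dg x) -> f b - f a <= g b - g a.
Proof.
move=> ab fd gd le.
have : g a - f a <= g b - f b.
  apply: (@der_mono (fun x => g x - f x) (fun x => dg x - df x) a b ab) => x h.
    by apply: derB; [exact: gd|exact: fd].
  by rewrite subr_ge0 le.
lra.
Qed.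

Lemma continuous_near_gt f x (w : R) : {for x, continuous f} -> w < f x ->
  exists2 d : R, 0 < d & forall y, `|x - y| < d -> w < f y.
Proof.
move=> cf wf; have : \forall y \near x, w < f y.
  exact: (cf _ (lt_nbhsr wf)).
by move=> /nbhs_ballP[d /= d0 H]; exists d => // y xy; apply: H.
Qed.

Lemma last_time (W : R -> R) a t (w : R) :
  (forall s, a <= s <= t -> {for s, continuous W}) -> w < W t ->
  (exists2 s, a <= s <= t & W s <= w) ->
  exists s1, [/\ a <= s1, s1 < t, W s1 <= w & forall s, s1 < s <= t -> w < W s].
Proof.
move=> cW Wt [s0 /andP[as0 s0t] Ws0].
pose S := [set s | a <= s <= t /\ W s <= w].
have S0 : S s0 by split => //; rewrite as0.
have ubS : ubound S t by move=> s [/andP[]].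
have hs : has_sup S by split; [exists s0|exists t].
set s1 := sup S.
have s01 : s0 <= s1 by apply: ub_le_sup => //; exists t.
have s1t : s1 <= t by apply: ge_sup => //; exists s0.
have W1 : W s1 <= w.
  rewrite leNgt; apply/negP => W1.
  have [|d d0 H] := continuous_near_gt (cW s1 _) W1.
    by rewrite (le_trans as0 s01).
  have [s Ss sd] := sup_adherent d0 hs.
  have : w < W s.
    apply: H; rewrite ger0_norm ?subr_ge0; last by apply: ub_le_sup => //; exists t.
    by rewrite ltrBlDr addrC -ltrBlDr.
  by rewrite ltNge; case: Ss => _ ->.
exists s1; split => //.
- exact: le_trans s01.
- rewrite lt_neqAle s1t andbT; apply/eqP => e.
  by move: Wt; rewrite ltNge -e W1.
- move=> s /andP[s1s st]; rewrite ltNge; apply/negP => Ws.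
  have := s1s; rewrite ltNge => /negP; apply; apply: ub_le_sup; first by exists t.
  by split => //; rewrite st (le_trans as0)// (le_trans s01)// ltW.
Qed.


(** The reflection [s -> - s] reduces this to [last_time]. That lemma only gives [m s1 <= 0];
    equality holds because a negative value would persist slightly to the left of [s1], where [m] is
    positive. *)
Lemma first_time (m : R -> R) a b :
  (forall s, a <= s <= b -> {for s, continuous m}) -> 0 < m a ->
  (exists2 s, a <= s <= b & m s <= 0) ->
  exists s1, [/\ a < s1, s1 <= b, m s1 = 0 & forall s, a <= s < s1 -> 0 < m s].
Proof.
move=> cm ma [s0 /andP[as0 s0b] ms0].
have [|||s1 [h1 h2 h3 h4]] := @last_time (fun s => m (- s)) (- b) (- a) 0.
- move=> s /andP[? ?]; apply: continuous_comp; first exact: opp_continuous.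
  by apply: cm; rewrite lerNr lerNl; apply/andP.
- by rewrite opprK.
- by exists (- s0); rewrite ?opprK// !lerN2 s0b.
have H s : a <= s < - s1 -> 0 < m s.
  by move=> /andP[? ?]; rewrite -(opprK s); apply: h4; rewrite ltrNr lerN2; apply/andP.
have as1 : a < - s1 by rewrite ltrNr.
have s1b : - s1 <= b by rewrite lerNl.
exists (- s1); split => //; apply/eqP; rewrite eq_le h3/= leNgt; apply/negP => ms1.
have [||d d0 Hd] := @continuous_near_gt (fun s => - m s) (- s1) 0.
- by apply: continuousN; apply: cm; rewrite (ltW as1).
- by rewrite oppr_gt0.
pose z := Num.max a (- s1 - d / 2).
have az : a <= z by rewrite le_max lexx.
have zs : z < - s1 by rewrite gt_max as1; lra.
have dz : - s1 - d / 2 <= z by rewrite le_max lexx orbT.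
have : 0 < - m z by apply: Hd; rewrite ger0_norm; lra.
have : 0 < m z by apply: H; rewrite az.
lra.
Qed.

(* Read backward from [t], [W] can only increase as long as it exceeds [w]. *)
Lemma barrier (W dW : R -> R) a t (w c : R) : a <= t -> 0 <= c ->
  (forall s, a <= s <= t -> is_derive s 1 W (dW s)) ->
  (forall s, a <= s <= t -> w < W s -> dW s <= - c) ->
  w < W t -> W t + c * (t - a) <= W a.
Proof.
move=> at_ c0 Wd Wc Wt.
have H s : a <= s <= t -> w < W s.
  move=> ast; rewrite ltNge; apply/negP => Ws.
  have [|||s1 [as1 s1t Ws1 Hs1]] := @last_time W a t w.
  - by move=> ? /Wd/der_continuous.
  - by [].
  - by exists s.
  have [x /andP[? ?]|x /andP[? ?]|y /andP[y1 y2] e] := @mvt W dW s1 t s1t.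
  - by apply: (der_continuous (Wd _ _)); rewrite (le_trans as1).
  - by apply: Wd; rewrite (le_trans as1) ltW.
  have : dW y * (t - s1) <= 0.
    apply: mulr_le0_ge0; last by rewrite subr_ge0 ltW.
    apply: (@le_trans _ _ (- c)); last by rewrite oppr_le0.
    apply: Wc; first by rewrite (le_trans as1) ltW.
    by apply: Hs1; rewrite y1 ltW.
  by rewrite -e; lra.
have : W t - W a <= - c * t - - c * a.
  apply: (@der_compare W (fun s => - c * s) dW (fun=> - c) a t at_ Wd).
    by move=> x _; have := derZ (- c) (der_id x); rewrite mulr1.
  by move=> x /andP[? ?]; apply: Wc; [|apply: H]; rewrite !ltW.
lra.
Qed.

Lemma antiderivative h : continuous h ->
  exists H : R -> R, forall x, is_derive x 1 H (h x).
Proof.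
move=> ch; pose mu := @lebesgue_measure R.
pose I a b := \int[mu]_(t in `[a, b]) h t.
have ih a b : mu.-integrable `[a, b] (EFin \o h).
  apply: continuous_compact_integrable; first exact: segment_compact.
  exact: continuous_subspaceT.
have Iadd a b c : a <= b -> b <= c -> I a c = I a b + I b c.
  move=> ab bc; rewrite /I -(@Rintegral_itv_obnd_cbnd _ b); last first.
    by apply: integrableS (ih b c) => //; apply: subset_itvr; rewrite bnd_simp.
  by rewrite -(@Rintegral_itvB _ h (BLeft a) (BRight c) b) ?bnd_simp//; ring.
(* One of the two integrals is always over an empty or one-point interval, so this is the oriented
   integral from 0. Near [x] it differs by a constant from the integral from [a], which lies below
   both [x] and 0. *)
exists (fun x => I 0 x - I x 0) => x.
pose a := Num.min x 0 - 1.
have ax : a < x by rewrite /a ltrBlDr ltr_pwDr// ge_min lexx.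
have a0 : a < 0 by rewrite /a ltrBlDr ltr_pwDr// ge_min lexx orbT.
apply: (@near_eq_is_derive _ _ _ (fun y => I a y - I a 0)).
  near=> y; have ay : a < y by near: y; exact: lt_nbhsr.
  have e0 (b c : R) : c < b -> I b c = 0.
    by move=> cb; rewrite /I set_itv_ge ?Rintegral_set0// -leNgt bnd_simp.
  have e1 (b : R) : I b b = 0 by rewrite /I set_itv1 Rintegral_set1.
  case: (ltgtP y 0) => y0.
  - by rewrite (e0 0 y)// (Iadd a y 0) ?ltW//; ring.
  - by rewrite (e0 y 0)// (Iadd a 0 y) ?ltW//; ring.
  - by rewrite y0 e1; ring.
have x1 : x < x + 1 by rewrite ltrDl.
have [dI vI] := @continuous_FTC1_closed R h a x (x + 1) x1 (ih _ _) ax (ch x).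
have dIx : is_derive x 1 (I a) (h x) by apply: DeriveDef => //; rewrite -derive1E.
by have := derB dIx (der_cst x (I a 0)); rewrite subr0.
Unshelve. all: by end_near. Qed.

End calculus.

(** * Consequences of the hypotheses on the nonlinearity *)

(** The hypotheses constrain [f] on the half-line only; this extension is continuous and
    nondecreasing on the whole line, so the equation makes sense before solutions are known to be
    positive. *)
Definition ext0 {R : realType} (f : R -> R) (u : R) : R := f (Num.max u 0).

(* [f1] is the derivative of [f], [F] its tail integral and [Phi] its primitive
   (extended by 0 to the left); [nl_Phi] is the Pohozaev condition (4). *)
Record nonlinearity {R : realType} (k : R) (f f1 F Phi : R -> R) : Prop := {
  nl_k : 1 <= k ;
  nl_cont : continuous (ext0 f) ;
  nl_f0 : f 0 = 0 ;
  nl_der : forall u : R, 0 < u -> is_derive u 1 f (f1 u) ;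
  nl_f1 : forall u : R, 0 < u -> 0 < f1 u ;
  nl_f1_mono : forall u v : R, 0 < u -> u <= v -> f1 u <= f1 v ;
  nl_pos : forall u : R, 0 < u -> 0 < f u ;
  nl_F_der : forall u : R, 0 < u -> is_derive u 1 F (- (f u)^-1) ;
  nl_F : forall u : R, 0 < u -> 0 < F u ;
  nl_F_lim : forall e : R, 0 < e -> exists2 B, 0 < B & forall u : R, B <= u -> F u < e ;
  nl_tail : exists U0 C, [/\ 0 < U0, 0 < C & forall u : R, U0 <= u ->
    f1 u * F u <= 1 /\ f u * F u <= C] ;
  nl_theta : forall e : R, 0 < e ->
    exists2 B, 0 < B & forall u : R, B <= u -> 1 - f1 u * F u <= e ;
  nl_Phi_der : forall u : R, is_derive u 1 Phi (ext0 f u) ;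
  nl_Phi0 : Phi 0 = 0 ;
  nl_Phi : forall u : R, 0 <= u -> (k + 2) * 2 * Phi u <= k * (u * f u) }.

Lemma convex_mid {R : realType} (D : set R) (g : R -> R) (x y : R) :
  @convex_function R R^o D g -> D x -> D y -> g ((x + y) / 2) <= (g x + g y) / 2.
Proof.
move=> cvx Dx Dy; have t0 : 0 <= (2^-1 : R) by lra.
have t1 : (2^-1 : R) <= 1 by lra.
have := cvx (Itv01 t0 t1) x y (mem_set Dx) (mem_set Dy).
have h2 : 1 - 2^-1 = 2^-1 :> R by lra.
rewrite convRE/= /conv/= /unstable.onem h2 /GRing.scale/=.
have -> : 2^-1 * x + 2^-1 * y = (x + y) / 2 by field.
by have -> : 2^-1 * g x + 2^-1 * g y = (g x + g y) / 2 by field.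
Qed.

Section nonlinearity.
Context {R : realType}.
Implicit Types (u v w x y s t e : R).
Variable f : R -> R.
Hypothesis f_C1 : derivable_within `[0, +oo[ f 0.
Hypothesis f_C2 : C2_line `]0, +oo[ f.
Hypothesis f0 : f 0 = 0.
Hypothesis f'_gt0 : forall u : R, 0 < u -> 0 < f^`() u.
Hypothesis f''_gt0 : forall u : R, 0 < u -> 0 < f^`(2) u.

Let f1 := f^`().
Let f2 := f^`(2).

Let fd u : 0 < u -> is_derive u 1 f (f1 u).
Proof.
move=> u0; have [|df _ _] := @f_C2 u; first by rewrite /= in_itv/= u0.
by rewrite /f1 derive1E; apply: derivableP.
Qed.

Let f1d u : 0 < u -> is_derive u 1 f1 (f2 u).
Proof.
move=> u0; have [|_ df _] := @f_C2 u; first by rewrite /= in_itv/= u0.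
by rewrite /f2 derive1Sn derive1n1 derive1E; apply: derivableP.
Qed.

Let f2c u : 0 < u -> {for u, continuous f2}.
Proof. by move=> u0; have [|//] := @f_C2 u; rewrite /= in_itv/= u0. Qed.

Lemma ext0_nneg u : 0 <= u -> ext0 f u = f u.
Proof. by move=> u0; rewrite /ext0 max_l. Qed.

Lemma ext0_npos u : u <= 0 -> ext0 f u = 0.
Proof. by move=> u0; rewrite /ext0 max_r. Qed.

Lemma ext0_continuous : continuous (ext0 f).
Proof.
move=> x; case: (ltgtP x 0) => [x0|x0|->].
- apply: (@der_continuous _ _ _ 0).
  apply: (@near_eq_is_derive _ _ _ (cst 0)).
  near=> y; rewrite ext0_npos// ltW//; near: y; exact: lt_nbhsl.
- apply: (@der_continuous _ _ _ (f1 x)).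
  apply: near_eq_is_derive (fd x0).
  near=> y; rewrite ext0_nneg// ltW//; near: y; exact: lt_nbhsr.
(* At 0 only the one-sided difference quotient is available. It is bounded near 0, which gives a
   linear bound on [f] and hence continuity. *)
move/cvg_ex: f_C1 => [l fl].
have /fl/nbhs_ballP[d /= d0 H] : nbhs l (ball l (1 : R)) by exact: nbhsx_ballx.
have {}H y : 0 < y -> y < d -> `|f y| <= (`|l| + 1) * y.
  move=> y0 yd.
  have := H y; rewrite /ball/= sub0r normrN gtr0_norm// => /(_ yd).
  rewrite in_itv/= andbT subr0 f0 subr0 => /(_ (conj (ltW y0) _)) {}H.
  have {H} : `|l - f y / y| < 1 by apply: H; apply/eqP; rewrite gt_eqF.
  have -> : `|f y| = `|f y / y| * y by rewrite normrM normfV (gtr0_norm y0) mulfVK// gt_eqF.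
  move=> H; rewrite ler_pM2r//.
  by have := ler_normD (f y / y - l) l; rewrite subrK distrC; lra.
apply/cvgrPdist_le => e e0; rewrite ext0_npos// .
have l1 : 0 < `|l| + 1 by rewrite ltr_wpDl.
near=> y; rewrite sub0r normrN; case: (leP y 0) => y0.
  by rewrite ext0_npos// normr0 ltW.
have yd : y < d.
  by near: y; exact: lt_nbhsl.
have ye : y < e / (`|l| + 1).
  by near: y; apply: lt_nbhsl; rewrite divr_gt0.
rewrite (ext0_nneg (ltW y0)) (le_trans (H _ y0 yd))//.
by rewrite mulrC -ler_pdivlMr// ltW.
Unshelve. all: by end_near. Qed.

Lemma f_gt0 u : 0 < u -> 0 < f u.
Proof.
move=> u0; have [x _|x /andP[x0 _]|c /andP[c0 _]] := @mvt _ (ext0 f) f1 0 u u0.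
- exact: ext0_continuous.
- apply: near_eq_is_derive (fd x0).
  near=> y; rewrite ext0_nneg// ltW//; near: y; exact: lt_nbhsr.
- rewrite (ext0_nneg (ltW u0)) (ext0_nneg (lexx 0)) f0 !subr0 => ->.
  by rewrite mulr_gt0// /f1 f'_gt0.
Unshelve. all: by end_near. Qed.

Lemma f1_mono u v : 0 < u -> u <= v -> f1 u <= f1 v.
Proof.
move=> u0 uv; apply: (@der_mono _ f1 f2 u v uv) => x /andP[ux _].
- by apply: f1d; exact: lt_le_trans ux.
- by rewrite ltW// /f2 f''_gt0// (lt_trans u0).
Qed.

Lemma f_mono u v : 0 < u -> u <= v -> f u <= f v.
Proof.
move=> u0 uv; apply: (@der_mono _ f f1 u v uv) => x /andP[ux _].
- by apply: fd; exact: lt_le_trans ux.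
- by rewrite ltW// /f1 f'_gt0// (lt_trans u0).
Qed.

Let lnf1 u : 0 < u -> is_derive u 1 (fun u => ln (f u)) (f1 u / f u).
Proof. by move=> u0; apply: der_ln; [exact: f_gt0|exact: fd]. Qed.

Let G2 u := (f2 u * f u - f1 u ^+ 2) / f u ^+ 2.

Let lnf2 u : 0 < u -> is_derive u 1 (fun u => f1 u / f u) (G2 u).
Proof.
move=> u0; have fu := f_gt0 u0.
apply: der_eq (derM (f1d u0) (derV (fd u0) (lt0r_neq0 fu))) _.
by rewrite /G2; field; rewrite gt_eqF.
Qed.

Let G2c u : 0 < u -> {for u, continuous G2}.
Proof.
move=> u0; have fu := f_gt0 u0.
have cf := der_continuous (fd u0); have cf1 := der_continuous (f1d u0).
apply: continuousM.
  apply: continuousB; first by apply: continuousM => //; exact: f2c.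
  by apply: continuousM.
by apply: continuousV; [rewrite expf_neq0// gt_eqF|apply: continuousM].
Qed.

(** The inequality is the nonnegativity of [G2], the second derivative of [ln f]. Were [G2] negative
    at [x], it would be so nearby; a mean value on each side of [x] and a third one between them
    make the second difference of [ln f] at [x] negative, against midpoint convexity. *)
Lemma log_convex_ge0 u0 : 0 < u0 ->
  @convex_function R R^o `[u0, +oo[ (fun u : R => ln (f u)) ->
  forall u, u0 < u -> f1 u ^+ 2 <= f u * f2 u.
Proof.
move=> u00 cvx x ux; have x0 := lt_trans u00 ux; have fx := f_gt0 x0.
suff : 0 <= G2 x.
  by rewrite /G2 pmulr_lge0 ?invr_gt0 ?exprn_gt0// subr_ge0 mulrC.
rewrite leNgt; apply/negP => Gx.
have [||d d0 Hd] := @continuous_near_gt R (fun u => - G2 u) x 0.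
- by apply: continuousN; exact: G2c.
- by rewrite oppr_gt0.
pose h := Num.min d (x - u0) / 2.
have m0 : 0 < Num.min d (x - u0) by rewrite lt_min d0 subr_gt0.
have h0 : 0 < h by rewrite divr_gt0.
have m1 : Num.min d (x - u0) <= d by rewrite ge_min lexx.
have hd : h < d by rewrite /h; lra.
have m2 : Num.min d (x - u0) <= x - u0 by rewrite ge_min lexx orbT.
have hx : h < x - u0 by rewrite /h; lra.
have c1 : x < x + h by lra.
have c2 : x - h < x by lra.
have [||y1 /andP[y11 y12] e1] := @mvt _ (fun u => ln (f u)) (fun u => f1 u / f u) x (x + h) c1.
- by move=> s /andP[s1 s2]; apply: (der_continuous (lnf1 _)); lra.
- by move=> s /andP[s1 s2]; apply: lnf1; lra.
have [||y2 /andP[y21 y22] e2] := @mvt _ (fun u => ln (f u)) (fun u => f1 u / f u) (x - h) x c2.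
- by move=> s /andP[s1 s2]; apply: (der_continuous (lnf1 _)); lra.
- by move=> s /andP[s1 s2]; apply: lnf1; lra.
have c3 : y2 < y1 by lra.
have [||y3 /andP[y31 y32] e3] := @mvt _ (fun u => f1 u / f u) G2 y2 y1 c3.
- by move=> s /andP[s1 s2]; apply: (der_continuous (lnf2 _)); lra.
- by move=> s /andP[s1 s2]; apply: lnf2; lra.
have G3 : 0 < - G2 y3 by apply: Hd; rewrite ltr_norml; apply/andP; lra.
have := @convex_mid _ _ _ (x - h) (x + h) cvx.
have -> : (x - h + (x + h)) / 2 = x by field.
have D1 : `[u0, +oo[ (x - h) by rewrite /= in_itv/= andbT; lra.
have D2 : `[u0, +oo[ (x + h) by rewrite /= in_itv/= andbT; lra.
move=> /(_ D1 D2); set a1 := ln (f (x - h)); set a2 := ln (f (x + h)).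
have : (f1 y1 / f y1 - f1 y2 / f y2) * h < 0.
  by rewrite pmulr_llt0// e3 pmulr_llt0; lra.
have e2' : x - (x - h) = h by ring.
move: e1 e2; rewrite -/a1 -/a2 e2'.
have -> : x + h - x = h by ring.
rewrite mulrBl; set p1 := (_ * h); set p2 := (_ * h); lra.
Qed.


(** * The tail integral [F] and its comparison with [1 / f'] *)

Section tail.
Variable u0 : R.
Hypothesis u0_gt0 : 0 < u0.
Hypothesis log_convex : forall u, u0 < u -> f1 u ^+ 2 <= f u * f2 u.
Hypothesis g_lim : f u * f2 u / f1 u ^+ 2 @[u --> +oo] --> (1 : R).

(** Log-convexity is available strictly to the right of [u0]; the shift yields a closed half-line
    inside that range. *)
Let U0 := u0 + 1.
Let U0_gt0 : 0 < U0. Proof. by have := u0_gt0; rewrite /U0; lra. Qed.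

Let invf1d u : 0 < u -> is_derive u 1 (fun u => (f1 u)^-1) (- (f2 u / f1 u ^+ 2)).
Proof. by move=> uu; apply: (derV (f1d uu)); rewrite gt_eqF// /f1 f'_gt0. Qed.

(** The derivative of [f / f'] is [1 - f f'' / f'^2], nonpositive by log-convexity. Together with
    [F <= 1 / f'] this bounds [f F]. *)
Lemma ratio_le u : U0 <= u -> f u / f1 u <= f U0 / f1 U0.
Proof.
move=> uu; have ux x : U0 <= x -> u0 < x /\ 0 < x by have := u0_gt0; rewrite /U0; lra.
rewrite -lerN2; apply: (@der_mono _ (fun u => - (f u / f1 u))
  (fun u => - (f1 u * (f1 u)^-1 + f u * - (f2 u / f1 u ^+ 2)))) => // x /andP[Ux _].
  have [_ x0] := ux _ Ux.
  by apply: derN; apply: derM; [exact: fd|exact: invf1d].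
have [u0x x0] := ux _ (ltW Ux).
have f1x : 0 < f1 x by rewrite /f1 f'_gt0.
rewrite oppr_ge0 mulrN mulfV ?gt_eqF// subr_le0 mulrA.
by rewrite ler_pdivlMr ?exprn_gt0// mul1r log_convex.
Qed.

Lemma f_unbounded M : exists2 B, U0 <= B & M <= f B.
Proof.
have fU := f_gt0 U0_gt0; have f1U : 0 < f1 U0 by rewrite /f1 f'_gt0.
exists (U0 + `|M| / f1 U0); first by rewrite lerDl divr_ge0// ltW.
have le : U0 <= U0 + `|M| / f1 U0 by rewrite lerDl divr_ge0// ltW.
have : f1 U0 * (U0 + `|M| / f1 U0) - f1 U0 * U0 <= f (U0 + `|M| / f1 U0) - f U0.
  apply: (@der_compare _ (fun x => f1 U0 * x) f (fun=> f1 U0) f1) => //.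
  - by move=> x _; have := derZ (f1 U0) (der_id x); rewrite mulr1.
  - by move=> x /andP[Ux _]; apply: fd; exact: lt_le_trans Ux.
  - by move=> x /andP[Ux _]; apply: f1_mono => //; exact: ltW.
rewrite mulrDr mulrCA divff ?gt_eqF// mulr1 addrAC subrr add0r.
by have := ler_norm M; lra.
Qed.

(** [1 / f'] is the bounded ratio [f / f'] divided by the unbounded [f]. *)
Lemma invf1_small e u : 0 < e -> exists2 v, u <= v & (f1 v)^-1 <= e.
Proof.
move=> e0; have fU := f_gt0 U0_gt0; have f1U : 0 < f1 U0 by rewrite /f1 f'_gt0.
have [B UB fB] := f_unbounded (f U0 / f1 U0 / e).
exists (Num.max u B); first by rewrite le_max lexx.
set v := Num.max u B.
have Bv : B <= v by rewrite le_max lexx orbT.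
have Uv : U0 <= v by exact: le_trans Bv.
have v0 : 0 < v by exact: lt_le_trans Uv.
have fv : f U0 / f1 U0 / e <= f v.
  by apply: le_trans fB _; apply: f_mono => //; exact: lt_le_trans UB.
have f1v : 0 < f1 v by rewrite /f1 f'_gt0.
have r0 : 0 < f U0 / f1 U0 by rewrite divr_gt0.
have fv0 := f_gt0 v0.
have -> : (f1 v)^-1 = f v / f1 v / f v by rewrite mulrAC divff ?gt_eqF// mul1r.
rewrite ler_pdivrMr// (le_trans (ratio_le Uv))//.
by move: fv; rewrite ler_pdivrMr// [_ * e]mulrC.
Qed.

Let invf_exp_continuous : continuous (fun s => expR s / f (expR s)).
Proof.
move=> s; apply: continuousM; first exact: continuous_expR.
apply: continuousV; first by rewrite gt_eqF// f_gt0// expR_gt0.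
apply: continuous_comp; first exact: continuous_expR.
by apply: (der_continuous (fd _)); exact: expR_gt0.
Qed.

(** The derivative of [- 1 / f'] is [f'' / f'^2], which is at least [1 / f] by log-convexity and
    eventually at most [(1 + e) / f] by the limit hypothesis. Integrating over [[u, v]] and letting
    [v] grow gives both comparisons of [F] with [1 / f']; the first also proves that the tail
    integral converges. *)
Lemma tail_nonlinearity : exists2 F : R -> R, forall u, 0 < u -> F u = tail_integral f u &
  [/\ forall u, 0 < u -> is_derive u 1 F (- (f u)^-1),
     forall u, 0 < u -> 0 < F u,
     forall e, 0 < e -> exists2 B, 0 < B & forall u, B <= u -> F u < e &
     (forall u, U0 <= u -> F u <= (f1 u)^-1) /\
     forall e, 0 < e ->
       exists2 B, 0 < B & forall u, B <= u -> (f1 u)^-1 <= (1 + e) * F u].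
Proof.
(* [1 / f] is controlled on the open half-line only, so its antiderivative is obtained on the whole
   line after the substitution [u = expR s]. *)
have [H Hd] := antiderivative invf_exp_continuous.
pose A u := H (ln u).
have Ad u : 0 < u -> is_derive u 1 A (f u)^-1.
  move=> uu; apply: der_eq (der_comp (Hd (ln u)) (is_derive1_ln uu)) _.
  by rewrite lnK ?posrE// mulrAC divff ?gt_eqF// mul1r.
have AE s : A (expR s) = H s by rewrite /A expRK.
have Hmono s t : s <= t -> H s <= H t.
  move=> st; apply: der_mono (fun x _ => Hd x) _ => // x _.
  by rewrite divr_ge0 ?expR_ge0// ltW// f_gt0// expR_gt0.
have Amono u v : 0 < u -> u <= v -> A u <= A v.
  by move=> uu uv; apply: Hmono; rewrite ler_ln ?posrE// (lt_le_trans uu).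
have ux x : U0 <= x -> u0 < x /\ 0 < x by have := u0_gt0; rewrite /U0; lra.
have Abd u v : U0 <= u -> u <= v -> A v - A u <= (f1 u)^-1 - (f1 v)^-1.
  move=> Uu uv; rewrite -[leRHS]opprK opprB.
  rewrite (_ : - (_ - _) = - (f1 v)^-1 - - (f1 u)^-1); last by ring.
  apply: (@der_compare _ A (fun x => - (f1 x)^-1) (fun x => (f x)^-1)
    (fun x => - - (f2 x / f1 x ^+ 2))) => // x /andP[ux1 _].
  - by apply: Ad; have [] := ux x (le_trans Uu ux1).
  - by apply/derN/invf1d; have [] := ux x (le_trans Uu ux1).
  - have [u0x x0] := ux x (le_trans Uu (ltW ux1)).
    rewrite opprK -[leLHS]mul1r ler_pdivrMr ?f_gt0// mulrAC ler_pdivlMr ?exprn_gt0 /f1 ?f'_gt0//.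
    by rewrite mul1r mulrC log_convex.
have hub : has_ubound (range H).
  exists (A U0 + (f1 U0)^-1) => _ [s _ <-]; rewrite -AE.
  have f1U : 0 < f1 U0 by rewrite /f1 f'_gt0.
  case: (leP (expR s) U0) => [sU|/ltW sU].
    by rewrite (le_trans (Amono _ _ (expR_gt0 _) sU))// lerDl invr_ge0 ltW.
  have f1s : 0 < f1 (expR s) by rewrite /f1 f'_gt0 ?expR_gt0.
  have := Abd _ _ (lexx U0) sU; have := invr_gt0 (f1 (expR s)); rewrite f1s.
  by lra.
pose l := sup (range H).
have Hl s : H s <= l by apply: ub_le_sup => //; exists s.
have Al u : 0 < u -> A u <= l by move=> _; exact: Hl.
have ladh e : 0 < e -> exists2 s, 0 < s & forall u, s <= u -> l - e < A u.
  move=> e0; have [|_ [s _ <-] Hs] := @sup_adherent _ (range H) e e0.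
    by split => //; exists (H 0), 0.
  exists (expR s); first exact: expR_gt0.
  move=> u su; apply: lt_le_trans Hs _.
  by rewrite -AE Amono// expR_gt0.
exists (fun u => l - A u).
  move=> u uu; rewrite /tail_integral.
  rewrite (@Rintegral_ge0_continuous_FTC2y _ (fun s => (f s)^-1) A u l)//.
  - by move=> x ux1; rewrite invr_ge0 ltW// f_gt0// (lt_le_trans uu).
  - apply: continuous_in_subspaceT => x; rewrite inE/= in_itv/= andbT => ux1.
    have x0 := lt_le_trans uu ux1.
    apply: continuousV; first by rewrite gt_eqF// f_gt0.
    exact: (der_continuous (fd x0)).
  - apply/cvgrPdist_lt => e e0; have [s s0 Hs] := ladh _ e0.
    near=> x; have sx : s <= x by near: x; apply: nbhs_pinfty_ge; exact: num_real.
    have x0 : 0 < x by exact: lt_le_trans sx.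
    rewrite ger0_norm ?subr_ge0 ?Al//.
    by have := Hs _ sx; lra.
  - by move=> x ux1; have [] := Ad x (lt_trans uu ux1).
  - by apply: cvg_at_right_filter; exact: (der_continuous (Ad _ uu)).
  - move=> x; rewrite in_itv/= andbT => ux1.
    by rewrite derive1E; have [_ ->] := Ad x (lt_trans uu ux1).
split.
- move=> u uu; apply: der_eq (derB (der_cst u l) (Ad u uu)) _.
  by rewrite sub0r.
- move=> u uu; rewrite subr_gt0; apply: lt_le_trans (Al (u + 1) _); last by lra.
  have u1 : u < u + 1 by rewrite ltrDl.
  have [x /andP[? _]|x /andP[? _]|c /andP[c1 _] e] := @mvt _ A (fun x => (f x)^-1) u (u + 1) u1.
  - by apply: (der_continuous (Ad _ _)); exact: lt_le_trans uu _.
  - by apply: Ad; exact: lt_trans uu _.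
  rewrite -subr_gt0 e mulr_gt0 ?subr_gt0// invr_gt0 f_gt0//; exact: lt_trans c1.
- move=> e e0; have [B B0 HB] := ladh _ e0; exists B => // u Bu.
  by have := HB _ Bu; lra.
have f1V x : 0 < x -> 0 < (f1 x)^-1 by move=> x0; rewrite invr_gt0 /f1 f'_gt0.
split.
- move=> u Uu; rewrite lerBlDr; apply: ge_sup; first by exists (H 0), 0.
  move=> _ [s _ <-]; rewrite -AE.
  have [_ uu] := ux _ Uu.
  case: (leP (expR s) u) => [sU|/ltW sU].
    by rewrite (le_trans (Amono _ _ (expR_gt0 _) sU))// lerDr ltW// f1V.
  by have := Abd _ _ Uu sU; have := f1V _ (expR_gt0 s); lra.
move=> e e0.
have /cvgrPdist_lt/(_ _ e0)[B [_ HB]] := g_lim.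
exists (Num.max U0 (B + 1)); first by rewrite lt_max U0_gt0.
move=> u; rewrite ge_max => /andP[Uu Bu].
have [_ uu] := ux _ Uu.
have Alow v : u <= v -> (f1 u)^-1 - (f1 v)^-1 <= (1 + e) * (A v - A u).
  move=> uv; rewrite mulrBr (_ : _ - _ = - (f1 v)^-1 - - (f1 u)^-1); last by ring.
  apply: (@der_compare _ (fun x => - (f1 x)^-1) (fun x => (1 + e) * A x)
    (fun x => - - (f2 x / f1 x ^+ 2)) (fun x => (1 + e) * (f x)^-1)) => // x /andP[ux1 _].
  - by apply/derN/invf1d; have [] := ux x (le_trans Uu ux1).
  - by apply/derZ/Ad; have [] := ux x (le_trans Uu ux1).
  - have [u0x x0] := ux x (le_trans Uu (ltW ux1)).
    have Bx : B < x by lra.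
    have := HB _ Bx; rewrite ltr_norml => /andP[+ _].
    have fx := f_gt0 x0; have f1x : 0 < f1 x by rewrite /f1 f'_gt0.
    move=> Hx; rewrite opprK ler_pdivlMr//.
    by rewrite mulrAC [f2 x * _]mulrC; lra.
rewrite leNgt; apply/negP => lt.
(* If the bound failed, the boundary term [1 / f' v] could be made at most half of the defect,
   contradicting [Alow]. *)
have [|v uv Hv] := @invf1_small (((f1 u)^-1 - (1 + e) * (l - A u)) / 2) u.
  by rewrite divr_gt0// subr_gt0.
have := Alow _ uv; have := Al v (lt_le_trans uu uv) => H1.
have : (1 + e) * (A v - A u) <= (1 + e) * (l - A u) by rewrite ler_pM2l; lra.
by move: lt Hv; lra.
Unshelve. all: by end_near. Qed.

End tail.

(** For [g = ln f] the quotient [g'' / g'^2] equals [f f'' / f'^2 - 1]. *)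
Lemma log_ratio_lim :
  (let g := fun u : R => ln (f u) in
   (g^`(2))%classic u / (g^`())%classic u ^+ 2 @[u --> +oo] --> (0 : R)) ->
  f u * f2 u / f1 u ^+ 2 @[u --> +oo] --> (1 : R).
Proof.
set g := fun u : R => ln (f u) => /= glim.
have g1E u : 0 < u -> (g^`())%classic u = f1 u / f u.
  by move=> u0; rewrite derive1E; have [_ ->] := lnf1 u0.
have g2E u : 0 < u -> (g^`(2))%classic u = G2 u.
  move=> u0; rewrite derive1Sn derive1n1 derive1E.
  have [_ <-] := lnf2 u0; apply: near_eq_derive.
  by near=> y; apply: g1E; near: y; exact: lt_nbhsr.
rewrite -[X in _ --> X]add0r.
apply: cvg_trans (cvgD glim (cvg_cst (1 : R))).
apply: near_eq_cvg; near=> u.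
have u0 : 0 < u by near: u; apply: nbhs_pinfty_gt; exact: num_real.
transitivity ((g^`(2))%classic u / (g^`())%classic u ^+ 2 + 1); first by [].
rewrite g1E// g2E// /G2; have fu := f_gt0 u0; have f1u := f'_gt0 u0.
by field; rewrite !gt_eqF.
Unshelve. all: by end_near. Qed.

End nonlinearity.

Lemma sobolev_nonlinearity {R : realType} (N : nat) (hN : (3 <= N)%N)
  (f : R -> R)
  (f_C1 : C1_within `[0, +oo[ f)
  (f_C2 : C2_line `]0, +oo[ f)
  (f0 : f 0 = 0)
  (f'_gt0 : forall u : R, 0 < u -> 0 < f^`() u)
  (f''_gt0 : forall u : R, 0 < u -> 0 < f^`(2) u)
  (g_convex : exists u0 : R, 0 < u0 /\
     @convex_function R R^o `[u0, +oo[ (fun u : R => ln (f u)))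
  (g_lim : let g := fun u : R => ln (f u) in
     (g^`(2))%classic u / (g^`())%classic u ^+ 2 @[u --> +oo] --> (0 : R))
  (f_supercritical : forall u : R, 0 <= u ->
     0 <= u * f u - (sobolev_exponent R N + 1) *
                    \int[lebesgue_measure]_(s in `[0, u]) f s) :
  exists Phi, nonlinearity (N%:R - 2) f f^`() (tail_integral f) Phi.
Proof.
have fD0 : derivable_within `[0, +oo[ f 0.
  by apply: f_C1.1; rewrite /= in_itv/= lexx.
have cf := ext0_continuous fD0 f_C2 f0.
have [Phi0 Phi0d] := antiderivative cf.
pose Phi (u : R) := Phi0 u - Phi0 0.
have Phid (u : R) : is_derive u 1 Phi (ext0 f u).
  by have := derB (Phi0d u) (der_cst u (Phi0 0)); rewrite subr0.
have N3 : 3 <= N%:R :> R by rewrite (ler_nat _ 3).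
have fpos (u : R) : 0 < u -> 0 < f u := f_gt0 fD0 f_C2 f0 f'_gt0 (u := u).
have [u0 [u00 cvx]] := g_convex.
have lc := log_convex_ge0 fD0 f_C2 f0 f'_gt0 u00 cvx.
have gl := log_ratio_lim fD0 f_C2 f0 f'_gt0 g_lim.
have [F FE [Fd Fpos Flim [F1 F2]]] := tail_nonlinearity fD0 f_C2 f0 f'_gt0 f''_gt0 u00 lc gl.
have TE (u : R) : 0 < u -> tail_integral f u = F u by move=> ?; rewrite FE.
exists Phi; split => //.
- lra.
- move=> u uu; have [|df _ _] := @f_C2 u; first by rewrite /= in_itv/= uu.
  by rewrite derive1E; apply: derivableP.
- exact: f1_mono.
- move=> u uu; apply: near_eq_is_derive (Fd _ uu).
  by near=> y; rewrite TE//; near: y; exact: lt_nbhsr.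
- by move=> u uu; rewrite TE// Fpos.
- move=> e e0; have [B B0 HB] := Flim _ e0; exists B => // u Bu.
  by rewrite TE ?HB// (lt_le_trans B0).
- exists (u0 + 1), (f (u0 + 1) / (f^`())%classic (u0 + 1)); split => [||u Uu].
  + lra.
  + by rewrite divr_gt0 ?fpos ?f'_gt0//; lra.
  have uu : 0 < u by lra.
  have f1u := f'_gt0 _ uu.
  rewrite TE//; have FV := F1 _ Uu; split.
    by rewrite -(mulfV (lt0r_neq0 f1u)) ler_pM2l.
  apply: le_trans (ratio_le f_C2 f'_gt0 u00 lc Uu).
  by rewrite ler_pM2l ?fpos.
- move=> e e0; have [B B0 HB] := F2 _ e0; exists B => // u Bu.
  have uu : 0 < u by exact: lt_le_trans Bu.
  have f1u := f'_gt0 _ uu; rewrite TE//.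
  have := HB _ Bu; rewrite -(ler_pM2l f1u) mulfV ?gt_eqF// => H.
  have P : 0 < (f^`())%classic u * F u by rewrite mulr_gt0// Fpos.
  case: (leP 1 ((f^`())%classic u * F u)) => ?; first lra.
  move: H P; rewrite mulrCA; set q := _ * F u => H P.
  by have : e * q <= e; [rewrite -[leRHS]mulr1 ler_pM2l// ltW|lra].
- by rewrite /Phi subrr.
- move=> u; rewrite le_eqVlt => /orP[/eqP<-|uu].
    by rewrite /Phi subrr !(mulr0, mul0r).
  have := f_supercritical _ (ltW uu).
  have -> : \int[lebesgue_measure]_(s in `[0, u]) f s = Phi u.
    have -> : \int[lebesgue_measure]_(s in `[0, u]) f s =
              \int[lebesgue_measure]_(s in `[0, u]) ext0 f s.
      by apply: eq_Rintegral => x; rewrite inE/= in_itv/= => /andP[x0 _]; rewrite ext0_nneg.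
    rewrite /Rintegral (@continuous_FTC2 _ (ext0 f) Phi 0 u uu).
    + by rewrite /Phi -EFinB/= subrr subr0.
    + exact: continuous_subspaceT.
    + split => [x _| |].
      * by have [] := Phid x.
      * by apply: cvg_at_right_filter; exact: (der_continuous (Phid _)).
      * by apply: cvg_at_left_filter; exact: (der_continuous (Phid _)).
    + by move=> x _; rewrite derive1E; have [_ ->] := Phid x.
  (* With [k = N - 2] this exponent is [2 (k + 2) / k]; clearing the denominator gives the form of
     [nl_Phi]. *)
  have -> : sobolev_exponent R N + 1 = 2 * N%:R / (N%:R - 2).
    by rewrite /sobolev_exponent; field; lra.
  rewrite subr_ge0 mulrAC ler_pdivrMr; last lra.
  lra.
Unshelve. all: by end_near. Qed.

(** * The Lyapunov function *)

Section exp_small.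
Context {R : realType}.
Implicit Types (c e x y : R).

Lemma expR_small c e : 0 < c -> 0 < e -> exists a0 : R, forall a, a <= a0 -> expR (c * a) <= e.
Proof.
move=> c0 e0; exists (ln e / c) => a aa.
by rewrite -[leRHS]lnK ?posrE// ler_expR mulrC -ler_pdivlMr.
Qed.

(** This is the passage to the limit [a -> -oo], in the form used for all boundary terms at -oo. *)
Lemma le_exp_small x y M c (a0 : R) : 0 < c -> 
  (forall a, a <= a0 -> x <= y + M * expR (c * a)) -> x <= y.
Proof.
move=> c0 H; rewrite leNgt; apply/negP => yx.
pose e := (x - y) / (2 * (`|M| + 1)).
have M0 : 0 < `|M| + 1 by rewrite ltr_wpDl.
have e0 : 0 < e by rewrite divr_gt0 ?subr_gt0// mulr_gt0.
have [a1 Ha1] := expR_small c0 e0.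
pose a := Num.min a0 a1.
have aa0 : a <= a0 by rewrite ge_min lexx.
have aa1 : a <= a1 by rewrite ge_min lexx orbT.
have := H _ aa0; have := Ha1 _ aa1; set q := expR _ => He Hx.
have q0 : 0 < q by exact: expR_gt0.
have h1 : M * q <= `|M| * q by rewrite ler_wpM2r ?ler_norm// ltW.
have h2 : `|M| * q <= `|M| * e by rewrite ler_wpM2l.
have h3 : `|M| * e + e = (x - y) / 2.
  by rewrite /e; field; rewrite gt_eqF.
lra.
Qed.

End exp_small.

Section lyapunov.
Context {R : realType}.
Implicit Types (k E y th : R).

(** Along the unperturbed system the first two terms have derivative [- k (y - 2)^2], which does not
    see [E]. The cross term contributes [- k / 4 (E - 1)^2] and makes the decay strict; its
    coefficient is small enough to keep the whole positive definite for [E <= 3]. *)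
Definition lyap k E y : R :=
  (y - 2) ^+ 2 / 2 + 2 * k * (E - 1 - ln E) - (E - 1) * (y - 2) / 8.

(** With the constant 18 the difference of the two sides has derivative [(x - 1) (9 - x) / (9 x)],
    so its minimum on the range considered is at 1, where it vanishes. *)
Lemma ln_quadratic E : 0 < E -> E <= 3 -> (E - 1) ^+ 2 / 18 <= E - 1 - ln E.
Proof.
move=> E0 E3.
pose phi (x : R) := x - 1 - ln x - (x - 1) ^+ 2 / 18.
pose dphi (x : R) := 1 - 0 - 1 / x - 2 * (x - 1) * (1 - 0) * 18^-1.
have phid (x : R) : 0 < x -> is_derive x 1 phi (dphi x).
  move=> x0.
  have h1 := derB (der_id x) (der_cst x (1 : R)).
  have h2 := derM (derX2 h1) (der_cst x (18^-1 : R)).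
  apply: der_eq (derB (derB h1 (der_ln x0 (der_id x))) h2) _.
  by rewrite mulr0 addr0.
have dE (x : R) : 0 < x -> dphi x = (x - 1) * (9 - x) / (9 * x).
  by move=> x0; rewrite /dphi; field; rewrite gt_eqF.
have phi1 : phi 1 = 0 by rewrite /phi ln1; ring.
suff : 0 <= phi E by rewrite /phi subr_ge0.
rewrite -phi1; case: (leP 1 E) => E1.
  apply: (@der_mono _ phi dphi 1 E E1) => x /andP[x1 x2].
    by apply: phid; lra.
  rewrite dE; last lra.
  by rewrite divr_ge0 ?mulr_ge0//; lra.
rewrite -lerN2; apply: (@der_mono _ (fun x => - phi x) (fun x => - dphi x) E 1 (ltW E1)) => x /andP[x1 x2].
  by apply: derN; apply: phid; lra.
rewrite dE; last lra.
rewrite -!mulNr divr_ge0 ?mulr_ge0//; lra.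
Qed.

Lemma lyap_ge k E y : 1 <= k -> 0 < E -> E <= 3 ->
  (y - 2) ^+ 2 / 4 + (E - 1) ^+ 2 / 12 <= lyap k E y.
Proof.
move=> k1 E0 E3; have H := ln_quadratic E0 E3.
rewrite /lyap; set q := E - 1 - ln E in H *.
have q0 : 0 <= q by apply: le_trans H; rewrite divr_ge0// sqr_ge0.
have : 2 * q <= 2 * k * q by rewrite ler_wpM2r//; lra.
set a := E - 1 in H *; set b := y - 2 => Hk.
have : 0 <= (b / 2 - a / 8) ^+ 2 by exact: sqr_ge0.
have := sqr_ge0 a; nra.
Qed.

Lemma lyap12 k : lyap k 1 2 = 0.
Proof. by rewrite /lyap ln1; field. Qed.

Lemma lyap_close k E y d : 1 <= k -> 0 < E -> E <= 3 -> 0 <= d ->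
  lyap k E y <= d ^+ 2 / 12 -> `|E - 1| <= d /\ `|y - 2| <= d.
Proof.
move=> k1 E0 E3 d0 W; have := lyap_ge y k1 E0 E3 => H.
have := sqr_ge0 (E - 1); have := sqr_ge0 (y - 2) => h1 h2.
by split; rewrite -(@ler_pXn2r _ 2%N) ?nnegrE// real_normK ?num_real//; lra.
Qed.

Lemma lyap_le k E y : 1 <= k -> 1 / 2 <= E ->
  lyap k E y <= (4 * k + 1) * ((y - 2) ^+ 2 + (E - 1) ^+ 2).
Proof.
move=> k1 E2; have E0 : 0 < E by lra.
have H : E - 1 - ln E <= 2 * (E - 1) ^+ 2.
  (* The bound [ln E^-1 <= E^-1 - 1] leaves [(E - 1)^2 / E], and [E >= 1 / 2] supplies the factor
     2. *)
  have := @le_ln1Dx R (E^-1 - 1).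
  rewrite (_ : 1 + (E^-1 - 1) = E^-1); last by ring.
  have E1 : 0 < E^-1 by rewrite invr_gt0.
  have -> : (-1 < E^-1 - 1) = true by lra.
  move=> /(_ isT); rewrite lnV ?posrE// => lnE.
  have : E - 1 + (E^-1 - 1) <= 2 * (E - 1) ^+ 2.
    rewrite (_ : _ + _ = (E - 1) ^+ 2 / E); last by field; rewrite gt_eqF.
    by rewrite mulrC ler_wpM2r ?sqr_ge0// -div1r ler_pdivrMr//; lra.
  lra.
rewrite /lyap; set q := E - 1 - ln E in H *.
have : 2 * k * q <= 2 * k * (2 * (E - 1) ^+ 2) by rewrite ler_wpM2l//; lra.
set a := E - 1 in H *; set b := y - 2 => Hk.
have := sqr_ge0 a; have := sqr_ge0 b; have := sqr_ge0 (a + b) => h1 h2 h3.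
have : 0 <= k * b ^+ 2 by rewrite mulr_ge0//; lra.
nra.
Qed.

Definition dlyap k E y th : R :=
  let dE := E * (2 - y) in let dy := k * (2 * E - y) - th * y ^+ 2 in
  (y - 2) * dy + 2 * k * (dE - dE / E) - (dE * (y - 2) + (E - 1) * dy) / 8.

Lemma dlyap_le k E y th : 1 <= k -> 0 < E -> E <= 3 -> 0 <= y -> y <= 7 -> 0 <= th ->
  dlyap k E y th <= - ((y - 2) ^+ 2 / 2 + (E - 1) ^+ 2 / 8) + 120 * th.
Proof.
move=> k1 E0 E3 y0 y7 th0.
rewrite /dlyap /= (_ : E * (2 - y) / E = 2 - y); last by field; rewrite gt_eqF.
have -> : (y - 2) * (k * (2 * E - y) - th * y ^+ 2) +
  2 * k * (E * (2 - y) - (2 - y)) -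
  (E * (2 - y) * (y - 2) + (E - 1) * (k * (2 * E - y) - th * y ^+ 2)) / 8 =
  - (k - E / 8) * (y - 2) ^+ 2 - k / 4 * (E - 1) ^+ 2 + k / 8 * ((E - 1) * (y - 2))
  + th * (y ^+ 2 * ((E - 1) / 8 + (2 - y))) by field.
(* On the region [y^2 <= 49] and the bracket is at most [1 / 4 + 2], so the product stays below
   120. *)
have h1 : th * (y ^+ 2 * ((E - 1) / 8 + (2 - y))) <= th * 120.
  apply: ler_wpM2l => //.
  apply: (@le_trans _ _ (y ^+ 2 * (9 / 4))).
    by apply: ler_wpM2l; [exact: sqr_ge0|lra].
  have : y ^+ 2 <= 49 by nra.
  lra.
set a := E - 1 in h1 *; set b := y - 2.
have h2 : (E - 1) * (y - 2) <= (a ^+ 2 + b ^+ 2) / 2.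
  by have := sqr_ge0 (a - b); rewrite /a /b; nra.
have h3 : k / 8 * (a * b) <= k / 8 * ((a ^+ 2 + b ^+ 2) / 2).
  by apply: ler_wpM2l => //; lra.
have h4 : E / 8 * b ^+ 2 <= 3 / 8 * b ^+ 2.
  by apply: ler_wpM2r; [exact: sqr_ge0|lra].
have a2 := sqr_ge0 a; have b2 := sqr_ge0 b.
have h5 : a ^+ 2 <= k * a ^+ 2 by rewrite -{1}[a ^+ 2]mul1r ler_wpM2r.
have h6 : b ^+ 2 <= k * b ^+ 2 by rewrite -{1}[b ^+ 2]mul1r ler_wpM2r.
lra.
Qed.

(** Either the quadratic dissipation exceeds [121 e] and beats the error [120 e] by [e], or
    [(y - 2)^2 + (E - 1)^2 <= 968 e] with [968 = 8 * 121], and [lyap_le] contradicts the lower bound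
    on [lyap]. The condition [e <= 1 / 4000] ensures [E >= 1 / 2] in the second case. *)
Lemma lyap_decay k E y th e : 1 <= k -> 0 < E -> E <= 3 -> 0 <= y -> y <= 7 ->
  0 <= th -> th <= e -> e <= 1 / 4000 -> (4 * k + 1) * (968 * e) < lyap k E y ->
  dlyap k E y th <= - e.
Proof.
move=> k1 E0 E3 y0 y7 th0 the e1 W.
have := dlyap_le k1 E0 E3 y0 y7 th0.
case: (leP ((y - 2) ^+ 2 / 2 + (E - 1) ^+ 2 / 8) (121 * e)) => [small|]; last lra.
have s1 := sqr_ge0 (y - 2).
have s2 := sqr_ge0 (E - 1).
have E2 : 1 / 2 <= E by nra.
have := lyap_le y k1 E2.
have : (4 * k + 1) * ((y - 2) ^+ 2 + (E - 1) ^+ 2) <= (4 * k + 1) * (968 * e).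
  by apply: ler_wpM2l; lra.
lra.
Qed.

Lemma small_e k d : 1 <= k -> 0 < d -> exists2 e, 0 < e <= 1 / 4000 &
  (4 * k + 1) * (968 * e) <= d ^+ 2 / 12.
Proof.
move=> k1 d0; have d2 : 0 < d ^+ 2 by rewrite exprn_gt0.
set K := 4 * k + 1; set c : R := 968; set b : R := 1 / 4000; set D := d ^+ 2 / 12.
have K0 : 0 < K by rewrite /K; lra.
have c0 : 0 < c by rewrite ltr0n.
have b0 : 0 < b by rewrite divr_gt0 ?ltr0n ?ltr01.
have D0 : 0 < D by rewrite divr_gt0 ?ltr0n.
move: c c0 b b0 K K0 D D0 => c c0 b b0 K K0 D D0.
case: (leP (D / (K * c)) b) => h.
  exists (D / (K * c)); first by rewrite h divr_gt0 ?mulr_gt0.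
  have -> : K * (c * (D / (K * c))) = D; last by [].
  by field; rewrite !gt_eqF.
exists b; first by rewrite b0 lexx.
by rewrite mulrA mulrC -ler_pdivlMr ?mulr_gt0// ltW.
Qed.

End lyapunov.

(** * The radial equation in logarithmic coordinates *)

Section radial.
Context {R : realType}.
Implicit Types (s t a b u v e : R) (U P : R -> R).
Variables (k : R) (f f1 F Phi : R -> R).
Hypothesis NL : nonlinearity k f f1 F Phi.

Let k1 : 1 <= k := nl_k NL.
Let k0 : 0 < k. Proof. by have := k1; lra. Qed.

Lemma ext0_ge0 u : 0 <= ext0 f u.
Proof.
case: (leP u 0) => u0; first by rewrite ext0_npos ?(nl_f0 NL).
by rewrite ext0_nneg ltW// (nl_pos NL).
Qed.

Lemma ext0_mono u v : u <= v -> ext0 f u <= ext0 f v.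
Proof.
move=> uv; case: (leP u 0) => u0.
  by rewrite (ext0_npos (nl_f0 NL) u0) ext0_ge0.
have v0 := lt_le_trans u0 uv.
rewrite !ext0_nneg ?(ltW u0) ?(ltW v0)//.
apply: (@der_mono _ f f1 u v uv) => x /andP[x1 x2].
  by apply: (nl_der NL); exact: lt_le_trans x1.
by apply/ltW/(nl_f1 NL); exact: lt_trans x1.
Qed.

(* [s] is the logarithm of the radius and [P] the derivative of [U]. *)
Definition rsol U P s := is_derive s 1 U (P s) /\
  is_derive s 1 P (- k * P s - expR (2 * s) * ext0 f (U s)).

Definition EE U s := expR (2 * s) / (2 * k * F (U s)).
Definition yy U P s := - P s / (f (U s) * F (U s)).

Section sol.
Variables U P : R -> R.
Local Notation rsol := (rsol U P).
Local Notation E := (EE U).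
Local Notation y := (yy U P).

(** With [r = expR s] and [N = k + 2], [expR (k * s) * P s] is the flux [r^{N-1} u_r]. *)
Lemma rad_flux_der s : rsol s -> is_derive s 1 (fun s => expR (k * s) * P s)
  (- (expR ((k + 2) * s) * ext0 f (U s))).
Proof.
move=> [_ dP]; apply: der_eq (derM (der_expZ k s) dP) _.
have -> : expR ((k + 2) * s) = expR (k * s) * expR (2 * s) by rewrite mulrDl expRD.
by ring.
Qed.

Lemma rad_flux_mono a t : a <= t -> (forall s, a <= s <= t -> rsol s) ->
  expR (k * t) * P t <= expR (k * a) * P a.
Proof.
move=> at_ H; rewrite -lerN2.
apply: (@der_mono _ (fun s => - (expR (k * s) * P s))
  (fun s => - - (expR ((k + 2) * s) * ext0 f (U s))) a t at_) => s h.
  by apply/derN/rad_flux_der/H.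
by rewrite opprK mulr_ge0 ?ext0_ge0// expR_ge0.
Qed.

Lemma rad_slope_le0 a t : a <= t -> (forall s, a <= s <= t -> rsol s) ->
  P a <= 0 -> P t <= 0.
Proof.
move=> at_ H Pa; have := rad_flux_mono at_ H.
have : expR (k * a) * P a <= 0 by rewrite pmulr_rle0// expR_gt0.
move=> h1 h2; have := le_trans h2 h1; by rewrite pmulr_rle0// expR_gt0.
Qed.

Lemma rad_nonincr a t : a <= t -> (forall s, a <= s <= t -> rsol s) ->
  (forall s, a <= s <= t -> P s <= 0) -> U t <= U a.
Proof.
move=> at_ H P0; rewrite -lerN2.
apply: (@der_mono _ (fun s => - U s) (fun s => - P s) a t at_) => s h.
  by apply: derN; have [] := H _ h.
by rewrite oppr_ge0; apply: P0; case/andP: h => /ltW-> /ltW->.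
Qed.

(** [U] is nonincreasing, so the source on [[a, t]] is at least its value at [t]; the remaining
    exponential integrates exactly. *)
Lemma rad_flux_ge a t : a <= t -> (forall s, a <= s <= t -> rsol s) ->
  (forall s, a <= s <= t -> P s <= 0) ->
  ext0 f (U t) / (k + 2) * (expR ((k + 2) * t) - expR ((k + 2) * a)) <=
  expR (k * a) * P a - expR (k * t) * P t.
Proof.
move=> at_ H P0; have k2 : 0 < k + 2 by have := k1; lra.
rewrite mulrBr -[leRHS]opprK opprB [leRHS](_ : _ = - (expR (k * t) * P t) - - (expR (k * a) * P a)); last by ring.
apply: (@der_compare _ (fun s => ext0 f (U t) / (k + 2) * expR ((k + 2) * s))
  (fun s => - (expR (k * s) * P s)) (fun s => ext0 f (U t) / (k + 2) * ((k + 2) * expR ((k + 2) * s)))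
  (fun s => - - (expR ((k + 2) * s) * ext0 f (U s))) a t at_) => s h.
- exact/derZ/der_expZ.
- by apply/derN/rad_flux_der/H.
have /andP[/ltW s1 /ltW s2] := h.
rewrite opprK mulrA divfK ?gt_eqF// mulrC ler_wpM2l ?expR_ge0//.
apply: ext0_mono; apply: rad_nonincr => // x /andP[x1 x2].
  by apply: H; rewrite x2 (le_trans s1).
by apply: P0; rewrite x2 (le_trans s1).
Qed.

(** In the radius this reads [r f(u) <= - N u_r], the outcome of integrating the flux from the
    origin with [f(u)] replaced by its value at the outer radius. *)
Definition drift s := expR (2 * s) * ext0 f (U s) <= - ((k + 2) * P s).

Lemma rad_drift a t : a <= t -> (forall s, a <= s <= t -> rsol s) -> P a <= 0 ->
  drift a -> drift t.
Proof.
move=> at_ H Pa Da.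
have P0 s : a <= s <= t -> P s <= 0.
  move=> /andP[s1 s2]; apply: (rad_slope_le0 s1) => // x /andP[x1 x2].
  by apply: H; rewrite x1 (le_trans x2).
have k2 : 0 < k + 2 by have := k1; lra.
have := rad_flux_ge at_ H P0.
have ee x : expR ((k + 2) * x) = expR (k * x) * expR (2 * x) by rewrite mulrDl expRD.
rewrite mulrAC ler_pdivrMr// !ee => h1.
have h2 : expR (2 * a) * ext0 f (U t) <= - ((k + 2) * P a).
  apply: le_trans Da; rewrite ler_wpM2l ?expR_ge0//.
  by apply: ext0_mono; exact: rad_nonincr.
have := expR_gt0 (k * t); have := expR_gt0 (k * a).
rewrite /drift; set ea := expR (k * a) in h1 *; set et := expR (k * t) in h1 *.
move=> ea0 et0; rewrite -(ler_pM2l et0).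
have h3 : ea * (expR (2 * a) * ext0 f (U t)) <= ea * - ((k + 2) * P a) by rewrite ler_pM2l.
lra.
Qed.

(** Dividing [drift] by [f] bounds the derivative of [F u] in the radius from below by [r / N]. *)
Lemma rad_drift_F a t : a <= t -> (forall s, a <= s <= t -> rsol s) -> P a <= 0 ->
  drift a -> 0 < U t ->
  (expR (2 * t) - expR (2 * a)) / (2 * (k + 2)) <= F (U t) - F (U a).
Proof.
move=> at_ H Pa Da Ut; have k2 : 0 < k + 2 by have := k1; lra.
have sub s x : a <= s <= t -> a <= x <= s -> rsol x.
  by move=> /andP[s1 s2] /andP[x1 x2]; apply: H; rewrite x1 (le_trans x2).
have P0 s : a <= s <= t -> P s <= 0.
  by move=> h; have /andP[s1 s2] := h; apply: (rad_slope_le0 s1) => // x; exact: sub.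
have D s : a <= s <= t -> drift s.
  by move=> h; have /andP[s1 s2] := h; apply: (rad_drift s1) => // x; exact: sub.
have Us s : a <= s <= t -> 0 < U s.
  move=> /andP[s1 s2]; apply: lt_le_trans Ut _; apply: rad_nonincr => // x /andP[x1 x2].
    by apply: H; rewrite x2 (le_trans s1).
  by apply: P0; rewrite x2 (le_trans s1).
rewrite mulrBl.
have dF s : a <= s <= t -> is_derive s 1 (fun s => F (U s)) (- (f (U s))^-1 * P s).
  by move=> h; apply: der_comp; [apply: (nl_F_der NL); exact: Us|have [] := H _ h].
have -> : expR (2 * t) / (2 * (k + 2)) - expR (2 * a) / (2 * (k + 2)) =
  (2 * (k + 2))^-1 * expR (2 * t) - (2 * (k + 2))^-1 * expR (2 * a) by ring.
apply: (@der_compare _ (fun s => (2 * (k + 2))^-1 * expR (2 * s)) _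
   (fun s => (2 * (k + 2))^-1 * (2 * expR (2 * s))) _ a t at_ _ dF) => s h.
  exact/derZ/der_expZ.
have hh : a <= s <= t by case/andP: h => /ltW-> /ltW->.
have fs := nl_pos NL (Us _ hh).
have := D _ hh; rewrite /drift (ext0_nneg _ (ltW (Us _ hh))) => hD.
rewrite (_ : (2 * (k + 2))^-1 * (2 * expR (2 * s)) = expR (2 * s) / (k + 2)); last first.
  by field; rewrite gt_eqF.
rewrite ler_pdivrMr// (_ : - (f (U s))^-1 * P s * (k + 2) = - ((k + 2) * P s) / f (U s)); last by ring.
by rewrite ler_pdivlMr.
Qed.

Lemma EE_gt0 s : 0 < U s -> 0 < E s.
Proof. by move=> Us; rewrite divr_gt0 ?expR_gt0// !mulr_gt0 ?(nl_F NL). Qed.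

Lemma EE_le3 s : 0 < U s -> expR (2 * s) / (2 * (k + 2)) <= F (U s) ->
  k * E s <= k + 2.
Proof.
move=> Us; have F0 := nl_F NL Us.
rewrite ler_pdivrMr; last by have := k1; lra.
move=> h; rewrite /EE mulrA ler_pdivrMr; last by rewrite !mulr_gt0.
have := k0; nra.
Qed.

Lemma yy_ge0 s : 0 < U s -> P s <= 0 -> 0 <= y s.
Proof.
by move=> Us Ps; rewrite divr_ge0 ?oppr_ge0// mulr_ge0 ?ltW ?(nl_pos NL)// (nl_F NL).
Qed.

Lemma EE_der s : rsol s -> 0 < U s -> is_derive s 1 E (E s * (2 - y s)).
Proof.
move=> [dU _] Us; have F0 := nl_F NL Us; have ff := nl_pos NL Us.
have dF := der_comp (nl_F_der NL Us) dU.
have kF : 2 * k * F (U s) != 0 by rewrite gt_eqF// !mulr_gt0.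
refine (der_eq (derM (der_expZ 2 s) (derV (derZ (2 * k) dF) kF)) _).
by rewrite /EE /yy; field; rewrite !gt_eqF.
Qed.

Definition theta s := 1 - f1 (U s) * F (U s).

Lemma yy_der s : rsol s -> 0 < U s ->
  is_derive s 1 y (k * (2 * E s - y s) - theta s * y s ^+ 2).
Proof.
move=> [dU dP] Us; have F0 := nl_F NL Us; have ff := nl_pos NL Us.
have dF := der_comp (nl_F_der NL Us) dU.
have df := der_comp (nl_der NL Us) dU.
have fF : f (U s) * F (U s) != 0 by rewrite gt_eqF// !mulr_gt0.
refine (der_eq (derM (derN dP) (derV (derM df dF) fF)) _).
rewrite ext0_nneg ?ltW// /EE /yy /theta; field.
by rewrite !gt_eqF.
Qed.

Lemma lyap_der s : rsol s -> 0 < U s ->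
  is_derive s 1 (fun s => lyap k (E s) (y s)) (dlyap k (E s) (y s) (theta s)).
Proof.
move=> rs Us; have dE := EE_der rs Us; have dy := yy_der rs Us.
have E0 := EE_gt0 Us.
have db := derB dy (der_cst s (2 : R)).
have da := derB dE (der_cst s (1 : R)).
have d1 := derM (derX2 db) (der_cst s (2^-1 : R)).
have d2 := derZ (2 * k) (derB da (der_ln E0 dE)).
have d3 := derM (derM da db) (der_cst s (8^-1 : R)).
apply: der_eq (derB (derD d1 d2) d3) _.
by rewrite /dlyap; field; rewrite gt_eqF.
Qed.

Variables U0 C : R.
Hypothesis U00 : 0 < U0.
Hypothesis C0 : 0 < C.
Hypothesis tail : forall u, U0 <= u -> f1 u * F u <= 1 /\ f u * F u <= C.

(** This is the region where the Lyapunov estimates apply. The bound 3 is the value of [(k + 2) / k]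
    at [k = 1]. *)
Definition reg s := [/\ U0 <= U s, P s <= 0, E s <= 3 & y s <= 7].

Lemma theta_ge0 s : U0 <= U s -> 0 <= theta s.
Proof. by move=> /tail[? _]; rewrite subr_ge0. Qed.

Lemma kE_le3 s : k * E s <= k + 2 -> E s <= 3.
Proof. by have := k1; nra. Qed.

(** Where [y > 7] the derivative of [y] is at most [2 (k + 2) - 7 k < 0], since the [theta] term has
    the good sign; hence [y] does not decrease backward. *)
Lemma yy_barrier a t : a <= t -> (forall s, a <= s <= t -> rsol s) ->
  (forall s, a <= s <= t -> U0 <= U s /\ k * E s <= k + 2) -> 7 < y t ->
  7 < y a.
Proof.
move=> at_ H HE yt.
have U0s s : a <= s <= t -> 0 < U s by move=> /HE[] /(lt_le_trans U00).
apply: (lt_le_trans yt).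
apply: le_trans (@barrier _ y (fun s => k * (2 * E s - y s) - theta s * y s ^+ 2)
  a t 7 0 at_ (lexx 0) _ _ yt).
- by rewrite mul0r addr0.
- by move=> s h; apply: yy_der; [exact: H|exact: U0s].
- move=> s h ys; have [Us Es] := HE _ h.
  have : 0 <= theta s * y s ^+ 2 by rewrite mulr_ge0 ?sqr_ge0// theta_ge0.
  have : k * 7 <= k * y s by rewrite ler_pM2l// ltW.
  by have := k1; lra.
Qed.

Lemma reg_ivp a t : a <= t -> (forall s, a <= s <= t -> rsol s) ->
  0 < U a -> F (U a) = expR (2 * a) / (2 * k) -> P a = - (2 * (f (U a) * F (U a))) ->
  U0 <= U t -> reg t.
Proof.
move=> at_ H Ua FUa Pa Ut.
have F0 := nl_F NL Ua; have f0 := nl_pos NL Ua.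
have Pa0 : P a <= 0 by rewrite Pa oppr_le0 !mulr_ge0// ltW.
have Ut0 : 0 < U t := lt_le_trans U00 Ut.
have sub s x : a <= s <= t -> a <= x <= s -> rsol x.
  by move=> /andP[s1 s2] /andP[x1 x2]; apply: H; rewrite x1 (le_trans x2).
have P0 s : a <= s <= t -> P s <= 0.
  by move=> h; have /andP[s1 s2] := h; apply: (rad_slope_le0 s1) => // x; exact: sub.
have Us s : a <= s <= t -> U0 <= U s.
  move=> /andP[s1 s2]; apply: le_trans Ut _; apply: rad_nonincr => // x /andP[x1 x2].
    by apply: H; rewrite x2 (le_trans s1).
  by apply: P0; rewrite x2 (le_trans s1).
(* At [E = 1], [y = 2] the inequality reduces to [2 k <= 2 (k + 2)]. *)
have Da : drift a.
  rewrite /drift ext0_nneg ?ltW// Pa.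
  have -> : expR (2 * a) = 2 * k * F (U a).
    by rewrite FUa; field; rewrite gt_eqF.
  have : 0 <= f (U a) * F (U a) by rewrite mulr_ge0 ?ltW.
  nra.
have kE s : a <= s <= t -> k * E s <= k + 2.
  move=> h; have /andP[s1 s2] := h; have Us0 := lt_le_trans U00 (Us _ h).
  apply: EE_le3 => //.
  have := rad_drift_F s1 (fun x => sub s x h) Pa0 Da Us0.
  rewrite FUa mulrBl.
  have : expR (2 * a) / (2 * (k + 2)) <= expR (2 * a) / (2 * k).
    rewrite ler_pM2l ?expR_gt0// lef_pV2 ?posrE; have := k0; lra.
  lra.
have tt : a <= t <= t by rewrite at_ lexx.
split => //; first exact: P0.
  by apply: kE_le3; exact: kE.
rewrite leNgt; apply/negP => yt.
have := yy_barrier at_ H (fun s h => conj (Us s h) (kE s h)) yt.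
have -> : y a = 2 by rewrite /yy Pa; field; rewrite !gt_eqF.
lra.
Qed.

(** [lyap] vanishes at the starting point, which is the equilibrium; above the threshold it
    decreases forward, so it cannot have climbed past it. *)
Lemma lyap_ivp a t e : a <= t -> (forall s, a <= s <= t -> rsol s) ->
  0 < U a -> F (U a) = expR (2 * a) / (2 * k) -> P a = - (2 * (f (U a) * F (U a))) ->
  U0 <= U t -> 0 < e -> e <= 1 / 4000 ->
  (forall s, a <= s <= t -> theta s <= e) ->
  lyap k (E t) (y t) <= (4 * k + 1) * (968 * e).
Proof.
move=> at_ H Ua FUa Pa Ut e0 e1 th.
have F0 := nl_F NL Ua; have f0 := nl_pos NL Ua.
have regs s : a <= s <= t -> reg s.
  move=> /andP[s1 s2].
  apply: (@reg_ivp a s) => //.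
    by move=> x /andP[x1 x2]; apply: H; rewrite x1 (le_trans x2).
  apply: le_trans Ut _; apply: rad_nonincr => // x /andP[x1 x2].
    by apply: H; rewrite x2 (le_trans s1).
  apply: (@rad_slope_le0 a x) => [|z /andP[z1 z2]|]; first exact: le_trans x1.
    by apply: H; rewrite z1 (le_trans z2).
  by rewrite Pa oppr_le0 !mulr_ge0// ltW.
rewrite leNgt; apply/negP => Wt.
have ke : 0 < k * e by rewrite mulr_gt0.
have w0 : 0 <= (4 * k + 1) * (968 * e) by lra.
have : lyap k (E t) (y t) + e * (t - a) <= lyap k (E a) (y a).
  apply: (@barrier _ (fun s => lyap k (E s) (y s))
    (fun s => dlyap k (E s) (y s) (theta s)) a t ((4 * k + 1) * (968 * e)) e at_ (ltW e0) _ _ Wt).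
  - move=> s h; have [Us _ _ _] := regs _ h.
    by apply: lyap_der; [exact: H|exact: lt_le_trans Us].
  - move=> s h Ws; have [Us Ps Es ys] := regs _ h.
    have Us0 := lt_le_trans U00 Us.
    apply: lyap_decay Ws; [exact: k1|exact: EE_gt0|exact: Es|exact: yy_ge0|exact: ys
      |exact: theta_ge0|exact: th|exact: e1].
have -> : y a = 2 by rewrite /yy Pa; field; rewrite !gt_eqF.
have -> : E a = 1 by rewrite /EE FUa; field; rewrite !gt_eqF// expR_gt0.
rewrite lyap12.
have : 0 <= e * (t - a) by rewrite mulr_ge0 ?subr_ge0// ltW.
lra.
Qed.


End sol.

Lemma F_nonincr u v : 0 < u -> u <= v -> F v <= F u.
Proof.
move=> u0 uv; rewrite -lerN2.
apply: (@der_mono _ (fun x => - F x) (fun x => - - (f x)^-1) u v uv) => x /andP[x1 x2].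
  by apply/derN/(nl_F_der NL); exact: lt_le_trans x1.
by rewrite opprK invr_ge0 ltW// (nl_pos NL)// (lt_trans u0).
Qed.

End radial.

(** * A priori bounds and convergence to the equilibrium at -oo *)

Section sing.
Context {R : realType}.
Implicit Types (s t a b u v e d : R) (U P : R -> R).
Variables (k : R) (f f1 F Phi : R -> R).
Hypothesis NL : nonlinearity k f f1 F Phi.
Variables U0 C : R.
Hypothesis U00 : 0 < U0.
Hypothesis tail : forall u, U0 <= u -> f1 u * F u <= 1 /\ f u * F u <= C.

Let k1 : 1 <= k := nl_k NL.
Let k0 : 0 < k. Proof. by have := k1; lra. Qed.

Local Notation rsol := (rsol k f).
Local Notation EE := (EE k F).
Local Notation yy := (yy f F).
Local Notation theta := (theta f1 F).
Local Notation reg := (reg k f F).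

Section singular.
Variables U P : R -> R.
Local Notation E := (EE U).
Local Notation y := (yy U P).
Hypothesis radU : forall s, rsol U P s.
Hypothesis Uoo : forall M : R, exists s0, forall s, s <= s0 -> M <= U s.

(** The flux is nonincreasing, so a positive slope at [t] would be positive at all earlier times and
    [U] would stay below [U t] toward -oo. *)
Lemma sing_slope t : P t <= 0.
Proof.
rewrite leNgt; apply/negP => Pt.
have Pa a : a <= t -> 0 < P a.
  move=> at_; have := rad_flux_mono NL at_ (fun s _ => radU s).
  have h : 0 < expR (k * t) * P t by rewrite mulr_gt0// expR_gt0.
  by move/(lt_le_trans h); rewrite pmulr_rgt0// expR_gt0.
have [s0 H] := Uoo (U t + 1).
pose a := Num.min s0 t.
have at_ : a <= t by rewrite ge_min lexx orbT.
have as0 : a <= s0 by rewrite ge_min lexx.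
have : U a <= U t.
  apply: (@der_mono _ U P a t at_) => s /andP[_ s2]; first by have [] := radU s.
  by apply/ltW/Pa/ltW.
have := H _ as0; lra.
Qed.

Lemma sing_nonincr a t : a <= t -> U t <= U a.
Proof.
by move=> at_; apply: (rad_nonincr at_) => s _; [exact: radU|exact: sing_slope].
Qed.

Lemma sing_drift t : drift k f U P t.
Proof.
have k2 : 0 < k + 2 by have := k1; lra.
have : ext0 f (U t) / (k + 2) * expR ((k + 2) * t) <= - (expR (k * t) * P t).
  apply: (@le_exp_small _ _ _ (ext0 f (U t) / (k + 2)) (k + 2) t k2) => a at_.
  have := rad_flux_ge NL at_ (fun s _ => radU s) (fun s _ => sing_slope s).
  have : expR (k * a) * P a <= 0 by rewrite pmulr_rle0 ?sing_slope// expR_gt0.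
  by rewrite mulrBr; lra.
have -> : expR ((k + 2) * t) = expR (k * t) * expR (2 * t) by rewrite mulrDl expRD.
rewrite mulrAC ler_pdivrMr// /drift => h.
rewrite -(ler_pM2l (expR_gt0 (k * t))).
lra.
Qed.

Lemma sing_F t : 0 < U t -> expR (2 * t) / (2 * (k + 2)) <= F (U t).
Proof.
move=> Ut; have two0 : 0 < 2 :> R by [].
apply: (@le_exp_small _ _ _ ((2 * (k + 2))^-1) 2 t two0) => a at_.
have := rad_drift_F NL at_ (fun s _ => radU s) (sing_slope a) (sing_drift a) Ut.
have : 0 < F (U a) by apply: (nl_F NL); apply: lt_le_trans Ut _; exact: sing_nonincr.
by rewrite mulrBl; lra.
Qed.

(** Only [y <= 7] is left after the flux estimates. If it failed at [t] it would fail at all earlier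
    times, and since [E'/E = 2 - y < - 5], [ln E] would grow linearly backward, beyond [ln 3]. *)
Lemma sing_reg t : U0 <= U t -> reg U P U0 t.
Proof.
move=> Ut; have Us s : s <= t -> U0 <= U s.
  by move=> st; apply: le_trans Ut _; exact: sing_nonincr.
have Us0 s : s <= t -> 0 < U s by move=> st; exact: lt_le_trans (Us _ st).
have kE s : s <= t -> k * E s <= k + 2.
  by move=> st; apply: (EE_le3 NL); [|apply: sing_F]; exact: Us0.
have E3 s : s <= t -> E s <= 3 by move=> st; apply: (kE_le3 NL); exact: kE.
split; [exact: Ut|exact: sing_slope|exact: E3|].
rewrite leNgt; apply/negP => yt.
have ya a : a <= t -> 7 < y a.
  move=> at_; apply: (yy_barrier NL U00 tail at_) yt => s /andP[_ st]; first exact: radU.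
  by split; [exact: Us|exact: kE].
pose a := t - (`|ln 3 - ln (E t)| + 1).
have n0 := normr_ge0 (ln 3 - ln (E t)).
have at_ : a <= t by rewrite /a; lra.
have : ln (E t) - ln (E a) <= - 5 * t - - 5 * a.
  apply: (@der_compare _ (fun s => ln (E s)) (fun s => - 5 * s)
    (fun s => E s * (2 - y s) / E s) (fun=> - 5) a t at_) => s /andP[_ st].
  - by apply: der_ln; [apply: (EE_gt0 NL); exact: Us0|apply: (EE_der NL); [exact: radU|exact: Us0]].
  - by have := derZ (- 5) (der_id s); rewrite mulr1.
  - have Ess : 0 < E s by apply: (EE_gt0 NL); apply: Us0; exact: ltW.
    rewrite mulrAC divff ?mul1r ?gt_eqF//.
    by have := ya _ (ltW st); lra.
have : ln (E a) <= ln 3.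
  have Ea : 0 < E a by apply: (EE_gt0 NL); exact: Us0.
  by rewrite ler_ln ?posrE//; exact: E3.
have := ler_norm (ln 3 - ln (E t)).
move: n0; rewrite /a; lra.
Qed.

(* If the Lyapunov function ever exceeded its threshold it would grow linearly
   backward, so [E] would decay exponentially and [y], the logarithmic
   derivative of [F (U s)], would be integrable at -oo; [U] would be bounded. *)
Lemma sing_lyap e t0 : 0 < e -> e <= 1 / 4000 ->
  (forall s, s <= t0 -> U0 <= U s /\ theta U s <= e) ->
  forall t, t <= t0 -> lyap k (E t) (y t) <= (4 * k + 1) * (968 * e).
Proof.
move=> e0 e1 H t tt0; rewrite leNgt; apply/negP => Wt.
have ke : 0 < k * e by rewrite mulr_gt0.
have st s : s <= t -> s <= t0 by move=> /le_trans; apply.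
have Us0 s : s <= t -> 0 < U s by move=> /st/H[] /(lt_le_trans U00).
have regs s : s <= t -> reg U P U0 s by move=> /st/H[? _]; exact: sing_reg.
have Es s : s <= t -> 0 < E s <= 3.
  by move=> h; rewrite (EE_gt0 NL) ?Us0//; have [] := regs _ h.
have ys s : s <= t -> 0 <= y s <= 7.
  by move=> h; have [_ ? _ ->] := regs _ h; rewrite (yy_ge0 NL) ?Us0.
have Wa a : a <= t -> e * (t - a) <= lyap k (E a) (y a).
  move=> at_.
  have : lyap k (E t) (y t) + e * (t - a) <= lyap k (E a) (y a).
    apply: (@barrier _ (fun s => lyap k (E s) (y s))
      (fun s => dlyap k (E s) (y s) (theta U s)) a t ((4 * k + 1) * (968 * e)) e at_ (ltW e0) _ _ Wt).
    - by move=> s /andP[_ h]; apply: (lyap_der NL); [exact: radU|exact: Us0].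
    - move=> s /andP[_ h] Ws; have /andP[E0 E3] := Es _ h; have /andP[y0 y7] := ys _ h.
      have [Us the] := H _ (st _ h).
      exact: (lyap_decay k1 E0 E3 y0 y7 (theta_ge0 tail Us) the e1 Ws).
  lra.
pose kap := e / (2 * k).
have kap0 : 0 < kap by rewrite divr_gt0// mulr_gt0.
(* On the region the terms of [lyap] other than [- 2 * k * ln E] sum to at most [14 + 4 * k]. *)
pose D := (14 + 4 * k) / (2 * k) - kap * t.
have lnE a : a <= t -> ln (E a) <= D + kap * a.
  move=> at_; have := Wa _ at_.
  have /andP[E0 E3] := Es _ at_; have /andP[y0 y7] := ys _ at_.
  have h1 : (y a - 2) ^+ 2 <= 25 by nra.
  have h2 : - 5 <= (E a - 1) * (y a - 2) by nra.
  have h3 : 2 * k * (E a - 1) <= 2 * k * 2 by rewrite ler_wpM2l; have := k0; lra.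
  rewrite /lyap => h4.
  have : 2 * k * ln (E a) <= 14 + 4 * k - e * (t - a) by lra.
  rewrite -ler_pdivlMl ?mulr_gt0//; move/le_trans; apply.
  by rewrite /D /kap le_eqVlt; apply/orP; left; apply/eqP; field; rewrite gt_eqF.
pose M := expR D.
have EM a : a <= t -> E a <= M * expR (kap * a).
  move=> at_; have /andP[E0 _] := Es _ at_.
  by rewrite -[leLHS]lnK ?posrE// /M -expRD ler_expR lnE.
have kk : 0 < k + kap by have := k0; lra.
(* [C1 * expR (kap * s)] solves [y' = k (2 M expR (kap * s) - y)], the linear equation that
   dominates the one for [y]. *)
pose C1 := 2 * k * M / (k + kap).
have M0 : 0 < M by exact: expR_gt0.
have C10 : 0 < C1 by rewrite divr_gt0// !mulr_gt0.
have ybd s : s <= t -> y s <= C1 * expR (kap * s).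
  move=> h.
  have : expR (k * s) * y s <= C1 * expR ((k + kap) * s).
    apply: (@le_exp_small _ _ _ 7 k s k0) => a as_.
    have : expR (k * s) * y s - expR (k * a) * y a <=
        C1 * expR ((k + kap) * s) - C1 * expR ((k + kap) * a).
      apply: (@der_compare _ (fun x => expR (k * x) * y x)
        (fun x => C1 * expR ((k + kap) * x))
        (fun x => k * expR (k * x) * y x +
          expR (k * x) * (k * (2 * E x - y x) - theta U x * y x ^+ 2))
        (fun x => C1 * ((k + kap) * expR ((k + kap) * x))) a s as_) => x /andP[_ xs].
      + refine (derM (der_expZ k x) _).
        by apply: (yy_der NL); [exact: radU|apply: Us0; exact: le_trans h].
      + exact/derZ/der_expZ.
      have xt : x <= t by rewrite (le_trans (ltW xs)).
      have -> : expR ((k + kap) * x) = expR (k * x) * expR (kap * x) by rewrite mulrDl expRD.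
      have := EM _ xt => hE.
      have th0 : 0 <= theta U x * y x ^+ 2.
        have [Ux _] := H _ (st _ xt).
        by rewrite mulr_ge0 ?sqr_ge0// (theta_ge0 tail).
      have -> : C1 * ((k + kap) * (expR (k * x) * expR (kap * x))) =
        expR (k * x) * (2 * k * (M * expR (kap * x))).
        by rewrite /C1; field; rewrite gt_eqF.
      rewrite -mulrA [k * (_ * _)]mulrCA -mulrDr ler_pM2l ?expR_gt0//.
      have : 2 * k * E x <= 2 * k * (M * expR (kap * x)) by rewrite ler_pM2l// mulr_gt0.
      lra.
    have : 0 <= C1 * expR ((k + kap) * a) by rewrite mulr_ge0 ?expR_ge0// ltW.
    have : expR (k * a) * y a <= expR (k * a) * 7.
      by rewrite ler_pM2l ?expR_gt0//; have /andP[] := ys _ (le_trans as_ h).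
    lra.
  have -> : expR ((k + kap) * s) = expR (k * s) * expR (kap * s) by rewrite mulrDl expRD.
  by rewrite [C1 * (_ * _)]mulrCA ler_pM2l ?expR_gt0.
pose C2 := C1 / kap * expR (kap * t).
have lnF a : a <= t -> ln (F (U t)) - C2 <= ln (F (U a)).
  move=> at_.
  have : ln (F (U t)) - ln (F (U a)) <= C1 / kap * expR (kap * t) - C1 / kap * expR (kap * a).
    apply: (@der_compare _ (fun x => ln (F (U x))) (fun x => C1 / kap * expR (kap * x))
      (fun x => - (f (U x))^-1 * P x / F (U x))
      (fun x => C1 / kap * (kap * expR (kap * x))) a t at_) => x /andP[_ xt].
    + apply: der_ln; first by apply: (nl_F NL); exact: Us0.
      by apply: der_comp; [apply: (nl_F_der NL); exact: Us0|have [] := radU x].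
    + exact/derZ/der_expZ.
    have := ybd _ (ltW xt); rewrite mulrA divfK ?gt_eqF//; apply: le_trans.
    by rewrite /yy invfM; lra.
  have : 0 < C1 / kap * expR (kap * a) by rewrite mulr_gt0 ?expR_gt0// divr_gt0.
  by rewrite /C2; lra.
have [B B0 HB] := nl_F_lim NL (expR_gt0 (ln (F (U t)) - C2)).
have [s0 Hs0] := Uoo B.
pose a := Num.min s0 t.
have at_ : a <= t by rewrite ge_min lexx orbT.
have as0 : a <= s0 by rewrite ge_min lexx.
have := HB _ (Hs0 _ as0); rewrite ltNge => /negP; apply.
have Fa : 0 < F (U a) by apply: (nl_F NL); exact: Us0.
by rewrite -[leRHS]lnK ?posrE// ler_expR lnF.
Qed.

End singular.

Lemma sing_asymptotics U P :
  (forall s, rsol U P s) -> (forall M : R, exists s0, forall s, s <= s0 -> M <= U s) ->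
  forall d, 0 < d -> exists t0, forall s, s <= t0 ->
    [/\ reg U P U0 s, theta U s <= 1 / 32, `|EE U s - 1| <= d & `|yy U P s - 2| <= d].
Proof.
move=> radU Uoo d d0.
have [e /andP[e0 e1] he] := small_e k1 d0.
have [B B0 HB] := nl_theta NL e0.
have [t0 Ht0] := Uoo (Num.max U0 B).
have H s : s <= t0 -> U0 <= U s /\ theta U s <= e.
  by move=> /Ht0; rewrite ge_max => /andP[? /HB].
exists t0 => s st.
have [Us the] := H _ st.
have rs := sing_reg radU Uoo Us.
have [_ _ E3 _] := rs.
have W := sing_lyap radU Uoo e0 e1 H st.
have Us0 := lt_le_trans U00 Us.
have [? ?] := lyap_close k1 (EE_gt0 NL Us0) E3 (ltW d0) (le_trans W he).
by split => //; lra.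
Qed.

(** The point is that [s1] does not depend on the start [a]. The proof is a continuity argument:
    while [U >= U1] the solution is close to the equilibrium, so [E >= 1 / 2] and
    [F U <= expR (2 s) / k]; for [s <= s1] this forces [U > U1] strictly, so [U1] is never
    reached. *)
Lemma ivp_trap d : 0 < d -> exists s1, forall U P a,
  (forall s, a <= s -> rsol U P s) ->
  0 < U a -> F (U a) = expR (2 * a) / (2 * k) -> P a = - (2 * (f (U a) * F (U a))) ->
  forall t, a <= t -> t <= s1 ->
    [/\ reg U P U0 t, theta U t <= 1 / 32, `|EE U t - 1| <= d & `|yy U P t - 2| <= d].
Proof.
move=> d0; pose d' := Num.min d (1 / 2).
have d'0 : 0 < d' by rewrite lt_min d0; lra.
have d'd : d' <= d by rewrite ge_min lexx.
have d'2 : d' <= 1 / 2 by rewrite ge_min lexx orbT.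
have [e /andP[e0 e1] he] := small_e k1 d'0.
have [B B0 HB] := nl_theta NL e0.
pose U1 := Num.max U0 B.
have U10 : 0 < U1 by rewrite lt_max U00.
have F0 := nl_F NL U10.
have two0 : 0 < 2 :> R by [].
have kF0 : 0 < k * F U1 / 2 by rewrite divr_gt0// mulr_gt0.
have [s1 Hs1] := expR_small two0 kF0.
exists s1 => U P a radU Ua FUa Pa t at_ ts1.
have Fbig s u : s <= s1 -> 0 < u -> F u <= expR (2 * s) / k -> U1 < u.
  move=> ss u0 Fu; rewrite ltNge; apply/negP => uU.
  have := F_nonincr NL u0 uU; have := Hs1 _ ss.
  move: Fu; rewrite ler_pdivlMr// => Fu h1 h2.
  have : F U1 * k <= F u * k by rewrite ler_pM2r.
  have : 0 < k * F U1 by rewrite mulr_gt0.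
  lra.
have close s : a <= s -> s <= s1 -> (forall x, a <= x <= s -> U1 <= U x) ->
    [/\ reg U P U0 s, `|EE U s - 1| <= d' & `|yy U P s - 2| <= d'].
  move=> as_ ss1 Ux.
  have Us : U1 <= U s by apply: Ux; rewrite as_ lexx.
  have U0s : U0 <= U s by apply: le_trans Us; rewrite le_max lexx.
  have radx x : a <= x <= s -> rsol U P x by move=> /andP[x1 _]; exact: radU.
  have rs : reg U P U0 s := reg_ivp NL U00 tail as_ radx Ua FUa Pa U0s.
  have [_ _ E3 _] := rs.
  have th x : a <= x <= s -> theta U x <= e.
    move=> h; apply: HB; apply: le_trans (Ux _ h).
    by rewrite le_max lexx orbT.
  have W := lyap_ivp NL U00 tail as_ radx Ua FUa Pa U0s e0 e1 th.
  have Us0 := lt_le_trans U00 U0s.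
  have [? ?] := lyap_close k1 (EE_gt0 NL Us0) E3 (ltW d'0) (le_trans W he).
  by split.
have as1 : a <= s1 := le_trans at_ ts1.
have ma : 0 < U a - U1.
  rewrite subr_gt0; apply: (Fbig a) => //; rewrite FUa ler_pM2l ?expR_gt0//.
  by rewrite lef_pV2 ?posrE; have := k0; lra.
have H s : a <= s -> s <= s1 -> U1 < U s.
  move=> as_ ss; rewrite ltNge; apply/negP => Us.
  have [x /andP[x1 _]| //||s2 [as2 s2s e2 Hs2]] := @first_time _ (fun x => U x - U1) a s.
  - have [dU _] := radU _ x1.
    by have := der_continuous (derB dU (der_cst x U1)).
  - by exists s; rewrite ?as_ ?lexx// subr_le0.
  have s2s1 : s2 <= s1 by exact: le_trans ss.
  have e2' : U s2 = U1 by lra.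
  have Ux x : a <= x <= s2 -> U1 <= U x.
    move=> /andP[x1]; rewrite le_eqVlt => /orP[/eqP->|x2]; first by rewrite e2'.
    by have := Hs2 x; rewrite x1 x2 => /(_ isT); lra.
  have [_ hE _] := close s2 (ltW as2) s2s1 Ux.
  have Us2 : 0 < U s2 by rewrite e2'.
  have := Fbig s2 _ s2s1 Us2; rewrite e2' ltxx => Hf; suff : false by []; apply: Hf.
  move: hE; rewrite ler_norml => /andP[hE _].
  have : 1 / 2 <= EE U s2 by lra.
  by rewrite /EE e2' ler_pdivlMr ?mulr_gt0// ler_pdivlMr//; lra.
have Ut x : a <= x <= t -> U1 <= U x.
  by move=> /andP[x1 x2]; apply/ltW/H => //; exact: le_trans ts1.
have [r h1 h2] := close t at_ ts1 Ut.
have the : theta U t <= e.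
  apply: HB; apply: le_trans (ltW (H _ at_ ts1)).
  by rewrite le_max lexx orbT.
split; [exact: r|lra|exact: le_trans d'd|exact: le_trans d'd].
Qed.

End sing.

(** * Uniqueness *)

Section gronwall.
Context {R : realType}.
Implicit Types (k c h p : R).

(** A modified energy for [h'' + k h' + 2 k h = 0], the linearization at the equilibrium. Without
    the product term the derivative is [- k p^2], which gives no decay in [h]. *)
Definition qform k h p : R := p ^+ 2 / 2 + k * h ^+ 2 + h * p / 2.

Definition dqform k c h p : R :=
  let dp := - k * p - c * h in p * dp + 2 * k * h * p + (p * p + h * dp) / 2.

Lemma qform_ge k h p : 1 <= k -> (h ^+ 2 + p ^+ 2) / 4 <= qform k h p.
Proof.
move=> k1; have h2 := sqr_ge0 h; have p2 := sqr_ge0 p.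
have : 0 <= (h + p) ^+ 2 by exact: sqr_ge0.
have : h ^+ 2 <= k * h ^+ 2 by rewrite -{1}[h ^+ 2]mul1r ler_wpM2r.
rewrite /qform; lra.
Qed.

Lemma qform_le k h p : 1 <= k -> qform k h p <= (k + 1) * (h ^+ 2 + p ^+ 2).
Proof.
move=> k1; have h2 := sqr_ge0 h; have p2 := sqr_ge0 p.
have : 0 <= (h - p) ^+ 2 by exact: sqr_ge0.
have : p ^+ 2 <= k * p ^+ 2 by rewrite -{1}[p ^+ 2]mul1r ler_wpM2r.
rewrite /qform; lra.
Qed.

Lemma dqform_decay k c h p : 1 <= k -> `|c - 2 * k| <= k / 8 ->
  dqform k c h p <= - (1 / 16) * qform k h p.
Proof.
move=> k1; rewrite ler_norml => /andP[c1 c2].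
pose dl := c - 2 * k.
have h2 := sqr_ge0 h; have p2 := sqr_ge0 p.
have kh : h ^+ 2 <= k * h ^+ 2 by rewrite -{1}[h ^+ 2]mul1r ler_wpM2r.
have kp : p ^+ 2 <= k * p ^+ 2 by rewrite -{1}[p ^+ 2]mul1r ler_wpM2r.
have hp1 : h * p <= (h ^+ 2 + p ^+ 2) / 2.
  by have := sqr_ge0 (h - p); lra.
have hp2 : - (h * p) <= (h ^+ 2 + p ^+ 2) / 2.
  by have := sqr_ge0 (h + p); lra.
have e1 : dqform k c h p = - (k - 1 / 2) * p ^+ 2 - (dl + k / 2) * (h * p)
  - k * h ^+ 2 - dl / 2 * h ^+ 2.
  by rewrite /dqform /dl; field.
have b1 : - (dl + k / 2) * (h * p) <= (5 * k / 8) * ((h ^+ 2 + p ^+ 2) / 2).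
  apply: (@le_trans _ _ ((dl + k / 2) * ((h ^+ 2 + p ^+ 2) / 2))).
    rewrite mulNr -mulrN; apply: ler_wpM2l => //; rewrite /dl; lra.
  apply: ler_wpM2r; first lra.
  by rewrite /dl; lra.
have b2 : - (dl / 2) * h ^+ 2 <= k / 16 * h ^+ 2.
  by apply: ler_wpM2r => //; rewrite /dl; lra.
rewrite e1 /qform; lra.
Qed.

Lemma dqform_growth k c h p K : 1 <= k -> `|c| <= K ->
  dqform k c h p <= (12 * k + 6 * K + 6) * qform k h p.
Proof.
move=> k1 cK; have q := qform_ge h p k1.
have K0 : 0 <= K by apply: le_trans cK.
move: cK; rewrite ler_norml => /andP[c1 c2].
have h2 := sqr_ge0 h; have p2 := sqr_ge0 p.
set r := h ^+ 2 + p ^+ 2 in q *.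
have hp1 : h * p <= r / 2.
  by rewrite /r; have := sqr_ge0 (h - p); lra.
have hp2 : - (h * p) <= r / 2.
  by rewrite /r; have := sqr_ge0 (h + p); lra.
have b1 : - c * (h * p) <= K * (r / 2).
  case: (leP 0 c) => c0.
    rewrite mulNr -mulrN; apply: (@le_trans _ _ (c * (r / 2))).
      by apply: ler_wpM2l.
    by apply: ler_wpM2r => //; rewrite /r; lra.
  apply: (@le_trans _ _ (- c * (r / 2))).
    by apply: ler_wpM2l => //; lra.
  by apply: ler_wpM2r; [rewrite /r; lra|lra].
have b2 : - c * h ^+ 2 <= K * r.
  apply: (@le_trans _ _ (K * h ^+ 2)); first by apply: ler_wpM2r => //; lra.
  by apply: ler_wpM2l => //; rewrite /r; lra.
have b3 : k * (h * p) <= k * (r / 2) by apply: ler_wpM2l => //; lra.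
have b4 : p ^+ 2 <= r by rewrite /r; lra.
have b5 : 0 <= k * p ^+ 2 by rewrite mulr_ge0//; lra.
have r0 : 0 <= r by rewrite /r addr_ge0.
have : (3 * k + 3 / 2 * K + 3 / 2) * r <= (3 * k + 3 / 2 * K + 3 / 2) * (4 * qform k h p).
  by apply: ler_wpM2l; lra.
have e1 : dqform k c h p = - k * p ^+ 2 - c * (h * p) + 2 * (k * (h * p)) + p ^+ 2 / 2
  - k * (h * p) / 2 - c * h ^+ 2 / 2.
  by rewrite /dqform; field.
have b6 : - (k * (h * p)) <= k * (r / 2) by rewrite -mulrN; apply: ler_wpM2l => //; lra.
have kr : 0 <= k * r by rewrite mulr_ge0//; lra.
have Kr : 0 <= K * r by rewrite mulr_ge0.
rewrite e1; lra.
Qed.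

Lemma gronwall (Q dQ : R -> R) (A a t : R) : a <= t ->
  (forall s : R, a <= s <= t -> is_derive s 1 Q (dQ s)) ->
  (forall s : R, a <= s <= t -> dQ s <= A * Q s) ->
  Q t <= expR (A * (t - a)) * Q a.
Proof.
move=> at_ Qd Qle.
have : expR (- A * t) * Q t <= expR (- A * a) * Q a.
  rewrite -lerN2.
  apply: (@der_mono _ (fun s => - (expR (- A * s) * Q s))
    (fun s => - (- A * expR (- A * s) * Q s + expR (- A * s) * dQ s)) a t at_) => s h.
    by apply/derN/derM; [exact: der_expZ|exact: Qd].
  have hh : a <= s <= t by case/andP: h => /ltW-> /ltW->.
  have : expR (- A * s) * dQ s <= expR (- A * s) * (A * Q s).
    by rewrite ler_pM2l ?expR_gt0// Qle.
  lra.
have -> : expR (- A * a) = expR (A * (t - a)) * expR (- A * t).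
  by rewrite -expRD; congr expR; ring.
rewrite -mulrA [X in _ <= X]mulrCA ler_pM2l ?expR_gt0//.
Qed.

End gronwall.

(** * The linear equation for the difference of two solutions *)

Section difference.
Context {R : realType}.
Implicit Types (s t a b u v e d : R) (U P : R -> R).
Variables (k : R) (f f1 F Phi : R -> R).
Hypothesis NL : nonlinearity k f f1 F Phi.
Variables U0 C : R.
Hypothesis U00 : 0 < U0.
Hypothesis C0 : 0 < C.
Hypothesis tail : forall u, U0 <= u -> f1 u * F u <= 1 /\ f u * F u <= C.

Let k1 : 1 <= k := nl_k NL.
Let k0 : 0 < k. Proof. by have := k1; lra. Qed.

Local Notation rsol := (rsol k f).
Local Notation EE := (EE k F).
Local Notation yy := (yy f F).
Local Notation theta := (theta f1 F).
Local Notation reg := (reg k f F).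

Lemma ext0_mvt u v : 0 <= u -> u < v ->
  exists2 x, u < x < v & ext0 f v - ext0 f u = f1 x * (v - u).
Proof.
move=> u0 uv; apply: (@mvt _ (ext0 f) f1 u v uv) => x /andP[x1 x2].
  exact: (nl_cont NL).
have x0 : 0 < x by exact: le_lt_trans x1.
apply: near_eq_is_derive (nl_der NL x0).
by near=> y; rewrite ext0_nneg// ltW//; near: y; exact: lt_nbhsr.
Unshelve. all: by end_near. Qed.

Lemma ext0_lip M u v : 0 < M -> u <= M -> v <= M ->
  `|ext0 f u - ext0 f v| <= f1 M * `|u - v|.
Proof.
move=> M0; wlog uv : u v / u <= v => [H uM vM|uM vM].
  by case: (leP u v) => [/H->//|/ltW/H]; rewrite distrC [`|v - u|]distrC; apply.
have f1M : 0 <= f1 M by exact/ltW/(nl_f1 NL).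
rewrite distrC [`|u - v|]distrC [`|v - u|]ger0_norm ?subr_ge0//.
rewrite ger0_norm ?subr_ge0 ?(ext0_mono NL)//.
case: (leP v 0) => v0.
  rewrite !(ext0_npos (nl_f0 NL)) ?subrr ?(le_trans uv)//.
  by rewrite mulr_ge0// subr_ge0.
pose u' := Num.max u 0.
have -> : ext0 f u = ext0 f u' by rewrite /ext0 /u' -maxA maxxx.
have u'0 : 0 <= u' by rewrite le_max lexx orbT.
have uu' : u <= u' by rewrite le_max lexx.
have : u' <= v by rewrite ge_max uv ltW.
rewrite le_eqVlt => /orP[/eqP->|u'v].
  by rewrite subrr mulr_ge0// subr_ge0.
have [x /andP[x1 x2] ->] := ext0_mvt u'0 u'v.
apply: ler_pM.
- by apply/ltW/(nl_f1 NL); exact: le_lt_trans x1.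
- by rewrite subr_ge0 ltW.
- by apply: (nl_f1_mono NL); [exact: le_lt_trans x1|rewrite (le_trans (ltW x2))].
- by rewrite lerD2l lerN2.
Qed.

(** The tolerance [1 / 32] keeps [E (1 - theta)] within [1 / 16] of 1, hence [expR (2 s) f'(U)]
    within [k / 8] of [2 k], as [dqform_decay] requires. *)
Definition near_sing U P s :=
  [/\ reg U P U0 s, theta U s <= 1 / 32, `|EE U s - 1| <= 1 / 32 & `|yy U P s - 2| <= 1 / 32].

Lemma f1_EE U P s : near_sing U P s ->
  2 * k - k / 8 <= expR (2 * s) * f1 (U s) <= 2 * k + k / 8.
Proof.
move=> [[Us _ _ _] th E1 _]; have Us0 := lt_le_trans U00 Us.
have th0 := theta_ge0 tail Us.
have F0 := nl_F NL Us0.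
have -> : expR (2 * s) * f1 (U s) = 2 * k * (EE U s * (1 - theta U s)).
  by rewrite /EE /theta; field; rewrite !gt_eqF.
move: E1; rewrite ler_norml; move: th th0; set x := theta _ _; set y := EE _ _ => th th0 /andP[y1 y2].
have : 15 / 16 <= y * (1 - x) by nra.
have : y * (1 - x) <= 17 / 16 by nra.
have := k0; set z := y * (1 - x); nra.
Qed.

Section two.
Variables U1 P1 U2 P2 : R -> R.

Definition qdiff s := qform k (U1 s - U2 s) (P1 s - P2 s).

Lemma qdiff_der s c : rsol U1 P1 s -> rsol U2 P2 s ->
  expR (2 * s) * (ext0 f (U1 s) - ext0 f (U2 s)) = c * (U1 s - U2 s) ->
  is_derive s 1 qdiff (dqform k c (U1 s - U2 s) (P1 s - P2 s)).
Proof.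
move=> [dU1 dP1] [dU2 dP2] hc.
have dh := derB dU1 dU2; have dp := derB dP1 dP2.
have d1 := derM (derX2 dp) (der_cst s (2^-1 : R)).
have d2 := derZ k (derX2 dh).
have d3 := derM (derM dh dp) (der_cst s (2^-1 : R)).
refine (der_eq (derD (derD d1 d2) d3) _).
by rewrite /dqform -hc; field.
Qed.

(** The zeroth-order coefficient in the equation for [U1 - U2]. Where the solutions meet any value
    would satisfy [dquotE]; [2 * k] is the equilibrium value, so [dquot_near] is immediate there. *)
Definition dquot s :=
  if U1 s == U2 s then 2 * k
  else expR (2 * s) * (ext0 f (U1 s) - ext0 f (U2 s)) / (U1 s - U2 s).

Lemma dquotE s : expR (2 * s) * (ext0 f (U1 s) - ext0 f (U2 s)) = dquot s * (U1 s - U2 s).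
Proof.
rewrite /dquot; case: eqP => [->|/eqP ne]; first by rewrite !subrr !mulr0.
by rewrite mulfVK// subr_eq0.
Qed.

Lemma dquot_near s : near_sing U1 P1 s -> near_sing U2 P2 s ->
  `|dquot s - 2 * k| <= k / 8.
Proof.
move=> n1 n2; rewrite /dquot; case: eqP => [_|/eqP ne].
  by rewrite subrr normr0; have := k0; lra.
have /andP[a1 b1] := f1_EE n1; have /andP[a2 b2] := f1_EE n2.
have [[Us1 _ _ _] _ _ _] := n1; have [[Us2 _ _ _] _ _ _] := n2.
have p1 := lt_le_trans U00 Us1; have p2 := lt_le_trans U00 Us2.
have ex := expR_gt0 (2 * s).
suff [x hx] : exists2 x, expR (2 * s) * f1 (Num.min (U1 s) (U2 s)) <= x <=
    expR (2 * s) * f1 (Num.max (U1 s) (U2 s)) &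
    expR (2 * s) * (ext0 f (U1 s) - ext0 f (U2 s)) / (U1 s - U2 s) = x.
  move=> ->; move: hx => /andP[]; rewrite ler_norml.
  by case: (leP (U1 s) (U2 s)) => _ h1 h2; apply/andP; split; lra.
case: (ltgtP (U1 s) (U2 s)) => [lt|lt|e]; last by rewrite e eqxx in ne.
- have [x /andP[x1 x2] hx] := ext0_mvt (ltW p1) lt.
  exists (expR (2 * s) * f1 x).
    by rewrite !ler_pM2l// !(nl_f1_mono NL) ?ltW// (lt_trans p1).
  have -> : ext0 f (U1 s) - ext0 f (U2 s) = f1 x * (U1 s - U2 s) by lra.
  by rewrite mulrA mulfK// subr_eq0.
- have [x /andP[x1 x2] hx] := ext0_mvt (ltW p2) lt.
  exists (expR (2 * s) * f1 x).
    by rewrite !ler_pM2l// !(nl_f1_mono NL) ?ltW// (lt_trans p2).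
  by rewrite hx mulrA mulfK// subr_eq0.
Qed.

Lemma dquot_bound s M : 0 < M -> U1 s <= M -> U2 s <= M ->
  `|dquot s| <= 2 * k + expR (2 * s) * f1 M.
Proof.
move=> M0 h1 h2; have f1M := nl_f1 NL M0.
rewrite /dquot; case: eqP => [_|/eqP ne].
  by rewrite ger0_norm ?lerDl ?mulr_ge0 ?expR_ge0// ltW// k0.
have := ext0_lip M0 h1 h2 => H.
have ne0 : 0 < `|U1 s - U2 s| by rewrite normr_gt0 subr_eq0.
rewrite normrM normfV ler_pdivrMr// normrM (gtr0_norm (expR_gt0 _)).
apply: (@le_trans _ _ (expR (2 * s) * (f1 M * `|U1 s - U2 s|))).
  by rewrite ler_pM2l ?expR_gt0.
by rewrite mulrA ler_pM2r// lerDr mulr_ge0// ltW// k0.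
Qed.

Lemma qdiff_decay a t : a <= t ->
  (forall s, a <= s <= t -> rsol U1 P1 s /\ rsol U2 P2 s) ->
  (forall s, a <= s <= t -> near_sing U1 P1 s /\ near_sing U2 P2 s) ->
  qdiff t <= expR (- (1 / 16) * (t - a)) * qdiff a.
Proof.
move=> at_ H N.
apply: (@gronwall _ qdiff (fun s => dqform k (dquot s) (U1 s - U2 s) (P1 s - P2 s)) _ a t at_) => s h.
  by have [? ?] := H _ h; apply: qdiff_der => //; exact: dquotE.
by have [? ?] := N _ h; apply: dqform_decay; [exact: k1|exact: dquot_near].
Qed.

Lemma qdiff_growth a t M : a <= t -> 0 < M ->
  (forall s, a <= s <= t -> rsol U1 P1 s /\ rsol U2 P2 s) ->
  (forall s, a <= s <= t -> U1 s <= M /\ U2 s <= M) ->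
  qdiff t <= expR ((12 * k + 6 * (2 * k + expR (2 * t) * f1 M) + 6) * (t - a)) * qdiff a.
Proof.
move=> at_ M0 H N.
apply: (@gronwall _ qdiff (fun s => dqform k (dquot s) (U1 s - U2 s) (P1 s - P2 s)) _ a t at_) => s h.
  by have [? ?] := H _ h; apply: qdiff_der => //; exact: dquotE.
have [? ?] := N _ h; apply: dqform_growth; first exact: k1.
apply: (le_trans (@dquot_bound s M _ _ _)) => //.
have f1M := nl_f1 NL M0; have /andP[_ st] := h.
by rewrite lerD2l ler_pM2r// ler_expR ler_pM2l.
Qed.

Lemma near_sing_P U P s : near_sing U P s -> - (3 * C) <= P s <= 0.
Proof.
move=> [[Us Ps _ _] _ _ y2]; rewrite Ps andbT.
have Us0 := lt_le_trans U00 Us; have F0 := nl_F NL Us0; have f0 := nl_pos NL Us0.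
have [_ fF] := tail Us; have fF0 : 0 < f (U s) * F (U s) by rewrite mulr_gt0.
have -> : P s = - (f (U s) * F (U s) * yy U P s).
  by rewrite /yy; field; rewrite !gt_eqF.
move: y2; rewrite ler_norml lerN2 => /andP[_ y2].
have : f (U s) * F (U s) * yy U P s <= f (U s) * F (U s) * 3 by rewrite ler_pM2l//; lra.
lra.
Qed.

(* [f F] is bounded, so [u] is a Lipschitz function of [ln (F u)]. *)
Lemma lnF_lip u v : U0 <= u -> u <= v -> v - u <= C * (ln (F u) - ln (F v)).
Proof.
move=> Uu uv; have pos x : u <= x -> U0 <= x /\ 0 < x.
  by move=> ux; have h := le_trans Uu ux; split=> //; exact: lt_le_trans h.
rewrite mulrBr.
have -> : C * ln (F u) - C * ln (F v) = - C * ln (F v) - - C * ln (F u) by ring.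
apply: (@der_compare _ (fun x => x) (fun x => - C * ln (F x)) (fun=> 1)
  (fun x => - C * (- (f x)^-1 / F x)) u v uv) => x /andP[ux _].
- have [_ x0] := pos _ ux.
  by apply/derZ/der_ln; [exact: (nl_F NL)|exact: (nl_F_der NL)].
have [Ux x0] := pos _ (ltW ux).
have [_ fF] := tail Ux; have F0 := nl_F NL x0; have f0 := nl_pos NL x0.
have -> : - C * (- (f x)^-1 / F x) = C / (f x * F x) by field; rewrite !gt_eqF.
by rewrite ler_pdivlMr ?mulr_gt0// mul1r.
Qed.

Lemma lnF_EE U s : 0 < U s -> ln (F (U s)) = 2 * s - ln (2 * k) - ln (EE U s).
Proof.
move=> Us; have F0 := nl_F NL Us.
have -> : ln (EE U s) = 2 * s - (ln (2 * k) + ln (F (U s))).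
  by rewrite /EE ln_div ?posrE ?expR_gt0 ?mulr_gt0// expRK [ln (_ * F _)]lnM ?posrE ?mulr_gt0.
ring.
Qed.

Lemma ln_near1 (x : R) : `|x - 1| <= 1 / 32 -> - 1 <= ln x <= 1.
Proof.
rewrite ler_norml => /andP[x1 x2]; have x0 : 0 < x by lra.
have e1 : 2 <= expR (1 : R) by have := @expR_ge1Dx R 1; lra.
apply/andP; split.
  rewrite -ler_expR lnK ?posrE// expRN.
  apply: (@le_trans _ _ 2^-1); last lra.
  by rewrite lef_pV2 ?posrE ?expR_gt0.
by rewrite -ler_expR lnK ?posrE//; lra.
Qed.

(** The bound is independent of [s]. By [lnF_EE] the two values of [ln (F U)] differ only through
    [ln E], by at most 2, so [lnF_lip] gives [2 C] for the difference of the [U]; both slopes lie in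
    [[- 3 C, 0]]. *)
Lemma qdiff_bound s : near_sing U1 P1 s -> near_sing U2 P2 s ->
  qdiff s <= (k + 1) * ((2 * C) ^+ 2 + (3 * C) ^+ 2).
Proof.
move=> n1 n2; apply: (le_trans (qform_le _ _ k1)).
apply: ler_wpM2l; first by have := k0; lra.
have [[V1 _ _ _] _ e1 _] := n1; have [[V2 _ _ _] _ e2 _] := n2.
have p1 := lt_le_trans U00 V1; have p2 := lt_le_trans U00 V2.
have /andP[l1 l1'] := ln_near1 e1; have /andP[l2 l2'] := ln_near1 e2.
have /andP[q1 q1'] := near_sing_P n1; have /andP[q2 q2'] := near_sing_P n2.
apply: lerD; rewrite -ler_sqrt ?sqr_ge0// sqrtr_sqr sqrtr_sqr.
  rewrite [`|2 * C|]ger0_norm; last by have := C0; lra.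
  case: (leP (U1 s) (U2 s)) => h.
    rewrite distrC ger0_norm ?subr_ge0//.
    apply: (le_trans (lnF_lip V1 h)); rewrite [2 * C]mulrC; apply: ler_wpM2l; first exact: ltW.
    by rewrite !lnF_EE//; lra.
  rewrite ger0_norm; last by rewrite subr_ge0 ltW.
  apply: (le_trans (lnF_lip V2 (ltW h))); rewrite [2 * C]mulrC; apply: ler_wpM2l; first exact: ltW.
  by rewrite !lnF_EE//; lra.
rewrite [`|3 * C|]ger0_norm; last by have := C0; lra.
by rewrite ler_norml; apply/andP; split; lra.
Qed.

Lemma qdiff_eq s : qdiff s <= 0 -> U1 s = U2 s /\ P1 s = P2 s.
Proof.
move=> q0; have := qform_ge (U1 s - U2 s) (P1 s - P2 s) k1.
move=> /le_trans/(_ q0); have := sqr_ge0 (U1 s - U2 s); have := sqr_ge0 (P1 s - P2 s).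
move=> h1 h2 h3.
have e1 : (U1 s - U2 s) ^+ 2 = 0 by apply/eqP; rewrite eq_le h2 andbT; lra.
have e2 : (P1 s - P2 s) ^+ 2 = 0 by apply/eqP; rewrite eq_le h1 andbT; lra.
by move: e1 e2 => /eqP + /eqP; rewrite !sqrf_eq0 !subr_eq0 => /eqP-> /eqP->.
Qed.

End two.

Lemma sing_near U P :
  (forall s, rsol U P s) -> (forall M : R, exists s0, forall s, s <= s0 -> M <= U s) ->
  exists t0, forall s, s <= t0 -> near_sing U P s.
Proof.
move=> radU Uoo; have d0 : 0 < 1 / 32 :> R by lra.
exact: (sing_asymptotics NL U00 tail radU Uoo d0).
Qed.

Theorem sing_unique U P V Q :
  (forall s, rsol U P s) -> (forall M : R, exists s0, forall s, s <= s0 -> M <= U s) ->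
  (forall s, rsol V Q s) -> (forall M : R, exists s0, forall s, s <= s0 -> M <= V s) ->
  forall s, U s = V s.
Proof.
move=> rU Uoo rV Voo.
have [t1 H1] := sing_near rU Uoo; have [t2 H2] := sing_near rV Voo.
pose t0 := Num.min t1 t2.
have N s : s <= t0 -> near_sing U P s /\ near_sing V Q s.
  by rewrite le_min => /andP[? ?]; split; [exact: H1|exact: H2].
have B s : s <= t0 -> qdiff U P V Q s <= 0.
  move=> st; pose B0 := (k + 1) * ((2 * C) ^+ 2 + (3 * C) ^+ 2).
  have c0 : 0 < 1 / 16 :> R by lra.
  apply: (@le_exp_small _ _ _ (expR (- (1 / 16) * s) * B0) (1 / 16) s c0) => a as_.
  have [n1 n2] := N _ (le_trans as_ st).
  have := qdiff_decay as_ (fun x _ => conj (rU x) (rV x)).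
  move=> /(_ _)/le_trans; apply; first by move=> x /andP[_ xs]; apply: N; exact: le_trans st.
  rewrite add0r.
  have -> : expR (- (1 / 16) * (s - a)) = expR (- (1 / 16) * s) * expR (1 / 16 * a).
    by rewrite -expRD; congr expR; ring.
  by rewrite [leRHS]mulrAC ler_pM2l ?mulr_gt0 ?expR_gt0//; exact: qdiff_bound.
move=> s; case: (leP s t0) => st; first by have [] := qdiff_eq (B _ st).
have ni W T x : (forall s, rsol W T s) -> (forall M : R, exists s0, forall s, s <= s0 -> M <= W s) ->
   t0 <= x -> W x <= W t0.
  by move=> rW Woo; exact: (sing_nonincr NL rW Woo).
(* To the right of [t0] the solutions may leave the neighbourhood of the equilibrium; crude
   exponential growth suffices, as the difference at [t0] is already zero. *)
pose M := `|U t0| + `|V t0| + 1.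
have M0 : 0 < M by rewrite ltr_wpDl// addr_ge0.
suff : qdiff U P V Q s <= 0 by move=> /qdiff_eq[].
apply: (@le_trans _ _ (expR ((12 * k + 6 * (2 * k + expR (2 * s) * f1 M) + 6) * (s - t0)) *
    qdiff U P V Q t0)); last by rewrite pmulr_rle0 ?expR_gt0// B.
apply: (qdiff_growth (ltW st) M0 (fun x _ => conj (rU x) (rV x))) => x /andP[tx _].
have := ni _ _ _ rU Uoo tx; have := ni _ _ _ rV Voo tx.
have := ler_norm (U t0); have := ler_norm (V t0).
have := normr_ge0 (U t0); have := normr_ge0 (V t0).
by rewrite /M; split; lra.
Qed.

End difference.

(** * Existence *)

Section limits.
Context {R : realType}.
Implicit Types (s t a b c e l M : R).

(** The intervals of radius [r n] about [u n] meet pairwise, so the supremum of their left ends lies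
    in all of them; the explicit rate is retained. *)
Lemma cauchy_rate (u r : nat -> R) :
  (forall n m, (n <= m)%N -> `|u m - u n| <= r n) ->
  exists l, forall n, `|u n - l| <= r n.
Proof.
move=> H.
have le n m : u n - r n <= u m + r m.
  case/orP: (leq_total n m) => h; have := H _ _ h; rewrite ler_norml => /andP[h1 h2].
    by have := H m m (leqnn m); have := normr_ge0 (u m - u m); lra.
  by have := H n n (leqnn n); have := normr_ge0 (u n - u n); lra.
have hs : has_sup (range (fun n => u n - r n)).
  split; first by exists (u 0%N - r 0%N), 0%N.
  by exists (u 0%N + r 0%N) => _ [n _ <-].
exists (sup (range (fun n => u n - r n))) => n.
have h1 : u n - r n <= sup (range (fun n => u n - r n)).
  by apply: ub_le_sup; [exact: hs.2|exists n].
have h2 : sup (range (fun n => u n - r n)) <= u n + r n.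
  by apply: ge_sup; [exact: hs.1|move=> _ [m _ <-]].
by rewrite ler_norml; apply/andP; split; lra.
Qed.

Lemma geo_small M e : 0 < e -> exists n0, forall n, (n0 <= n)%N -> M * 2^-1 ^+ n <= e.
Proof.
move=> e0; pose n0 := Num.bound (`|M| / e); exists n0 => n nn.
have nM : `|M| / e < n%:R.
  have : `|M| / e < n0%:R.
    by apply: archi_boundP; rewrite divr_ge0// ltW.
  by move=> /lt_le_trans; apply; rewrite ler_nat.
have p2 m : m%:R <= 2 ^+ m :> R.
  elim: m => [|m IH]; first by rewrite expr0.
  rewrite exprS -natr1; have : 1 <= 2 ^+ m :> R by rewrite exprn_ege1// ler1n.
  by move: IH; set q := 2 ^+ m; lra.
rewrite exprVn ler_pdivrMr ?exprn_gt0//.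
apply: (le_trans (ler_norm M)); rewrite mulrC -ler_pdivrMr//.
exact: le_trans (ltW nM) (p2 n).
Qed.

Definition luc (u : nat -> R -> R) (U : R -> R) := forall b e, 0 < e ->
  exists n0, forall n, (n0 <= n)%N -> forall s, `|s| <= b -> `|u n s - U s| <= e.

Lemma luc_continuous u U : luc u U ->
  (forall b, exists n0, forall n, (n0 <= n)%N -> forall s, `|s| <= b ->
    {for s, continuous (u n)}) -> continuous U.
Proof.
move=> uU cu s; apply/cvgrPdist_le => e e0.
have e3 : 0 < e / 3 by rewrite divr_gt0.
have [n0 Hn0] := uU (`|s| + 1) _ e3.
have [n1 Hn1] := cu (`|s| + 1).
pose n := maxn n0 n1.
have h0 := Hn0 n (leq_maxl _ _); have h1 := Hn1 n (leq_maxr _ _).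
have s1 : `|s| <= `|s| + 1 by lra.
have /cvgrPdist_le/(_ _ e3) := h1 s s1 => near_n.
near=> t.
have t1 : `|t| <= `|s| + 1.
  have : `|s - t| < 1 by near: t; exact: (@cvgr_dist_lt _ _ _ _ _ id s).
  have := ler_normD s (t - s); rewrite addrC subrK [`|t - s|]distrC; lra.
have := h0 _ s1; have := h0 _ t1.
have : `|u n s - u n t| <= e / 3 by near: t.
rewrite !ler_norml => /andP[? ?] /andP[? ?] /andP[? ?]; apply/andP; split; lra.
Unshelve. all: by end_near. Qed.

(** With [G] an antiderivative of [V], the mean value theorem applied to [u n - G], whose derivative
    [v n - V] is small, shows that [U - G] is constant. *)
Lemma luc_derive u v U V : luc u U -> luc v V -> continuous V ->
  (forall b, exists n0, forall n, (n0 <= n)%N -> forall s, `|s| <= b ->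
    is_derive s 1 (u n) (v n s)) -> forall s, is_derive s 1 U (V s).
Proof.
move=> uU vV cV d s.
have [G Gd] := antiderivative cV.
have key t : U t - G t = U 0 - G 0.
  apply/eqP; rewrite -subr_eq0 -normr_le0; apply/ler_addgt0Pl => e e0; rewrite addr0.
  pose b := `|t|; have b0 : 0 <= b by rewrite normr_ge0.
  pose e' := e / (2 + b); have e'0 : 0 < e' by rewrite divr_gt0//; lra.
  have [n0 H0] := uU b _ e'0; have [n1 H1] := vV b _ e'0; have [n2 H2] := d b.
  pose n := maxn n0 (maxn n1 n2).
  have {}H0 := H0 n (leq_maxl _ _).
  have {}H1 := H1 n (leq_trans (leq_maxl _ _) (leq_maxr _ _)).
  have {}H2 := H2 n (leq_trans (leq_maxr _ _) (leq_maxr _ _)).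
  have gd (x : R) : `|x| <= b -> is_derive x 1 (fun x => u n x - G x) (v n x - V x).
    by move=> xb; exact: (derB (H2 _ xb) (Gd x)).
  have b00 : `|0 : R| <= b by rewrite normr0.
  have bt : `|t| <= b by [].
  have m : `|(u n t - G t) - (u n 0 - G 0)| <= e' * b.
    case: (ltgtP t 0) => [t0|t0|->]; last by rewrite subrr normr0 mulr_ge0// ltW.
    - have xb (x : R) : t <= x <= 0 -> `|x| <= b.
        by move=> /andP[x1 x2]; rewrite /b !ler0_norm ?lerN2// ltW.
      have [x /xb/gd/der_continuous//|x /andP[x1 x2]|c /andP[c1 c2] e1] :=
          @mvt _ (fun x => u n x - G x) (fun x => v n x - V x) t 0 t0.
        by apply/gd/xb; rewrite !ltW.
      rewrite distrC e1 normrM sub0r normrN -/b ler_wpM2r//.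
      by apply: H1; apply: xb; rewrite !ltW.
    - have xb (x : R) : 0 <= x <= t -> `|x| <= b.
        by move=> /andP[x1 x2]; rewrite /b !ger0_norm// ltW.
      have [x /xb/gd/der_continuous//|x /andP[x1 x2]|c /andP[c1 c2] e1] :=
          @mvt _ (fun x => u n x - G x) (fun x => v n x - V x) 0 t t0.
        by apply/gd/xb; rewrite !ltW.
      rewrite e1 normrM subr0 -/b ler_wpM2r//.
      by apply: H1; apply: xb; rewrite !ltW.
  have he : e' * (2 + b) = e by rewrite mulfVK// gt_eqF//; lra.
  have := H0 _ bt; have := H0 _ b00; move: m; rewrite !ler_norml.
  move=> /andP[? ?] /andP[? ?] /andP[? ?]; apply/andP; split; lra.
have -> : U = fun t => G t + (U 0 - G 0).
  by apply/funext => t; rewrite -(key t); ring.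
by have := derD (Gd s) (der_cst s (U 0 - G 0)); rewrite addr0.
Qed.

End limits.

(** * The initial value problem for a globally Lipschitz nonlinearity *)

Section picard.
Context {R : realType}.
Implicit Types (s t u v c : R) (X Y Z : R -> R).
Variables (k L a alpha beta : R) (phi : R -> R).
Hypothesis k1 : 1 <= k.
Hypothesis L0 : 0 < L.
Hypothesis phi_lip : forall u v, `|phi u - phi v| <= L * `|u - v|.

Let lam := L / (k + 2).
(* The contraction weight solves the linear comparison problem: with respect to
   [e^{ks}], [omega'' + k omega' >= 2 L e^{2s} omega]. *)
Let omega s := expR (lam * expR (2 * s)).
Let domega s := 2 * lam * (expR (2 * s) * omega s).

Let k2 : 0 < k + 2. Proof. by have := k1; lra. Qed.
Let lam0 : 0 < lam. Proof. by rewrite divr_gt0. Qed.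

Let omega_der s : is_derive s 1 omega (domega s).
Proof.
refine (der_eq (der_exp (derZ lam (der_expZ 2 s))) _).
by rewrite /domega /omega; ring.
Qed.

Let omega_ge1 s : 1 <= omega s.
Proof. by rewrite /omega -expR0 ler_expR mulr_ge0 ?expR_ge0// ltW. Qed.

Let omega_mono s t : s <= t -> omega s <= omega t.
Proof. by move=> st; rewrite /omega ler_expR ler_pM2l// ler_expR ler_pM2l. Qed.

Let domega_gt0 s : 0 < domega s.
Proof.
apply: mulr_gt0; last by apply: mulr_gt0; exact: expR_gt0.
by apply: mulr_gt0; last exact: lam0.
Qed.

Let domega_flux_der s : is_derive s 1 (fun s => expR (k * s) * domega s)
  (2 * lam * (expR ((k + 2) * s) * ((k + 2) + 2 * lam * expR (2 * s)) * omega s)).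
Proof.
have -> : (fun s => expR (k * s) * domega s) =
          (fun s => 2 * lam * (expR ((k + 2) * s) * omega s)).
  apply/funext => x; rewrite /domega.
  have -> : expR ((k + 2) * x) = expR (k * x) * expR (2 * x) by rewrite mulrDl expRD.
  by ring.
refine (der_eq (derZ (2 * lam) (derM (der_expZ (k + 2) s) (omega_der s))) _).
by rewrite /domega; ring.
Qed.

(** [c / 2 * omega] is a supersolution for sources of size [c * L * omega]: comparing fluxes bounds
    [E], and one more integration bounds [D]. By linearity the upper bound gives the lower one. *)
Lemma weighted_bound (D E S : R -> R) c : 0 <= c ->
  (forall s, a <= s -> is_derive s 1 D (E s)) ->
  (forall s, a <= s -> is_derive s 1 E (- k * E s - expR (2 * s) * S s)) ->
  (forall s, a <= s -> `|S s| <= c * L * omega s) ->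
  D a = 0 -> `|E a| <= c / 2 * domega a ->
  forall s, a <= s -> `|D s| <= c / 2 * omega s.
Proof.
move=> c0; suff half (D' E' S' : R -> R) :
    (forall s, a <= s -> is_derive s 1 D' (E' s)) ->
    (forall s, a <= s -> is_derive s 1 E' (- k * E' s - expR (2 * s) * S' s)) ->
    (forall s, a <= s -> `|S' s| <= c * L * omega s) ->
    D' a = 0 -> `|E' a| <= c / 2 * domega a ->
    forall s, a <= s -> D' s <= c / 2 * omega s.
  move=> dD dE hS Da Ea s as_; rewrite ler_norml (half D E S)// andbT lerNl.
  apply: (half (fun x => - D x) (fun x => - E x) (fun x => - S x)) => //.
  - by move=> x ax; apply/derN/dD.
  - by move=> x ax; apply: der_eq (derN (dE x ax)) _; ring.
  - by move=> x ax; rewrite normrN hS.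
  - by rewrite Da oppr0.
  - by rewrite normrN.
move=> dD dE hS Da Ea s as_.
have hE x : a <= x -> E' x <= c / 2 * domega x.
  move=> ax.
  have : expR (k * x) * E' x - expR (k * a) * E' a <=
      c / 2 * (expR (k * x) * domega x) - c / 2 * (expR (k * a) * domega a).
    apply: (@der_compare _ (fun x => expR (k * x) * E' x)
      (fun x => c / 2 * (expR (k * x) * domega x))
      (fun x => k * expR (k * x) * E' x + expR (k * x) * (- k * E' x - expR (2 * x) * S' x))
      (fun s => c / 2 * (2 * lam * (expR ((k + 2) * s) * ((k + 2) + 2 * lam * expR (2 * s)) * omega s)))
      a x ax) => z /andP[az _].
    - by apply: derM; [exact: der_expZ|exact: dE].
    - exact/derZ/domega_flux_der.
    have -> : expR ((k + 2) * z) = expR (k * z) * expR (2 * z) by rewrite mulrDl expRD.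
    have ek := expR_gt0 (k * z); have e2 := expR_gt0 (2 * z).
    have -> : k * expR (k * z) * E' z + expR (k * z) * (- k * E' z - expR (2 * z) * S' z) =
      expR (k * z) * expR (2 * z) * - S' z by ring.
    have -> : c / 2 * (2 * lam * (expR (k * z) * expR (2 * z) * (k + 2 + 2 * lam * expR (2 * z)) * omega z)) =
      expR (k * z) * expR (2 * z) * (c * L * omega z + 2 * (c * lam * lam * expR (2 * z) * omega z)).
      by rewrite {1}/lam; rewrite /lam; field; rewrite gt_eqF.
    rewrite ler_pM2l ?mulr_gt0//.
    have := hS _ (ltW az); rewrite ler_norml => /andP[h _].
    have : 0 <= c * lam * lam * expR (2 * z) * omega z.
      by rewrite mulr_ge0 ?expR_ge0// mulr_ge0 ?expR_ge0// mulr_ge0 ?(ltW lam0)// mulr_ge0 ?(ltW lam0).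
    lra.
  have : expR (k * a) * E' a <= expR (k * a) * (c / 2 * domega a).
    by rewrite ler_pM2l ?expR_gt0// (le_trans (ler_norm _)).
  move=> h1 h2; rewrite -(ler_pM2l (expR_gt0 (k * x))); lra.
have : D' s - D' a <= c / 2 * omega s - c / 2 * omega a.
  apply: (@der_compare _ D' (fun x => c / 2 * omega x) E' (fun x => c / 2 * domega x) a s as_) => x /andP[ax _].
  - exact: dD.
  - exact/derZ/omega_der.
  - exact/hE/ltW.
have : 0 <= c / 2 * omega a by rewrite mulr_ge0 ?divr_ge0// ltW// (lt_le_trans _ (omega_ge1 a)).
by rewrite Da; lra.
Qed.

(** Freezing the argument of [X] to the left of [a] makes the problem well posed on the whole line,
    with two-sided derivatives at [a], while only values to the right of [a] enter. *)
Definition picard_step X Y Z := [/\ Y a = alpha, Z a = beta &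
  forall s, is_derive s 1 Y (Z s) /\
    is_derive s 1 Z (- k * Z s - expR (2 * s) * phi (X (Num.max s a)))].

Let phi_continuous : continuous phi.
Proof.
move=> x; apply/cvgrPdist_le => e e0.
near=> y; apply: (le_trans (phi_lip _ _)); rewrite mulrC -ler_pdivlMr//.
near: y; apply: (@cvgr_dist_le _ _ _ _ _ id x) => //.
by rewrite divr_gt0.
Unshelve. all: by end_near. Qed.

Lemma max_continuous : continuous (fun s : R => Num.max s a).
Proof. by move=> s; apply: continuous_max; [exact: cvg_id|exact: cvg_cst]. Qed.

Lemma picard_step_exists X : continuous X -> exists Y Z, picard_step X Y Z.
Proof.
move=> cX.
have [W0 W0d] : exists H : R -> R, forall s,
    is_derive s 1 H (- (expR ((k + 2) * s) * phi (X (Num.max s a)))).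
  apply: antiderivative => s; apply: cvgN; apply: cvgM.
    exact: (der_continuous (der_expZ (k + 2) s)).
  apply: (@continuous_comp _ _ _ (fun s => X (Num.max s a)) phi).
    by apply: (@continuous_comp _ _ _ (fun s => Num.max s a) X); [exact: max_continuous|exact: cX].
  exact: phi_continuous.
pose W s := W0 s + (expR (k * a) * beta - W0 a).
have Wd s : is_derive s 1 W (- (expR ((k + 2) * s) * phi (X (Num.max s a)))).
  by have := derD (W0d s) (der_cst s (expR (k * a) * beta - W0 a)); rewrite addr0.
pose Z s := expR (- k * s) * W s.
have Zd s : is_derive s 1 Z (- k * Z s - expR (2 * s) * phi (X (Num.max s a))).
  refine (der_eq (derM (der_expZ (- k) s) (Wd s)) _).
  have -> : expR ((k + 2) * s) = expR (k * s) * expR (2 * s) by rewrite mulrDl expRD.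
  have : expR (- k * s) * expR (k * s) = 1 by rewrite -expRD -mulrDl addNr mul0r expR0.
  rewrite /Z; set p := expR (- k * s); set q := expR (k * s) => pq.
  have -> : p * - (q * expR (2 * s) * phi (X (Num.max s a))) =
    - (p * q * (expR (2 * s) * phi (X (Num.max s a)))) by ring.
  by rewrite pq; ring.
have [Y0 Y0d] := antiderivative (fun s => der_continuous (Zd s)).
exists (fun s => Y0 s + (alpha - Y0 a)), Z; split.
- by ring.
- rewrite /Z /W addrC subrK mulrA -expRD.
  by rewrite (_ : - k * a + k * a = 0) ?expR0 ?mul1r//; ring.
- by move=> s; split=> //; have := derD (Y0d s) (der_cst s (alpha - Y0 a)); rewrite addr0.
Qed.

Lemma picard_contraction X X' Y Z Y' Z' c : 0 <= c ->
  picard_step X Y Z -> picard_step X' Y' Z' ->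
  (forall s, a <= s -> `|X s - X' s| <= c * omega s) ->
  forall s, a <= s -> `|Y s - Y' s| <= c / 2 * omega s.
Proof.
move=> c0 [Ya Za d] [Ya' Za' d'] XX.
apply: (@weighted_bound (fun s => Y s - Y' s) (fun s => Z s - Z' s)
  (fun s => phi (X s) - phi (X' s)) c c0).
- by move=> s _; apply: derB; [have [] := d s|have [] := d' s].
- move=> s as_; have [_ h] := d s; have [_ h'] := d' s.
  move: h h'; rewrite max_l// => h h'.
  by apply: der_eq (derB h h') _; ring.
- move=> s as_; apply: (le_trans (phi_lip _ _)).
  by rewrite [c * L]mulrC -mulrA ler_pM2l// XX.
- by rewrite Ya Ya' subrr.
- by rewrite Za Za' subrr normr0 mulr_ge0 ?divr_ge0// ltW// domega_gt0.
Qed.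

Lemma picard_exists : exists Y Z, picard_step Y Y Z.
Proof.
have base : exists2 c, 0 <= c & forall Y Z, picard_step (fun=> alpha) Y Z ->
    forall s, a <= s -> `|Y s - alpha| <= c * omega s.
  have dw0 := domega_gt0 a.
  (* The first summand pays for the constant source [phi alpha], the second for the initial
     slope. *)
  pose c := `|phi alpha| / L + 2 * `|beta| / domega a.
  have c1 : 0 <= `|phi alpha| / L by apply: divr_ge0; [exact: normr_ge0|exact: ltW].
  have c2 : 0 <= 2 * `|beta| / domega a by apply: divr_ge0; [exact: mulr_ge0|exact: ltW].
  exists c; first by rewrite addr_ge0.
  move=> Y Z [Ya Za d] s as_.
  have : `|Y s - alpha| <= c / 2 * omega s.
    apply: (@weighted_bound (fun s => Y s - alpha) Z (fun=> phi alpha) c) as_.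
    - by rewrite addr_ge0.
    - move=> x _; have [h _] := d x.
      by have := derB h (der_cst x alpha); rewrite subr0.
    - by move=> x ax; have [_] := d x; apply.
    - move=> x _; apply: (@le_trans _ _ (c * L)); last first.
        by rewrite ler_peMr ?omega_ge1// mulr_ge0 ?addr_ge0// ltW.
      rewrite mulrDl divfK ?gt_eqF// lerDl.
      by apply: mulr_ge0; [|exact: ltW].
    - by rewrite Ya subrr.
    - rewrite Za; have -> : `|beta| = (2 * `|beta| / domega a) / 2 * domega a.
        by field; rewrite gt_eqF.
      by rewrite ler_pM2r// ler_pM2r// lerDr.
  move/le_trans; apply; rewrite ler_pM2r; last exact: lt_le_trans (omega_ge1 s).
  by rewrite /c; lra.
have [c c0 Hc] := base.
(* The iterates carry their continuity, which the next integration requires. *)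
have step0 (X : {X : R -> R | continuous X}) :
    {X' : {X : R -> R | continuous X} |
      exists Y Z, picard_step (sval X) Y Z /\ sval X' = fun s => Y (Num.max s a)}.
  apply: cid; have [Y [Z h]] := picard_step_exists (svalP X).
  have cY : continuous (fun s => Y (Num.max s a)).
    move=> s; apply: (@continuous_comp _ _ _ (fun s => Num.max s a) Y).
      exact: max_continuous.
    by have [_ _ d] := h; have [/der_continuous] := d (Num.max s a).
  by exists (exist (fun X : R -> R => continuous X) _ cY), Y, Z.
pose nxt x := sval (step0 x).
have cx0 : continuous ((fun=> alpha) : R -> R) by move=> s; exact: cst_continuous.
pose x0 : {X : R -> R | continuous X} := exist (fun X : R -> R => continuous X) (fun=> alpha) cx0.
pose xs n := iter n nxt x0.
pose X n := sval (xs n).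
have Xs n : exists Y Z, picard_step (X n) Y Z /\ X n.+1 = fun s => Y (Num.max s a).
  exact: svalP (step0 (xs n)).
have maxa s : a <= Num.max s a by rewrite le_max lexx orbT.
have X1 n s : `|X n.+1 s - X n s| <= c * 2^-1 ^+ n * omega (Num.max s a).
  elim: n s => [|n IH] s.
    have [Y [Z [h ->]]] := Xs 0%N; rewrite expr0 mulr1.
    exact: (Hc Y Z h).
  have [Y [Z [h e]]] := Xs n; have [Y' [Z' [h' e']]] := Xs n.+1.
  rewrite e' [X n.+1 s](congr1 (fun g => g s) e).
  rewrite (_ : c * _ = c * 2^-1 ^+ n / 2); last by rewrite exprSr mulrA.
  apply: (picard_contraction _ h' h) => //; first by rewrite mulr_ge0 ?exprn_ge0.
  by move=> x ax; have := IH x; rewrite max_l.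
have w0 s : 0 < omega (Num.max s a) by exact: expR_gt0.
have Xnj s n j : `|X (n + j)%N s - X n s| <=
    2 * c * omega (Num.max s a) * (2^-1 ^+ n - 2^-1 ^+ (n + j)).
  elim: j => [|j IH]; first by rewrite addn0 !subrr normr0 mulr0.
  rewrite addnS; have := X1 (n + j)%N s.
  have := ler_normD (X (n + j).+1 s - X (n + j)%N s) (X (n + j)%N s - X n s).
  rewrite [X in `|X|](_ : _ = X (n + j).+1 s - X n s); last by ring.
  move: IH; rewrite exprS; set p := 2^-1 ^+ (n + j); set q := 2^-1 ^+ n; set w := omega _.
  by move=> h1 h2 h3; lra.
have Xnm s n m : (n <= m)%N -> `|X m s - X n s| <= 2 * c * omega (Num.max s a) * 2^-1 ^+ n.
  move=> nm; rewrite -(subnKC nm); apply: (le_trans (Xnj s n _)).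
  by rewrite ler_wpM2l ?gerBl ?exprn_ge0// !mulr_ge0// ltW.
have ex s : exists l, forall n, `|X n s - l| <= 2 * c * omega (Num.max s a) * 2^-1 ^+ n.
  by apply: (@cauchy_rate R (fun n => X n s) (fun n => 2 * c * omega (Num.max s a) * 2^-1 ^+ n)) => n m; exact: Xnm.
pose Xl s := sval (cid (ex s)).
have Xlb s n : `|X n s - Xl s| <= 2 * c * omega (Num.max s a) * 2^-1 ^+ n.
  exact: (svalP (cid (ex s))).
have lucX : luc X Xl.
  move=> b e e0; have [n0 H] := geo_small (2 * c * omega (Num.max b a)) e0.
  exists n0 => n nn s sb; apply: (le_trans (Xlb s n)); apply: le_trans (H _ nn).
  apply: ler_wpM2r; first by rewrite exprn_ge0.
  apply: ler_wpM2l; first by rewrite mulr_ge0.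
  apply: omega_mono; rewrite ge_max !le_max lexx orbT andbT.
  by rewrite (le_trans (ler_norm s) sb).
have cXl : continuous Xl.
  apply: (luc_continuous lucX) => b; exists 0%N => n _ s _.
  exact: (svalP (xs n)).
(* One further step from the limit is differentiable by construction; the contraction shows that it
   agrees with the limit on the right of [a]. *)
have [Y [Z h]] := picard_step_exists cXl.
have YX s : a <= s -> Y s = Xl s.
  move=> as_; apply/eqP; rewrite -subr_eq0 -normr_le0; apply/ler_addgt0Pl => e e0; rewrite addr0.
  have [n0 H] := geo_small (2 * c * omega s) e0.
  apply: le_trans (H n0 (leqnn _)).
  have [Y' [Z' [h' e']]] := Xs n0.
  have c'0 : 0 <= 2 * c * 2^-1 ^+ n0 by rewrite !mulr_ge0 ?exprn_ge0.
  have : `|Y s - Y' s| <= 2 * c * 2^-1 ^+ n0 / 2 * omega s.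
    apply: (picard_contraction c'0 h h') => // x ax.
    by rewrite distrC mulrAC; have := Xlb x n0; rewrite max_l.
  have := Xlb s n0.+1; rewrite e' /= max_l// exprS.
  have := ler_normD (Y s - Y' s) (Y' s - Xl s).
  rewrite [X in `|X|](_ : _ = Y s - Xl s); last by ring.
  by lra.
have [Ya Za d] := h.
exists Y, Z; split => // s; have [d1 d2] := d s; split => //.
by rewrite YX.
Qed.

End picard.

Lemma luc_cauchy {R : realType} (u : nat -> R -> R) :
  (forall b e : R, 0 < e -> exists n0, forall n m, (n0 <= n)%N -> (n <= m)%N ->
     forall s, `|s| <= b -> `|u m s - u n s| <= e) ->
  exists U, luc u U.
Proof.
move=> H.
have cv s : cvg (u n s @[n --> \oo]).
  apply: cauchy_cvg; apply: cauchy_exP => e e0.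
  have e2 : 0 < e / 2 by rewrite divr_gt0.
  have [n0 Hn] := H `|s| _ e2.
  exists (u n0 s); exists n0 => // n /= nn.
  by rewrite /ball/= distrC (le_lt_trans (Hn _ _ _ nn _ _))//; lra.
exists (fun s => lim (u n s @[n --> \oo])) => b e e0.
have e2 : 0 < e / 2 by rewrite divr_gt0.
have [n0 Hn] := H b _ e2; exists n0 => n nn s sb.
have /cvgrPdist_le/(_ _ e2)[m0 _ Hm] := cv s.
pose m := maxn n m0.
have := Hm m (leq_maxr _ _); have := Hn n m nn (leq_maxl _ _) s sb.
rewrite /= !ler_norml => /andP[? ?] /andP[? ?]; apply/andP; split; lra.
Qed.

(** * Solutions started at the equilibrium and their limit *)

Section existence.
Context {R : realType}.
Implicit Types (s t a b u v e d : R) (U P : R -> R).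
Variables (k : R) (f f1 F Phi : R -> R).
Hypothesis NL : nonlinearity k f f1 F Phi.
Variables U0 C : R.
Hypothesis U00 : 0 < U0.
Hypothesis C0 : 0 < C.
Hypothesis tail : forall u, U0 <= u -> f1 u * F u <= 1 /\ f u * F u <= C.

Let k1 : 1 <= k := nl_k NL.
Let k0 : 0 < k. Proof. by have := k1; lra. Qed.

Local Notation rsol := (rsol k f).
Local Notation EE := (EE k F).
Local Notation near_sing := (near_sing k f f1 F U0).

Lemma min_dist u v b : `|Num.min u b - Num.min v b| <= `|u - v|.
Proof.
wlog uv : u v / u <= v => [H|].
  by case: (leP u v) => [/H//|/ltW/H]; rewrite distrC [`|v - u|]distrC.
have m : Num.min u b <= Num.min v b by rewrite le_min !ge_min uv lexx orbT.
rewrite distrC [`|u - v|]distrC !ger0_norm ?subr_ge0//.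
case: (leP v b) => vb; case: (leP u b) => ub; lra.
Qed.

(** Cutting [f] off above [alpha] makes it globally Lipschitz. With [beta <= 0] the solution is
    nonincreasing, so it never exceeds [alpha] and solves the original equation. *)
Lemma ivp_exists a alpha beta : 0 < alpha -> beta <= 0 ->
  exists U P, [/\ U a = alpha, P a = beta & forall s, a <= s -> rsol U P s].
Proof.
move=> alpha0 beta0.
pose phi u := ext0 f (Num.min u alpha).
have phi_lip u v : `|phi u - phi v| <= f1 alpha * `|u - v|.
  apply: (le_trans (ext0_lip NL alpha0 _ _)); [by rewrite ge_min lexx orbT..|].
  by rewrite ler_pM2l ?min_dist// (nl_f1 NL).
have [U [P [Ua Pa d]]] := @picard_exists R k (f1 alpha) a alpha beta phi k1 (nl_f1 NL alpha0) phi_lip.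
exists U, P; split => // s as_.
have Pneg t : a <= t -> P t <= 0.
  move=> at_.
  have : expR (k * t) * P t <= expR (k * a) * P a.
    rewrite -lerN2.
    apply: (@der_mono _ (fun s => - (expR (k * s) * P s)) (fun s => - (k * expR (k * s) * P s +
      expR (k * s) * (- k * P s - expR (2 * s) * phi (U (Num.max s a))))) a t at_) => x _.
      by have [_ h] := d x; exact: (derN (derM (der_expZ k x) h)).
    have : 0 <= expR (k * x) * (expR (2 * x) * phi (U (Num.max x a))).
      by rewrite !mulr_ge0 ?expR_ge0// (ext0_ge0 NL).
    lra.
  have : expR (k * a) * P a <= 0 by rewrite Pa pmulr_rle0// expR_gt0.
  by move=> h1 h2; have := le_trans h2 h1; rewrite pmulr_rle0// expR_gt0.
have Us : U s <= alpha.
  rewrite -Ua -lerN2; apply: (@der_mono _ (fun s => - U s) (fun s => - P s) a s as_) => x /andP[ax _].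
    by apply: derN; have [] := d x.
  by rewrite oppr_ge0 Pneg// ltW.
have [d1 d2] := d s; split => //; move: d2.
by rewrite max_l// /phi min_l.
Qed.

Lemma F_surj e : 0 < e -> e < F U0 -> exists2 u, U0 <= u & F u = e.
Proof.
move=> e0 eF; have [B B0 HB] := nl_F_lim NL e0.
pose B' := Num.max U0 B.
have UB : U0 <= B' by rewrite le_max lexx.
have BB : B <= B' by rewrite le_max lexx orbT.
have cF : {within `[U0, B'], continuous F}.
  apply: continuous_in_subspaceT => x; rewrite inE/= in_itv/= => /andP[x1 _].
  exact: (der_continuous (nl_F_der NL (lt_le_trans U00 x1))).
have := IVT UB cF (v := e); have := HB _ BB => FB.
rewrite ge_min le_max (ltW FB) (ltW eF) orbT => /(_ isT)[c].
by rewrite in_itv/= => /andP[c1 _] Fc; exists c.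
Qed.

Lemma near_sing_F U P s : near_sing U P s ->
  expR (2 * s) / (4 * k) <= F (U s) <= expR (2 * s) / k.
Proof.
move=> [[Us _ _ _] _ E1 _]; have Us0 := lt_le_trans U00 Us.
have F0 := nl_F NL Us0; have es := expR_gt0 (2 * s).
move: E1; rewrite ler_norml => /andP[E1 E2].
have h1 : 1 / 2 <= EE U s by lra.
have h2 : EE U s <= 2 by lra.
move: h1 h2; rewrite /EE ler_pdivlMr ?mulr_gt0// ler_pdivrMr ?mulr_gt0// => h1 h2.
rewrite ler_pdivrMr ?mulr_gt0// ler_pdivlMr//; apply/andP; split; lra.
Qed.

Lemma luc_rhs (u p : nat -> R -> R) (U P : R -> R) (start : nat -> R) : luc u U -> luc p P ->
  (forall b, exists n0, forall n, (n0 <= n)%N -> start n <= b) ->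
  (forall n s t, start n <= s -> s <= t -> u n t <= u n s) ->
  luc (fun n s => - k * p n s - expR (2 * s) * ext0 f (u n s))
      (fun s => - k * P s - expR (2 * s) * ext0 f (U s)).
Proof.
move=> uU pP hs mono b e e0.
(* By monotonicity [u n] is largest at [- |b|], where it is within 1 of [U]; [U s] costs one more
   unit. Below [M] the nonlinearity has Lipschitz constant [f1 M]. *)
pose M := `|U (- `|b|)| + 2.
have M0 : 0 < M by rewrite /M; have := normr_ge0 (U (- `|b|)); lra.
have f1M := nl_f1 NL M0.
pose D := k + expR (2 * b) * f1 M + 1.
have ef : 0 < expR (2 * b) * f1 M by rewrite mulr_gt0// expR_gt0.
have D0 : 0 < D by rewrite /D; have := k0; lra.
pose e1 := Num.min 1 (e / D).
have e10 : 0 < e1 by rewrite lt_min ltr01 divr_gt0.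
have e1D : e1 * D <= e by rewrite -ler_pdivlMr// ge_min lexx orbT.
have e11 : e1 <= 1 by rewrite ge_min lexx.
have [n0 H0] := uU `|b| _ e10; have [n1 H1] := pP `|b| _ e10; have [n2 H2] := hs (- `|b|).
exists (maxn n0 (maxn n1 n2)) => n; rewrite !geq_max => /and3P[nn0 nn1 nn2] s sb.
have sb' : `|s| <= `|b| by apply: (le_trans sb); exact: ler_norm.
have h0 := H0 _ nn0 _ sb'; have h1 := H1 _ nn1 _ sb'.
have bb : `|- `|b| | <= `|b| by rewrite normrN normr_id.
have hb := H0 _ nn0 _ bb.
have us : u n s <= M.
  have : u n s <= u n (- `|b|).
    by apply: mono; [exact: H2|rewrite lerNl; apply: le_trans sb'; rewrite -normrN ler_norm].
  move: hb; rewrite ler_norml => /andP[_ hb]; have := ler_norm (U (- `|b|)).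
  by rewrite /M; lra.
have Us : U s <= M.
  have : u n s <= u n (- `|b|).
    by apply: mono; [exact: H2|rewrite lerNl; apply: le_trans sb'; rewrite -normrN ler_norm].
  move: hb h0; rewrite !ler_norml => /andP[_ hb] /andP[h0 _]; have := ler_norm (U (- `|b|)).
  by rewrite /M; lra.
have hf := ext0_lip NL M0 us Us.
have es : expR (2 * s) <= expR (2 * b).
  by rewrite ler_expR ler_pM2l// (le_trans (ler_norm s)).
rewrite (_ : _ - _ = - k * (p n s - P s) - expR (2 * s) * (ext0 f (u n s) - ext0 f (U s))); last by ring.
apply: (le_trans (ler_normB _ _)); rewrite !normrM normrN (gtr0_norm k0) (gtr0_norm (expR_gt0 _)).
have hk : k * `|p n s - P s| <= k * e1 by rewrite ler_pM2l.
have hef : expR (2 * s) * `|ext0 f (u n s) - ext0 f (U s)| <= expR (2 * b) * (f1 M * e1).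
  apply: ler_pM; rewrite ?expR_ge0//; apply: (le_trans hf).
  by rewrite ler_pM2l.
by move: e1D; rewrite /D; lra.
Qed.

Theorem sing_exists : exists U P, (forall s, rsol U P s) /\
  (forall M : R, exists s0, forall s, s <= s0 -> M <= U s).
Proof.
have d0 : 0 < 1 / 32 :> R by lra.
have [s1 Hs1] := ivp_trap NL U00 tail d0.
have two0 : 0 < 2 :> R by [].
have FU0 := nl_F NL U00.
have [a' Ha'] := expR_small two0 (mulr_gt0 k0 FU0).
(* The shift puts every start [st n] to the left of both [s1], where trapping holds, and [a'], where
   [F_surj] supplies the equilibrium value. *)
pose N0 := Num.bound (`|s1| + `|a'|).
pose st (n : nat) : R := - (n + N0)%:R.
have N0b : `|s1| + `|a'| < N0%:R by apply: archi_boundP; rewrite addr_ge0.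
have st0 n : st n <= - N0%:R by rewrite lerN2 ler_nat leq_addl.
have sts1 n : st n <= s1.
  have := st0 n; have := N0b; have := normr_ge0 a'; have := ler_norm (- s1); rewrite normrN; lra.
have sta n : st n <= a'.
  have := st0 n; have := N0b; have := normr_ge0 s1; have := ler_norm (- a'); rewrite normrN; lra.
have stmono n m : (n <= m)%N -> st m <= st n.
  by move=> nm; rewrite lerN2 ler_nat leq_add2r.
have stoo b : exists n0, forall n, (n0 <= n)%N -> st n <= b.
  exists (Num.bound `|b|) => n nn.
  have : `|b| < (Num.bound `|b|)%:R by apply: archi_boundP.
  have : (Num.bound `|b|)%:R <= (n + N0)%:R :> R by rewrite ler_nat (leq_trans nn)// leq_addr.
  by have := ler_norm (- b); rewrite normrN /st; lra.
have ex n : exists UP : (R -> R) * (R -> R), [/\ 0 < UP.1 (st n),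
    F (UP.1 (st n)) = expR (2 * st n) / (2 * k),
    UP.2 (st n) = - (2 * (f (UP.1 (st n)) * F (UP.1 (st n)))) &
    forall s, st n <= s -> rsol UP.1 UP.2 s].
  have [||A UA FA] := @F_surj (expR (2 * st n) / (2 * k)).
  - by rewrite divr_gt0 ?expR_gt0// mulr_gt0.
  - by rewrite ltr_pdivrMr ?mulr_gt0//; have := Ha' _ (sta n); have := mulr_gt0 k0 FU0; lra.
  have A0 := lt_le_trans U00 UA.
  have fA := nl_pos NL A0; have FA0 := nl_F NL A0.
  have [|U [P [Ua Pa d]]] := @ivp_exists (st n) A (- (2 * (f A * F A))) A0.
    by rewrite oppr_le0 !mulr_ge0// ltW.
  by exists (U, P); rewrite /= Ua Pa.
have [UP HUP] := choice ex.
pose u n := (UP n).1; pose p n := (UP n).2.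
have rs n s : st n <= s -> rsol (u n) (p n) s by have [_ _ _] := HUP n; apply.
have ns n s : st n <= s -> s <= s1 -> near_sing (u n) (p n) s.
  by have [h1 h2 h3 h4] := HUP n; exact: Hs1.
have pn n s : st n <= s -> p n s <= 0.
  move=> h; apply: (rad_slope_le0 NL h); first by move=> x /andP[x1 _]; exact: rs.
  by have [[_ ? _ _] _ _ _] := ns n _ (lexx _) (sts1 n).
have mono n s t : st n <= s -> s <= t -> u n t <= u n s.
  move=> h1 h2; apply: (rad_nonincr h2) => x /andP[x1 _]; first by apply: rs; exact: le_trans x1.
  by apply: pn; exact: le_trans x1.
pose K0 := (k + 1) * ((2 * C) ^+ 2 + (3 * C) ^+ 2).
have K00 : 0 <= K0.
  by apply: mulr_ge0; [have := k0; lra|rewrite addr_ge0 ?sqr_ge0].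
(* The comparison begins at [st n], the later of the two starts: both solutions are then near the
   equilibrium and [qdiff] is at most [K0]. *)
have Qs n m s : (n <= m)%N -> st n <= s -> s <= s1 ->
    qdiff k (u m) (p m) (u n) (p n) s <= expR (- (1 / 16) * (s - st n)) * K0.
  move=> nm h1 h2.
  have b1 := stmono _ _ nm.
  apply: (le_trans (@qdiff_decay _ _ _ _ _ _ NL _ _ U00 tail (u m) (p m) (u n) (p n) (st n) s h1 _ _)).
  - by move=> x /andP[x1 _]; split; apply: rs => //; exact: le_trans x1.
  - move=> x /andP[x1 x2]; have xs1 := le_trans x2 h2.
    by split; apply: ns => //; exact: le_trans x1.
  rewrite ler_pM2l ?expR_gt0//; apply: (qdiff_bound NL U00 C0 tail).
    by apply: ns => //; exact: (sts1 n).
  by apply: ns => //; exact: (sts1 n).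
have es1 : 0 < expR (2 * s1) / (4 * k) by rewrite divr_gt0 ?expR_gt0// mulr_gt0.
(* Trapping at [s1] bounds [F (u n s1)] from below uniformly in [n], hence [u n] from above on the
   right of [s1]. *)
have [B B0 HB] := nl_F_lim NL es1.
have uB n s : s1 <= s -> u n s <= B.
  move=> h; apply: (le_trans (mono n s1 s (sts1 n) h)).
  rewrite leNgt; apply/negP => /ltW/HB.
  by have /andP[h1 _] := near_sing_F (ns n s1 (sts1 n) (lexx _)); rewrite ltNge h1.
have f1B := nl_f1 NL B0.
(* Up to [s1] the decay estimate applies; beyond it [G] bounds the growth over a length of at most
   [b + |s1|]. The factor [expR (1 / 16 * st n)] survives in both cases and makes the sequence
   Cauchy. *)
have Q b : 0 <= b -> exists2 K, 0 <= K & forall n m s, (n <= m)%N -> st n <= - b -> `|s| <= b ->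
    qdiff k (u m) (p m) (u n) (p n) s <= K * expR (1 / 16 * st n).
  move=> b0; pose G := expR ((12 * k + 6 * (2 * k + expR (2 * b) * f1 B) + 6) * (b + `|s1|)).
  have eb : 0 < expR (2 * b) * f1 B by rewrite mulr_gt0// expR_gt0.
  have A0 : 0 < 12 * k + 6 * (2 * k + expR (2 * b) * f1 B) + 6 by have := k0; lra.
  have bs : 0 <= b + `|s1| by rewrite addr_ge0.
  have G1 : 1 <= G.
    apply: le_trans (expR_ge1Dx _); rewrite lerDl.
    by apply: mulr_ge0; [exact: ltW|].
  have [E1 E10 E1E] : exists2 E1, 0 <= E1 & E1 = expR (1 / 16 * (b + `|s1|)) * K0.
    by eexists; last reflexivity; apply: mulr_ge0; [exact: expR_ge0|exact: K00].
  exists (G * E1); first by apply: mulr_ge0; [exact: expR_ge0|].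
  move=> n m s nm stb sb.
  have /andP[sb1 sb2] : - b <= s <= b by rewrite -ler_norml.
  have ss : st n <= s by exact: le_trans sb1.
  have key x : st n <= x -> x <= s1 -> - (b + `|s1|) <= x ->
      qdiff k (u m) (p m) (u n) (p n) x <= E1 * expR (1 / 16 * st n).
    move=> h1 h2 h3; rewrite E1E; apply: (le_trans (Qs n m x nm h1 h2)).
    rewrite mulrAC -expRD ler_wpM2r// ler_expR; lra.
  have Ge0 : 0 <= E1 * expR (1 / 16 * st n).
    by apply: mulr_ge0; [|exact: expR_ge0].
  have -> : G * E1 * expR (1 / 16 * st n) = G * (E1 * expR (1 / 16 * st n)) by rewrite mulrA.
  case: (leP s s1) => h.
    apply: (@le_trans _ _ (E1 * expR (1 / 16 * st n))).
      by apply: key => //; have := normr_ge0 s1; lra.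
    by rewrite ler_peMl.
  have b1 := stmono _ _ nm.
  have := @qdiff_growth _ _ _ _ _ _ NL (u m) (p m) (u n) (p n) s1 s B (ltW h) B0.
  move=> /(_ _ _)/le_trans; apply.
  - by move=> x /andP[x1 _]; split; apply: rs; apply: le_trans x1.
  - by move=> x /andP[x1 _]; split; exact: uB.
  have q0 : qdiff k (u m) (p m) (u n) (p n) s1 <=
      E1 * expR (1 / 16 * st n).
    by apply: key => //; have := ler_norm (- s1); rewrite normrN; lra.
  apply: (@le_trans _ _ (expR ((12 * k + 6 * (2 * k + expR (2 * s) * f1 B) + 6) * (s - s1)) *
    (E1 * expR (1 / 16 * st n)))).
    by rewrite ler_pM2l ?expR_gt0.
  apply: ler_wpM2r => //; rewrite /G ler_expR.
  have e2 : expR (2 * s) * f1 B <= expR (2 * b) * f1 B by rewrite ler_pM2r// ler_expR ler_pM2l.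
  have e3 : 0 < expR (2 * s) * f1 B by rewrite mulr_gt0// expR_gt0.
  apply: ler_pM.
  - by have := k0; lra.
  - by rewrite subr_ge0 ltW.
  - by lra.
  - by have := ler_norm (- s1); rewrite normrN; lra.
have cau b e : 0 < e -> exists n0, forall n m, (n0 <= n)%N -> (n <= m)%N ->
     forall s, `|s| <= b -> `|u m s - u n s| <= e /\ `|p m s - p n s| <= e.
  move=> e0; have [K KK HK] := Q `|b| (normr_ge0 b).
  have c16 : 0 < 1 / 16 :> R by lra.
  have ee : 0 < e ^+ 2 / (4 * (K + 1)) by rewrite divr_gt0 ?exprn_gt0// mulr_gt0//; lra.
  have [a1 Ha1] := expR_small c16 ee.
  have [n0 Hn0] := stoo (Num.min a1 (- `|b|)).
  exists n0 => n m nn nm s sb.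
  have := Hn0 _ nn; rewrite le_min => /andP[sta1 stb].
  have sb' : `|s| <= `|b| by apply: (le_trans sb); exact: ler_norm.
  have := HK n m s nm stb sb'; have := Ha1 _ sta1.
  rewrite ler_pdivlMr; last by rewrite mulr_gt0//; lra.
  set q := expR _ => hq; have q0 : 0 < q by exact: expR_gt0.
  have := qform_ge (u m s - u n s) (p m s - p n s) k1; rewrite /qdiff => h1 h2.
  have hh : (u m s - u n s) ^+ 2 + (p m s - p n s) ^+ 2 <= e ^+ 2 by nra.
  have := sqr_ge0 (u m s - u n s); have := sqr_ge0 (p m s - p n s) => g1 g2.
  have ae : 0 <= e by exact: ltW.
  by split; rewrite -(@ler_pXn2r _ 2%N) ?nnegrE// real_normK ?num_real//; lra.
have [U uU] : exists U, luc u U.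
  apply: luc_cauchy => b e e0; have [n0 H] := cau b _ e0; exists n0 => n m nn nm s sb.
  by have [] := H n m nn nm s sb.
have [P pP] : exists P, luc p P.
  apply: luc_cauchy => b e e0; have [n0 H] := cau b _ e0; exists n0 => n m nn nm s sb.
  by have [] := H n m nn nm s sb.
have ev b : exists n0, forall n, (n0 <= n)%N -> forall s, `|s| <= b -> rsol (u n) (p n) s.
  have [n0 H] := stoo (- b); exists n0 => n nn s; rewrite ler_norml => /andP[h _].
  by apply: rs; apply: le_trans h; exact: H.
have cU : continuous U.
  apply: (luc_continuous uU) => b; have [n0 H] := ev b; exists n0 => n nn s sb.
  by have [/der_continuous] := H n nn s sb.
have cP : continuous P.
  apply: (luc_continuous pP) => b; have [n0 H] := ev b; exists n0 => n nn s sb.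
  by have [_ /der_continuous] := H n nn s sb.
exists U, P; split.
  move=> s; split.
    apply: (luc_derive uU pP cP) => b; have [n0 H] := ev b; exists n0 => n nn x xb.
    by have [] := H n nn x xb.
  apply: (luc_derive pP (luc_rhs uU pP stoo mono)) => [x|b].
    have cf : {for x, continuous (fun s => ext0 f (U s))}.
      by apply: continuous_comp; [exact: cU|exact: (nl_cont NL)].
    have ce := der_continuous (der_expZ 2 x).
    apply: (@continuousB _ _ _ (fun s => - k * P s) (fun s => expR (2 * s) * ext0 f (U s))).
      by apply: (@continuousM _ _ (fun=> - k) P); [exact: cst_continuous|exact: cP].
    exact: (@continuousM _ _ (fun s => expR (2 * s)) (fun s => ext0 f (U s))).
  have [n0 H] := ev b; exists n0 => n nn x xb.
  by have [] := H n nn x xb.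
(* Blow-up passes to the limit because [F (u n s) <= expR (2 s) / k] uniformly in [n]; one unit of
   [M'] is lost in replacing [u n] by [U]. *)
move=> M; pose M' := `|M| + 2.
have M'0 : 0 < M' by rewrite /M'; have := normr_ge0 M; lra.
have kF : 0 < k * F M' / 2 by rewrite divr_gt0// mulr_gt0// (nl_F NL).
have [s0 Hs0] := expR_small two0 kF.
exists (Num.min s0 s1) => s; rewrite le_min => /andP[ss0 ss1].
have [n0 H] := uU `|s| _ ltr01.
have [n2 H2] := stoo s.
pose n := maxn n0 n2.
have := H n (leq_maxl _ _) s (lexx _); rewrite ler_norml => /andP[_ h].
have sn : st n <= s by apply: H2; exact: leq_maxr.
have nsn := ns n s sn ss1.
have /andP[_ Fu] := near_sing_F nsn.
have : M' < u n s.
  rewrite ltNge; apply/negP => uM.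
  have [[Us _ _ _] _ _ _] := nsn.
  have := F_nonincr NL (lt_le_trans U00 Us) uM.
  move: Fu; rewrite ler_pdivlMr// => Fu h1; have := Hs0 _ ss0.
  have : F M' * k <= F (u n s) * k by rewrite ler_pM2r.
  lra.
have := ler_norm M; rewrite /M'; lra.
Qed.

End existence.

(** * Positivity and growth *)

Section positivity.
Context {R : realType}.
Implicit Types (s t a b u v e d : R).
Variables (k : R) (f f1 F Phi : R -> R).
Hypothesis NL : nonlinearity k f f1 F Phi.

Let k1 : 1 <= k := nl_k NL.
Let k0 : 0 < k. Proof. by have := k1; lra. Qed.

Local Notation rsol := (rsol k f).

Lemma Phi_ge0 u : 0 <= u -> 0 <= Phi u.
Proof.
move=> u0; rewrite -(nl_Phi0 NL); apply: (@der_mono _ Phi (ext0 f) 0 u u0) => x _.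
  exact: (nl_Phi_der NL).
exact: (ext0_ge0 NL).
Qed.

Variables U P : R -> R.
Hypothesis radU : forall s, rsol U P s.
Hypothesis Uoo : forall M : R, exists s0, forall s, s <= s0 -> M <= U s.

Let nonincr a t : a <= t -> U t <= U a := @sing_nonincr _ _ _ _ _ _ NL _ _ radU Uoo a t.
Let slope t : P t <= 0 := @sing_slope _ _ _ _ _ _ NL _ _ radU Uoo t.

(** The slope is at least [- 3 C], so [U] grows at most linearly in [- s], that is logarithmically
    in the radius; the source term equals [2 k E (f F)]. The constant [B] adds the two bounds. *)
Lemma sing_growth : exists t0 A B, [/\ 0 <= A, 0 <= B &
  forall s, s <= t0 -> [/\ 0 < U s, U s <= A + B * (t0 - s), - B <= P s &
    expR (2 * s) * f (U s) <= B]].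
Proof.
have [U0 [C [U00 C0 tail]]] := nl_tail NL.
have [t0 Ht0] := sing_near NL U00 tail radU Uoo.
exists t0, `|U t0|, (3 * C + 4 * k * C).
have kC : 0 < k * C by rewrite mulr_gt0.
split; [exact: normr_ge0|lra|].
move=> s st; have ns := Ht0 _ st.
have /andP[P3 _] := near_sing_P NL U00 tail ns.
have [[Us _ E3 _] th E1 _] := ns.
have Us0 := lt_le_trans U00 Us.
split => //.
- have : U s - U t0 <= 3 * C * (t0 - s).
    rewrite (_ : U s - U t0 = - U t0 - - U s); last by ring.
    rewrite mulrBr; apply: (@der_compare _ (fun x => - U x) (fun x => 3 * C * x)
      (fun x => - P x) (fun=> 3 * C) s t0 st) => x /andP[x1 x2].
    + by apply: derN; have [] := radU x.
    + by have := derZ (3 * C) (der_id x); rewrite mulr1.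
    + by have /andP[h _] := near_sing_P NL U00 tail (Ht0 _ (ltW x2)); lra.
  have : 0 <= 4 * k * C * (t0 - s).
    by apply: mulr_ge0; [lra|rewrite subr_ge0].
  have := ler_norm (U t0); lra.
- lra.
have [_ fF] := tail _ Us; have F0 := nl_F NL Us0; have fu := nl_pos NL Us0.
have -> : expR (2 * s) * f (U s) = 2 * k * EE k F U s * (f (U s) * F (U s)).
  by rewrite /EE; field; rewrite !gt_eqF.
have E0 := EE_gt0 NL Us0.
move: E1; rewrite ler_norml => /andP[_ E1].
have fF0 : 0 < f (U s) * F (U s) by rewrite mulr_gt0.
have h1 : 2 * k * EE k F U s <= 4 * k by have := k0; nra.
have h2 : 0 <= 2 * k * EE k F U s by rewrite mulr_ge0 ?(ltW E0)// mulr_ge0// ltW.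
have : 2 * k * EE k F U s * (f (U s) * F (U s)) <= 4 * k * C.
  by apply: ler_pM => //; exact: ltW.
lra.
Qed.

(** In the radius this is [r^N (u_r^2 / 2 + Phi(u)) + (N - 2) / 2 r^{N-1} u u_r]. *)
Definition pohozaev s := expR (k * s) *
  (P s ^+ 2 * 2^-1 + k / 2 * (U s * P s) + expR (2 * s) * Phi (U s)).

Lemma pohozaev_der s : is_derive s 1 pohozaev
  (expR ((k + 2) * s) * ((k + 2) * Phi (U s) - k / 2 * (U s * ext0 f (U s)))).
Proof.
have [dU dP] := radU s.
have dPhi := der_comp (nl_Phi_der NL (U s)) dU.
have d1 := derM (derX2 dP) (der_cst s (2^-1 : R)).
have d2 := derZ (k / 2) (derM dU dP).
have d3 := derM (der_expZ 2 s) dPhi.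
refine (der_eq (derM (der_expZ k s) (derD (derD d1 d2) d3)) _).
have -> : expR ((k + 2) * s) = expR (k * s) * expR (2 * s) by rewrite mulrDl expRD.
by field.
Qed.

Lemma pohozaev_mono a t : a <= t -> 0 <= U t -> pohozaev t <= pohozaev a.
Proof.
move=> at_ Ut; rewrite -lerN2.
apply: (@der_mono _ (fun s => - pohozaev s) (fun s => - (expR ((k + 2) * s) *
  ((k + 2) * Phi (U s) - k / 2 * (U s * ext0 f (U s))))) a t at_) => s /andP[s1 s2].
  by apply: derN; exact: pohozaev_der.
have Us : 0 <= U s by apply: le_trans Ut _; apply: nonincr; exact: ltW.
rewrite -mulrN mulr_ge0 ?expR_ge0// ext0_nneg//.
have := nl_Phi NL Us; lra.
Qed.

(** At a first zero [pohozaev] reduces to a positive multiple of [P^2]. It is nonincreasing up to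
    there and its boundary term at -oo is at most 0, so [P] would vanish; but the flux is strictly
    negative at [t0] and does not increase afterwards. *)
Theorem sing_pos t : 0 < U t.
Proof.
rewrite ltNge; apply/negP => Ut.
have [t0 [A [B [A0 B0 H]]]] := sing_growth.
have t0t : t0 <= t.
  rewrite leNgt; apply/negP => /ltW tt0.
  by have [] := H _ tt0; rewrite ltNge Ut.
have [Ut0 _ _ _] := H _ (lexx t0).
have [x _|//||s1 [t0s1 s1t Us1 Hs1]] := @first_time _ U t0 t.
- by have [/der_continuous] := radU x.
- by exists t; rewrite ?t0t ?lexx.
have ps1 : pohozaev s1 <= 0.
  have kk : 0 < k - 1 / 2 by have := k1; lra.
  (* Half a power of [expR a] absorbs the linear growth of [U a] in [x = t0 - a], through
     [q * x <= 2] below; the remaining exponent [k - 1 / 2] is still positive. *)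
  pose M := expR (t0 / 2) * (B * B + 2 * (A + 2 * B) * B).
  apply: (@le_exp_small _ _ _ M (k - 1 / 2) t0 kk) => a at0.
  have as1 : a <= s1 by exact: le_trans (ltW t0s1).
  have Us10 : 0 <= U s1 by rewrite Us1.
  apply: (le_trans (pohozaev_mono as1 Us10)).
  have [Ua Ub Pa fa] := H _ at0.
  have P0 := slope a.
  pose x := t0 - a; have x0 : 0 <= x by rewrite subr_ge0.
  have PP : P a ^+ 2 <= B * B by rewrite expr2; nra.
  have UP : U a * P a <= 0 by rewrite pmulr_rle0.
  have kUP : k / 2 * (U a * P a) <= 0.
    by apply: mulr_ge0_le0 => //; rewrite divr_ge0// ltW.
  have Ph : Phi (U a) <= U a * f (U a).
    have := nl_Phi NL (ltW Ua); have := Phi_ge0 (ltW Ua) => h1 h2.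
    have uf : 0 < U a * f (U a) by rewrite mulr_gt0// (nl_pos NL).
    have : k * (2 * Phi (U a)) <= k * (U a * f (U a)).
      by apply: le_trans h2; lra.
    by rewrite ler_pM2l//; lra.
  have ePh : expR (2 * a) * Phi (U a) <= U a * B.
    apply: (@le_trans _ _ (U a * (expR (2 * a) * f (U a)))).
      by rewrite mulrCA ler_pM2l// expR_gt0.
    by rewrite ler_pM2l.
  have UB : U a * B <= (A + B * x) * B by rewrite ler_wpM2r.
  rewrite add0r /pohozaev; set z := (X in expR (k * a) * X).
  have -> : expR (k * a) = expR (t0 / 2) * expR (- (x / 2)) * expR ((k - 1 / 2) * a).
    by rewrite -!expRD; congr expR; rewrite /x; field.
  set q := expR (- (x / 2)).
  have q0 : 0 < q by exact: expR_gt0.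
  have q1 : q <= 1 by rewrite /q -[leRHS]expR0 ler_expR oppr_le0 divr_ge0.
  have qx : q * x <= 2.
    have := expR_ge1Dx (x / 2); rewrite -(ler_pM2l q0).
    have -> : q * expR (x / 2) = 1 by rewrite /q -expRD addNr expR0.
    lra.
  set e1 := expR (t0 / 2); have -> : e1 * q * expR ((k - 1 / 2) * a) * z =
    e1 * (q * z) * expR ((k - 1 / 2) * a) by ring.
  rewrite ler_pM2r ?expR_gt0// /M ler_pM2l ?expR_gt0//.
  have zb : z <= B * B + (A + B * x) * B by rewrite /z; nra.
  have : q * z <= q * (B * B + (A + B * x) * B) by rewrite ler_pM2l.
  have BB : 0 <= B * B by rewrite mulr_ge0.
  have AB : 0 <= A * B by rewrite mulr_ge0.
  have : q * (B * B) <= B * B by rewrite ler_piMl.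
  have : q * (A * B) <= A * B by rewrite ler_piMl.
  have : (q * x) * (B * B) <= 2 * (B * B) by rewrite ler_wpM2r.
  lra.
have : P s1 ^+ 2 <= 0.
  move: ps1; rewrite /pohozaev Us1 (nl_Phi0 NL) mul0r !mulr0 !addr0 pmulr_rle0 ?expR_gt0//.
  by lra.
have : P s1 < 0.
  have := rad_flux_mono NL (ltW t0s1) (fun s _ => radU s).
  have := @sing_drift _ _ _ _ _ _ NL _ _ radU Uoo t0.
  rewrite /drift (ext0_nneg _ (ltW Ut0)) => h.
  have fu := nl_pos NL Ut0.
  have : 0 < expR (2 * t0) * f (U t0) by rewrite mulr_gt0 ?expR_gt0.
  move=> h1; have Pt0 : P t0 < 0 by have := k0; nra.
  have : expR (k * t0) * P t0 < 0 by rewrite pmulr_rlt0 ?expR_gt0.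
  by move=> h2 h3; have := le_lt_trans h3 h2; rewrite pmulr_rlt0// expR_gt0.
by move=> h; rewrite leNgt exprn_even_gt0//= lt_eqF.
Qed.

(** [En] is the energy [u_r^2 / 2 + Phi(u)], which decreases along the radius. It bounds [u_r] away
    from the origin, so the truncations of the solution are Lipschitz. *)
Lemma sing_lipschitz a : exists2 K, 0 <= K & forall s, a <= s -> - (K * expR s) <= P s.
Proof.
pose En s := expR (- 2 * s) * (P s ^+ 2 * 2^-1) + Phi (U s).
have En_mono s : a <= s -> En s <= En a.
  move=> as_; rewrite -lerN2.
  apply: (@der_mono _ (fun s => - En s) (fun s => (1 + k) * (expR (- 2 * s) * P s ^+ 2)) a s as_) => x _.
    have [dU dP] := radU x.
    have d1 := derM (der_expZ (- 2) x) (derM (derX2 dP) (der_cst x (2^-1 : R))).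
    refine (der_eq (derN (derD d1 (der_comp (nl_Phi_der NL (U x)) dU))) _).
    have : expR (- 2 * x) * expR (2 * x) = 1 by rewrite -expRD -mulrDl addNr mul0r expR0.
    set p := expR (- 2 * x); set q := expR (2 * x) => pq.
    have -> : p * ((2 * P x * (- k * P x - q * ext0 f (U x))) * 2^-1 + P x ^+ 2 * 0) =
      - k * p * P x ^+ 2 - (p * q) * (P x * ext0 f (U x)) by field.
    by rewrite pq; field.
  rewrite mulr_ge0//; first by have := k0; lra.
  by rewrite mulr_ge0 ?expR_ge0// sqr_ge0.
have E0 : 0 <= En a.
  apply: addr_ge0; last by apply: Phi_ge0; exact/ltW/sing_pos.
  by rewrite mulr_ge0 ?expR_ge0// mulr_ge0 ?sqr_ge0.
(* The square of [2 * En a + 1] exceeds [2 * En a], which spares a square root. *)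
exists (2 * En a + 1); first lra.
move=> s as_; have := En_mono _ as_; rewrite {1}/En.
have Ph := Phi_ge0 (ltW (sing_pos s)) => h.
have e1 : expR (- 2 * s) = (expR s ^+ 2)^-1.
  by rewrite expr2 -expRD -expRN; congr expR; ring.
have es := expR_gt0 s.
have : P s ^+ 2 <= 2 * En a * expR s ^+ 2.
  have : (expR s ^+ 2)^-1 * (P s ^+ 2 * 2^-1) <= En a by rewrite -e1; lra.
  by rewrite ler_pdivrMl ?exprn_gt0//; lra.
move=> hP; rewrite lerNl -ler_sqr ?nnegrE.
- rewrite sqrrN; apply: (le_trans hP); rewrite exprMn.
  apply: ler_wpM2r; first by rewrite exprn_ge0// ltW.
  by rewrite expr2; nra.
- by rewrite oppr_ge0.
- by rewrite mulr_ge0 ?ltW//; lra.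
Qed.

End positivity.

(** * Radial functions on R^N *)

Section lines.
Context {R : realType} {V : normedModType R}.
Implicit Types (u : V -> R) (x v : V).

Let line_quotient u x v : (fun h : R => h^-1 *: ((u \o shift x) (h *: v) - u x)) =
  (fun h : R => h^-1 *: (((fun h : R => u (h *: v + x)) \o shift 0) (h *: 1) -
     (fun h : R => u (h *: v + x)) 0)).
Proof. by apply/funext => h /=; rewrite addr0 scale0r add0r [_%:A]mulr1. Qed.

Lemma is_derive_line u x v d :
  is_derive (0 : R) 1 (fun h : R => u (h *: v + x)) d <-> is_derive x v u d.
Proof.
by split=> -[]; rewrite /derivable /derive ?(line_quotient u x v) => h1 h2; split;
  rewrite /derivable /derive ?(line_quotient u x v).
Qed.

Lemma is_derive_ray u v (r : R) d : is_derive (r *: v) v u d ->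
  is_derive r 1 (fun t : R => u (t *: v)) d.
Proof.
have e : (fun h : R => h^-1 *: (((fun t : R => u (t *: v)) \o shift r) (h *: 1) - u (r *: v))) =
  (fun h : R => h^-1 *: ((u \o shift (r *: v)) (h *: v) - u (r *: v))).
  by apply/funext => h /=; rewrite [_%:A]mulr1 scalerDl.
by move=> [h1 h2]; split; rewrite ?/derivable ?/derive e.
Qed.

End lines.

Section euclid.
Context {R : realType} {n : nat}.
Implicit Types (x y : 'rV[R]_n) (i j : 'I_n).

Definition sqnorm x : R := \sum_(i < n) x ord0 i ^+ 2.

(** Half the logarithm of the squared norm is differentiated without passing through the square
    root. At the origin its value is the default 0. *)
Definition lnorm x : R := 2^-1 * ln (sqnorm x).

Lemma sqnorm_ge0 x : 0 <= sqnorm x.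
Proof. by apply: sumr_ge0 => i _; exact: sqr_ge0. Qed.

Lemma coord_sq_le x i : x ord0 i ^+ 2 <= sqnorm x.
Proof.
rewrite /sqnorm (bigD1 i)//= lerDl; apply: sumr_ge0 => j _; exact: sqr_ge0.
Qed.

Lemma sqnorm_gt0 x : (0 < sqnorm x) = (x != 0).
Proof.
rewrite lt_neqAle sqnorm_ge0 andbT eq_sym; congr negb.
apply/eqP/eqP => [h|->]; last by rewrite /sqnorm big1// => i _; rewrite mxE expr0n.
apply/rowP => i; rewrite mxE; apply/eqP; rewrite -sqrf_eq0 eq_le sqr_ge0 andbT.
by rewrite -h coord_sq_le.
Qed.

Lemma enormE x : enorm x = Num.sqrt (sqnorm x).
Proof. by []. Qed.

Lemma enorm_sqr x : enorm x ^+ 2 = sqnorm x.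
Proof. by rewrite enormE sqr_sqrtr// sqnorm_ge0. Qed.

Lemma enorm_gt0 x : (0 < enorm x) = (x != 0).
Proof. by rewrite enormE sqrtr_gt0 sqnorm_gt0. Qed.

Lemma lnormE x : x != 0 -> lnorm x = ln (enorm x).
Proof.
rewrite -enorm_gt0 => x0; rewrite /lnorm -enorm_sqr.
by rewrite expr2 lnM ?posrE//; field.
Qed.

Lemma expR_lnorm x : x != 0 -> expR (lnorm x) = enorm x.
Proof. by move=> x0; rewrite lnormE// lnK// posrE enorm_gt0. Qed.

Lemma expR_2lnorm x : x != 0 -> expR (2 * lnorm x) = sqnorm x.
Proof. by move=> x0; rewrite /lnorm mulrA divff// mul1r lnK// posrE sqnorm_gt0. Qed.

Lemma coord_le_norm x i : `|x ord0 i| <= `|x|.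
Proof.
rewrite [leRHS]mx_normrE.
by apply: (@le_bigmax _ _ _ 0 (fun ij : 'I_1 * 'I_n => `|x ij.1 ij.2|) (ord0, i)).
Qed.

Lemma coord_le_enorm x i : `|x ord0 i| <= enorm x.
Proof. by rewrite -sqrtr_sqr ler_wsqrtr// coord_sq_le. Qed.

Lemma norm_le_enorm x : `|x| <= enorm x.
Proof.
rewrite [leLHS]mx_normrE; apply: bigmax_le; first exact: sqrtr_ge0.
by move=> [i j] _ /=; rewrite (ord1 i) coord_le_enorm.
Qed.

Lemma enorm_le_norm x : enorm x <= n%:R * `|x|.
Proof.
have h : 0 <= n%:R * `|x| by rewrite mulr_ge0.
rewrite -(@ler_pXn2r _ 2%N) ?nnegrE ?sqrtr_ge0// enorm_sqr /sqnorm.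
apply: (@le_trans _ _ (\sum_(i < n) `|x| ^+ 2)).
  by apply: ler_sum => i _; rewrite -[x ord0 i ^+ 2]real_normK ?num_real// lerXn2r ?nnegrE ?coord_le_norm.
rewrite sumr_const card_ord exprMn.
rewrite [leLHS](_ : _ = n%:R * `|x| ^+ 2); last by rewrite mulr_natl.
rewrite ler_wpM2r ?sqr_ge0//.
rewrite -natrX ler_nat; case: (n) => // m; by rewrite leq_pmulr.
Qed.

(* Factoring the difference of squares avoids the Cauchy-Schwarz inequality. *)
Lemma enorm_lipschitz x y : `|enorm x - enorm y| <= n%:R * `|x - y|.
Proof.
have ex : 0 <= enorm x by exact: sqrtr_ge0.
have ey : 0 <= enorm y by exact: sqrtr_ge0.
have h : `|enorm x - enorm y| * (enorm x + enorm y) <= n%:R * `|x - y| * (enorm x + enorm y).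
  rewrite -{1}[enorm x + enorm y]ger0_norm ?addr_ge0// -normrM -subr_sqr !enorm_sqr.
  rewrite /sqnorm -sumrB; apply: (le_trans (ler_norm_sum _ _ _)).
  rewrite -mulrA mulr_natl -[X in _ *+ X]card_ord -sumr_const; apply: ler_sum => i _.
  rewrite subr_sqr normrM ler_pM//.
    by have := coord_le_norm (x - y) i; rewrite !mxE.
  by apply: (le_trans (ler_normD _ _)); rewrite lerD ?coord_le_enorm.
case: (ltrP 0 (enorm x + enorm y)) => s0; first by rewrite -(ler_pM2r s0).
have -> : enorm x = 0 by lra.
have -> : enorm y = 0 by lra.
by rewrite subrr normr0 mulr_ge0.
Qed.

Lemma sqnorm_line x i (h : R) :
  sqnorm (h *: basis_rV i + x) = sqnorm x + 2 * x ord0 i * h + h ^+ 2.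
Proof.
rewrite /sqnorm (bigD1 i)//= [\sum_(j < n) x ord0 j ^+ 2](bigD1 i)//=.
rewrite !mxE !eqxx/= mulr1.
rewrite (eq_bigr (fun j => x ord0 j ^+ 2)); first by ring.
by move=> j ji; rewrite !mxE eqxx/= (negbTE ji) mulr0 add0r.
Qed.

Lemma coord_line x i j (h : R) : (h *: basis_rV i + x) ord0 j = (i == j)%:R * h + x ord0 j.
Proof. by rewrite !mxE eqxx/= eq_sym mulrC. Qed.

Lemma sqnorm_der x i : is_derive x (basis_rV i) sqnorm (2 * x ord0 i).
Proof.
apply/is_derive_line.
rewrite (_ : (fun h : R => _) = fun h => sqnorm x + 2 * x ord0 i * h + h ^+ 2); last first.
  by apply/funext => h; exact: sqnorm_line.
have d := derD (derD (der_cst 0 (sqnorm x)) (derZ (2 * x ord0 i) (der_id (0 : R)))) (derX2 (der_id 0)).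
by apply: der_eq d _; ring.
Qed.

Lemma lnorm_line_der x i : x != 0 ->
  is_derive (0 : R) 1 (fun h : R => lnorm (h *: basis_rV i + x)) (x ord0 i / sqnorm x).
Proof.
rewrite -sqnorm_gt0 => x0.
have d : is_derive (0 : R) 1 (fun h : R => sqnorm (h *: basis_rV i + x)) (2 * x ord0 i).
  by apply/is_derive_line; exact: sqnorm_der.
have e : sqnorm (0 *: basis_rV i + x) = sqnorm x by rewrite scale0r add0r.
have d' := derZ 2^-1 (der_ln _ d); rewrite e in d'.
by apply: der_eq (d' x0) _; field; rewrite gt_eqF.
Qed.

Lemma radial_der (U : R -> R) x i d : x != 0 -> is_derive (lnorm x) 1 U d ->
  is_derive x (basis_rV i) (fun y => U (lnorm y)) (d * (x ord0 i / sqnorm x)).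
Proof.
move=> x0 dU; apply/is_derive_line.
apply: (@der_comp _ U (fun h => lnorm (h *: basis_rV i + x))); last exact: lnorm_line_der.
by rewrite scale0r add0r.
Qed.

Lemma radial_der2 (P : R -> R) x i j d : x != 0 -> is_derive (lnorm x) 1 P d ->
  is_derive x (basis_rV i) (fun y => P (lnorm y) * (y ord0 j / sqnorm y))
    (d * (x ord0 i * x ord0 j / sqnorm x ^+ 2) +
     P (lnorm x) * ((i == j)%:R / sqnorm x - 2 * x ord0 i * x ord0 j / sqnorm x ^+ 2)).
Proof.
move=> x0 dP; apply/is_derive_line.
have q0 : sqnorm x != 0 by rewrite gt_eqF// sqnorm_gt0.
have e0 : 0 *: basis_rV i + x = x by rewrite scale0r add0r.
have d1 : is_derive (0 : R) 1 (fun h : R => P (lnorm (h *: basis_rV i + x))) (d * (x ord0 i / sqnorm x)).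
  by apply: (@is_derive_line _ _ (fun y => P (lnorm y)) x (basis_rV i) _).2; exact: radial_der.
have d2 : is_derive (0 : R) 1 (fun h : R => sqnorm (h *: basis_rV i + x)) (2 * x ord0 i).
  by apply/is_derive_line; exact: sqnorm_der.
have d3 : is_derive (0 : R) 1 (fun h : R => (h *: basis_rV i + x) ord0 j) (i == j)%:R.
  rewrite (_ : (fun h : R => _) = fun h => (i == j)%:R * h + x ord0 j); last first.
    by apply/funext => h; exact: coord_line.
  by have := derD (derZ (i == j)%:R (der_id (0 : R))) (der_cst 0 (x ord0 j)); rewrite mulr1 addr0.
have d4 := derV d2; rewrite e0 in d4.
have := derM d1 (derM d3 (d4 q0)); rewrite e0 => dd.
by apply: der_eq dd _; field.
Qed.

Lemma neq0_near x : x != 0 -> \forall y \near x, y != 0.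
Proof.
move=> x0; have : open [set y : 'rV[R]_n | y != 0].
  rewrite (_ : [set _ | _] = ~` [set 0]); last by apply/seteqP; split => y /=; move/eqP.
  by apply: closed_openC; apply: accessible_closed_set1; exact: hausdorff_accessible.
by move=> o; have := @open_nbhs_nbhs _ x _ (conj o x0).
Qed.

Lemma coord_cont x i : {for x, continuous (fun y => y ord0 i)}.
Proof. exact: coord_continuous. Qed.

Lemma sqnorm_cont x : {for x, continuous sqnorm}.
Proof.
rewrite /sqnorm; elim: (index_enum _) => [|i r IH].
  rewrite (_ : (fun y : 'rV[R]_n => _) = (fun=> 0)); first exact: cst_continuous.
  by apply/funext => y; rewrite big_nil.
rewrite (_ : (fun y : 'rV[R]_n => _) =
  (fun y => y ord0 i * y ord0 i + \sum_(i <- r) y ord0 i ^+ 2)); last first.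
  by apply/funext => y; rewrite big_cons expr2.
apply: (@continuousD _ _ _ (fun y : 'rV[R]_n => y ord0 i * y ord0 i)); last exact: IH.
by apply: (@continuousM _ _ (fun y : 'rV[R]_n => y ord0 i)); exact: coord_cont.
Qed.

Lemma lnorm_cont x : x != 0 -> {for x, continuous lnorm}.
Proof.
move=> x0; apply: continuousM; first exact: cst_continuous.
apply: (@continuous_comp _ _ _ sqnorm (@ln R)); first exact: sqnorm_cont.
by apply: continuous_ln; rewrite sqnorm_gt0.
Qed.

Section C2.
Variables U P P2 : R -> R.
Hypothesis dU : forall s : R, is_derive s 1 U (P s).
Hypothesis dP : forall s : R, is_derive s 1 P (P2 s).

Let u y := U (lnorm y).

Lemma radial_D x i : x != 0 -> 'D_(basis_rV i) u x = P (lnorm x) * (x ord0 i / sqnorm x).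
Proof. by move=> x0; have [_ ->] := radial_der i x0 (dU (lnorm x)). Qed.

Lemma radial_DD x i j : x != 0 -> is_derive x (basis_rV i) ('D_(basis_rV j) u)
    (P2 (lnorm x) * (x ord0 i * x ord0 j / sqnorm x ^+ 2) +
     P (lnorm x) * ((i == j)%:R / sqnorm x - 2 * x ord0 i * x ord0 j / sqnorm x ^+ 2)).
Proof.
move=> x0; apply: near_eq_is_derive (radial_der2 i j x0 (dP (lnorm x))).
near=> y; rewrite radial_D//.
by near: y; exact: neq0_near.
Unshelve. all: by end_near. Qed.

Lemma radial_laplacian x : x != 0 ->
  laplacian u x = (P2 (lnorm x) + (n%:R - 2) * P (lnorm x)) / sqnorm x.
Proof.
move=> x0; have q0 : sqnorm x != 0 by rewrite gt_eqF// sqnorm_gt0.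
rewrite /laplacian.
rewrite (eq_bigr (fun i => (P2 (lnorm x) - 2 * P (lnorm x)) / sqnorm x ^+ 2 * x ord0 i ^+ 2 +
   P (lnorm x) / sqnorm x)); last first.
  by move=> i _; have [_ ->] := radial_DD i i x0; rewrite eqxx/= mulr1n; field.
rewrite big_split/= -mulr_sumr sumr_const card_ord -[_ *+ n]mulr_natr -/(sqnorm x).
by field.
Qed.

Lemma radial_C2 : continuous P2 -> C2_space [set x | x != 0] u.
Proof.
move=> cP2 x /= x0.
have q0 : sqnorm x != 0 by rewrite gt_eqF// sqnorm_gt0.
have cl := lnorm_cont x0.
have cU : {for x, continuous u}.
  by apply: (@continuous_comp _ _ _ lnorm U) => //; exact: (der_continuous (dU _)).
have cP : {for x, continuous (fun y => P (lnorm y))}.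
  by apply: (@continuous_comp _ _ _ lnorm P) => //; exact: (der_continuous (dP _)).
have cP2' : {for x, continuous (fun y => P2 (lnorm y))}.
  by apply: (@continuous_comp _ _ _ lnorm P2) => //; exact: cP2.
have cq : {for x, continuous (fun y => (sqnorm y)^-1)}.
  by apply: continuousV => //; exact: sqnorm_cont.
have cc i := @coord_cont x i.
have near0 (g h : 'rV[R]_n -> R) : (forall y, y != 0 -> g y = h y) ->
    {for x, continuous g} -> {for x, continuous h}.
  move=> gh cg; rewrite /prop_for /continuous_at -(gh x x0).
  have E : {near x, g =1 h} by near=> y; apply: gh; near: y; exact: neq0_near.
  exact: (cvg_trans (near_eq_cvg E) cg).
split => //.
  move=> i; split; first by have [] := radial_der i x0 (dU (lnorm x)).
  apply: (near0 (fun y => P (lnorm y) * (y ord0 i / sqnorm y))).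
    by move=> y y0; rewrite radial_D.
  by apply: continuousM => //; apply: continuousM.
move=> i j; split; first by have [] := radial_DD i j x0.
apply: (near0 (fun x => P2 (lnorm x) * (x ord0 i * x ord0 j * ((sqnorm x)^-1 * (sqnorm x)^-1)) +
     P (lnorm x) * ((i == j)%:R * (sqnorm x)^-1 - 2 * x ord0 i * x ord0 j * ((sqnorm x)^-1 * (sqnorm x)^-1)))).
  move=> y y0; have [_ ->] := radial_DD i j y0.
  have qy : sqnorm y != 0 by rewrite gt_eqF// sqnorm_gt0.
  by field.
apply: continuousD; apply: continuousM => //.
  by apply: continuousM; apply: continuousM.
apply: continuousB; first by apply: continuousM => //; exact: cst_continuous.
apply: continuousM; last exact: continuousM.
by apply: continuousM => //; apply: continuousM => //; exact: cst_continuous.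
Unshelve. all: by end_near. Qed.

End C2.
End euclid.

Lemma near0_lnorm {R : realType} (n : nat) (s0 : R) :
  \forall x \near (0 : 'rV[R]_n)^', x != 0 /\ lnorm x <= s0.
Proof.
have d0 : 0 < expR s0 / (n%:R + 1) by rewrite divr_gt0 ?expR_gt0// ltr_wpDl.
near=> x; have x0 : x != 0 by near: x; exact: nbhs_dnbhs_neq.
split => //; rewrite -ler_expR expR_lnorm//; apply: (le_trans (enorm_le_norm x)).
have : `|x| < expR s0 / (n%:R + 1) by near: x; exact: dnbhs0_lt.
rewrite ltr_pdivlMr ?ltr_wpDl// => h.
have := normr_ge0 x; lra.
Unshelve. all: by end_near. Qed.

(** * Radial profiles and solutions of the PDE *)

Section pde.
Context {R : realType}.
Variables (N : nat) (f f1 F Phi : R -> R).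
Hypothesis NL : nonlinearity (N%:R - 2) f f1 F Phi.

Let k : R := N%:R - 2.
Local Notation rsol := (rsol k f).

Lemma radial_singular_solution (U P : R -> R) :
  (forall s, rsol U P s) -> (forall M : R, exists s0, forall s, s <= s0 -> M <= U s) ->
  singular_solution f (fun x : 'rV[R]_N => U (lnorm x)).
Proof.
move=> rU Uoo.
have pos := sing_pos NL rU Uoo.
pose P2 (s : R) := - k * P s - expR (2 * s) * ext0 f (U s).
have dU (s : R) : is_derive s 1 U (P s) by have [] := rU s.
have dP (s : R) : is_derive s 1 P (P2 s) by have [] := rU s.
have cP2 : continuous P2.
  move=> s; have cf : {for s, continuous (fun s => ext0 f (U s))}.
    by apply: continuous_comp; [exact: (der_continuous (dU s))|exact: (nl_cont NL)].
  have ce := der_continuous (der_expZ 2 s).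
  apply: (@continuousB _ _ _ (fun x : R => - k * P x) (fun x : R => expR (2 * x) * ext0 f (U x))).
    by apply: (@continuousM _ _ (fun=> - k) P); [exact: cst_continuous|exact: (der_continuous (dP s))].
  exact: (@continuousM _ _ (fun x : R => expR (2 * x)) (fun x : R => ext0 f (U x))).
split.
- exact: (radial_C2 dU dP cP2).
- move=> x x0; rewrite (radial_laplacian dU dP x0) /P2 ext0_nneg ?ltW// expR_2lnorm//.
  by rewrite /k; field; rewrite gt_eqF// sqnorm_gt0.
- by move=> x x0; exact/ltW/pos.
- by move=> x y x0 y0 xy; rewrite !lnormE// xy.
- apply/cvgryPge => M; have [s0 Hs0] := Uoo M.
  by near=> x; apply: Hs0; have [] : x != 0 /\ lnorm x <= s0 by near: x; exact: near0_lnorm.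
Unshelve. all: by end_near. Qed.

Lemma sqnorm_ray (i : 'I_N) (r : R) : sqnorm (r *: basis_rV i) = r ^+ 2.
Proof.
have := sqnorm_line 0 i r; rewrite addr0 mxE => ->.
have -> : sqnorm (0 : 'rV[R]_N) = 0 by rewrite /sqnorm big1// => j _; rewrite mxE expr0n.
by ring.
Qed.

(** The restriction of [v] to one coordinate ray is a twice differentiable profile. Off the origin,
    an open set, [v] coincides with that profile composed with [lnorm], so the Laplacians agree and
    the radial formula gives the equation. *)
Lemma singular_solution_radial (v : 'rV[R]_N -> R) : (3 <= N)%N -> singular_solution f v ->
  exists V Q, [/\ forall s, rsol V Q s, forall M : R, exists s0, forall s, s <= s0 -> M <= V s &
    forall x, x != 0 -> v x = V (lnorm x)].
Proof.
move=> N3 [C2v eqv v0 rad voo].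
pose i0 : 'I_N := Ordinal (leq_trans (ltn0Sn 2) N3).
pose e : 'rV[R]_N := basis_rV i0.
pose ray s := expR s *: e.
have sqray s : sqnorm (ray s) = expR s ^+ 2 by exact: sqnorm_ray.
have ray0 s : ray s != 0 by rewrite -sqnorm_gt0 sqray exprn_gt0// expR_gt0.
have lray s : lnorm (ray s) = s.
  by rewrite /lnorm sqray expr2 -expRD expRK; lra.
pose V (s : R) := v (ray s).
pose Q (s : R) := 'D_e v (ray s) * expR s.
pose Q2 (s : R) := 'D_e ('D_e v) (ray s) * expR s * expR s + 'D_e v (ray s) * expR s.
have de (r : R) : is_derive r 1 (@expR R) (expR r) by exact: is_derive_expR.
have dV (s : R) : is_derive s 1 V (Q s).
  have [_ /(_ i0)[/derivableP d _] _] := C2v _ (ray0 s).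
  exact: (der_comp (is_derive_ray d) (de s)).
have dQ (s : R) : is_derive s 1 Q (Q2 s).
  have [_ _ /(_ i0 i0)[/derivableP d _]] := C2v _ (ray0 s).
  exact: (derM (der_comp (is_derive_ray d) (de s)) (de s)).
have vV x : x != 0 -> v x = V (lnorm x).
  move=> x0; apply: rad => //; rewrite [RHS]enormE sqray sqrtr_sqr gtr0_norm ?expR_gt0//.
  by rewrite expR_lnorm.
have lapE x : x != 0 -> laplacian v x = laplacian (fun y => V (lnorm y)) x.
  move=> x0; apply: eq_bigr => i _; apply: near_eq_derive; near=> y.
  have y0 : y != 0 by near: y; exact: neq0_near.
  apply: near_eq_derive; near=> z; apply: vV.
  by near: z; exact: neq0_near.
exists V, Q; split => // [s|M].
  split => //; apply: der_eq (dQ s) _.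
  have := eqv _ (ray0 s); rewrite lapE// (radial_laplacian dV dQ (ray0 s)) lray sqray -/(V s).
  rewrite ext0_nneg; last exact: v0.
  have -> : expR (2 * s) = expR s ^+ 2 by rewrite expr2 -expRD; congr expR; ring.
  have es : expR s ^+ 2 != 0 by rewrite expf_neq0// gt_eqF// expR_gt0.
  move/eqP; rewrite addr_eq0 => /eqP; move/(congr1 (fun z => z * expR s ^+ 2)).
  by rewrite divfK// => h; rewrite /k; lra.
have /cvgryPge/(_ M) := voo.
rewrite /dnbhs => /nbhs_ballP[d /= d0 H].
have [s0 Hs0] := expR_small ltr01 (divr_gt0 d0 (ltr0Sn _ 1)).
exists s0 => s ss0; apply: H; last exact: ray0.
rewrite -ball_normE /= sub0r normrN; apply: (le_lt_trans (norm_le_enorm _)).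
rewrite enormE sqray sqrtr_sqr gtr0_norm ?expR_gt0//.
by have := Hs0 _ ss0; rewrite mul1r; lra.
Unshelve. all: by end_near. Qed.

Lemma F_decreasing (u v : R) : 0 < u -> u < v -> F v < F u.
Proof.
move=> u0 uv; have pos x : u <= x -> 0 < x by exact: lt_le_trans.
have [x /andP[x1 _]|x /andP[x1 _]|c /andP[c1 _] e] := @mvt _ F (fun x => - (f x)^-1) u v uv.
- exact: (der_continuous (nl_F_der NL (pos _ x1))).
- exact: (nl_F_der NL (pos _ (ltW x1))).
have : - (f c)^-1 * (v - u) < 0.
  by rewrite mulNr oppr_lt0 mulr_gt0 ?subr_gt0// invr_gt0 (nl_pos NL)// pos// ltW.
by rewrite -e subr_lt0.
Qed.

Lemma F_pinvK (u : R) : 0 < u -> 'pinv_(fun=> 0) `]0, +oo[ F (F u) = u.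
Proof.
move=> u0; have inj : {in `]0, +oo[%classic &, injective F}.
  move=> x y; rewrite !inE/= !in_itv/= !andbT => x0 y0 e.
  case: (ltgtP x y) => // h; first by have := F_decreasing x0 h; rewrite e ltxx.
  by have := F_decreasing y0 h; rewrite e ltxx.
have uI : u \in `]0, +oo[%classic by rewrite inE/= in_itv/= u0.
exact: (pinvKV (fun=> 0) inj uI).
Qed.

(** By definition of [EE], [F U = r^2 / (2 k E)] exactly; the error is therefore [1 / E - 1]. *)
Lemma radial_asymptotics (U P : R -> R) :
  (forall s, rsol U P s) -> (forall M : R, exists s0, forall s, s <= s0 -> M <= U s) ->
  exists2 o : 'rV[R]_N -> R, o x @[x --> (0 : 'rV[R]_N)^'] --> (0 : R) &
    \forall x \near (0 : 'rV[R]_N)^', U (lnorm x) =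
      'pinv_(fun=> 0) `]0, +oo[ F (enorm x ^+ 2 / (2 * N%:R - 4) * (1 + o x)).
Proof.
move=> rU Uoo; have pos := sing_pos NL rU Uoo.
have k1 : 1 <= k := nl_k NL.
exists (fun x => (EE k F U (lnorm x))^-1 - 1); last first.
  near=> x; have x0 : x != 0 by near: x; exact: nbhs_dnbhs_neq.
  rewrite -[LHS]F_pinvK//; congr ('pinv_(fun=> 0) _ _ _).
  have F0 := nl_F NL (pos (lnorm x)).
  have q0 : sqnorm x != 0 by rewrite gt_eqF// sqnorm_gt0.
  rewrite /EE expR_2lnorm// enorm_sqr.
  have -> : 2 * N%:R - 4 = 2 * k :> R by rewrite /k; ring.
  by field; rewrite q0 !gt_eqF//; lra.
have [U0 [C [U00 C0 tail]]] := nl_tail NL.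
apply/cvgrPdist_le => e e0.
pose d := Num.min (1 / 2) (e / 2).
have d0 : 0 < d by rewrite lt_min divr_gt0//= divr_gt0.
have [t0 Ht0] := sing_asymptotics NL U00 tail rU Uoo d0.
near=> x.
have [_ xt0] : x != 0 /\ lnorm x <= t0 by near: x; exact: near0_lnorm.
have [_ _ E1 _] := Ht0 _ xt0.
have d2 : d <= 1 / 2 by rewrite ge_min lexx.
have d3 : d <= e / 2 by rewrite ge_min lexx orbT.
move: E1; set E := EE k F U (lnorm x) => E1.
have E2 : 1 / 2 <= E by move: E1; rewrite ler_norml => /andP[]; lra.
have Ep : 0 < E by lra.
rewrite sub0r normrN (_ : E^-1 - 1 = (1 - E) / E); last by field; rewrite gt_eqF.
rewrite normrM normfV (gtr0_norm Ep) ler_pdivrMr// distrC.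
by nra.
Unshelve. all: by end_near. Qed.

End pde.

(** * The closure of BUC in the uniformly local space *)

(* Compact sets and balls need not be shown measurable. *)
Lemma le_integral_restrict d (T : measurableType d) (R : realType)
    (mu : {measure set T -> \bar R}) (D E : set T) (f g : T -> \bar R) :
  (forall x, D x -> 0 <= f x)%E -> (forall x, E x -> 0 <= g x)%E ->
  (forall x, D x -> E x /\ (f x <= g x)%E) ->
  (\int[mu]_(x in D) f x <= \int[mu]_(x in E) g x)%E.
Proof.
move=> f0 g0 fg; rewrite !ge0_integralE//; apply: le_ereal_sup => _ [h /= hf <-].
exists h => //= x; apply: (le_trans (hf x)); rewrite !patchE.
case: ifPn => xD.
  by have [Ex] := fg _ (set_mem xD); rewrite mem_set.
by case: ifPn => // xE; exact: g0 (set_mem xE).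
Qed.

(** * Cubes and an integrable majorant of a logarithmic singularity *)

Section cubes.
Context {R : realType} (n : nat).
Implicit Types (x z : 'rV[R]_n).
Local Notation mu := (@lebesgue_rV R n).

Definition cube z (r : R) : set 'rV[R]_n :=
  [set x | forall i, `]z ord0 i - r, z ord0 i + r[%classic (x ord0 i)].

Lemma cubeP z r x : cube z r x <-> forall i, `|x ord0 i - z ord0 i| < r.
Proof.
split=> h i; have := h i; rewrite /= in_itv/= ltr_norml.
  by move=> /andP[h1 h2]; apply/andP; split; lra.
by move=> /andP[h1 h2]; apply/andP; split; lra.
Qed.

Lemma measurable_cube z r : measurable (cube z r).
Proof.
rewrite [X in measurable X](_ : _ = \bigcap_(i in [set: 'I_n])
  ((fun v : 'rV[R]_n => v ord0 i : measurableTypeR R) @^-1` `]z ord0 i - r, z ord0 i + r[%classic)).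
  apply: fin_bigcap_measurable => // i _; rewrite -[X in measurable X]setTI.
  by apply: measurable_coord => //; exact: measurable_itv.
by apply/seteqP; split=> v /= h i; [move=> _; exact: h|exact: (h i)].
Qed.

Lemma cube_volume z r : 0 < r -> mu (cube z r) = ((2 * r) ^+ n)%:E.
Proof.
move=> r0.
rewrite (@lebesgue_rV_box R n (fun i =>
  `]z ord0 i - r, z ord0 i + r[%classic : set (measurableTypeR R))); last first.
  by move=> i; exact: measurable_itv.
rewrite (eq_bigr (fun=> (2 * r)%:E)).
  by rewrite prodEFin prodr_const card_ord.
move=> i _; rewrite lebesgue_measure_itv/= lte_fin ifT; last by lra.
by rewrite -EFinB; congr EFin; ring.
Qed.

Lemma eball_sub_cube z r : eball z r `<=` cube z r.
Proof.
move=> x /= h; apply/cubeP => i; apply: le_lt_trans h.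
by have := coord_le_enorm (z - x) i; rewrite !mxE distrC.
Qed.

Lemma compact_sub_cube (K : set 'rV[R]_n) : compact K -> exists2 r, 0 < r & K `<=` cube 0 r.
Proof.
move=> /compact_bounded [M [_ hM]]; exists (`|M| + 2); first by have := normr_ge0 M; lra.
move=> x Kx; apply/cubeP => i; rewrite mxE subr0.
apply: (le_lt_trans (coord_le_norm x i)); have M1 : M < `|M| + 1 by have := ler_norm M; lra.
by apply: (le_lt_trans (hM _ M1 x Kx)); lra.
Qed.

(** The value [c * (m + 1)] is placed on the cube of half-side [2^-m], for all [m >= j]. With nested
    cubes instead of annuli, domination needs only one term of the sum. *)
Definition dyadic_sum (c : R) (j : nat) x : \bar R :=
  (\sum_(l <oo) (c * (j + l).+1%:R)%:E * (\1_(cube 0 (2^-1 ^+ (j + l))) x)%:E)%E.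

Lemma dyadic_sum_ge0 c j x : 0 <= c -> (0 <= dyadic_sum c j x)%E.
Proof.
move=> c0; apply: nneseries_ge0 => l _ _.
by rewrite -EFinM lee_fin; apply: mulr_ge0 => //; apply: mulr_ge0.
Qed.

Lemma le_dyadic_sum c j x (y : R) l : 0 <= c -> cube 0 (2^-1 ^+ (j + l)) x ->
  y <= c * (j + l).+1%:R -> (y%:E <= dyadic_sum c j x)%E.
Proof.
move=> c0 xl yl.
have h (m : nat) : (0 <= (c * (j + m).+1%:R)%:E * (\1_(cube 0 (2^-1 ^+ (j + m))) x)%:E)%E.
  by rewrite -EFinM lee_fin; apply: mulr_ge0 => //; apply: mulr_ge0.
apply: le_trans (nneseries_lim_ge l.+1 (fun m _ _ => h m)).
rewrite big_nat_recr//=; apply: le_trans (leeDr _ (sume_ge0 _ _)) => //.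
by rewrite indicE mem_set// mule1 lee_fin.
Qed.

Lemma measurable_dyadic_sum c j : 0 <= c -> measurable_fun [set: 'rV[R]_n] (dyadic_sum c j).
Proof.
move=> c0; apply: ge0_emeasurable_sum => [l x _ _|l _].
  by rewrite -EFinM lee_fin; apply: mulr_ge0 => //; apply: mulr_ge0.
apply/measurable_EFinP; apply: measurable_funM => //.
exact: measurable_indic (measurable_cube _ _).
Qed.

(** With [a = 2^-m] a term is [c (m + 1) (2 a)^n]. One factor [a] absorbs the weight, as
    [m + 1 <= 2^m], and a second one produces the geometric series; this is the use of [2 <= n]. *)
Lemma integral_dyadic_sum c j : (2 <= n)%N -> 0 <= c ->
  (\int[mu]_x dyadic_sum c j x <= (c * 2 ^+ n.+1 * 2^-1 ^+ j)%:E)%E.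
Proof.
move=> n2 c0; rewrite integral_nneseries//; first last.
- by move=> l x _; rewrite -EFinM lee_fin; apply: mulr_ge0 => //; apply: mulr_ge0.
- move=> l; apply/measurable_EFinP; apply: measurable_funM => //.
  exact: measurable_indic (measurable_cube _ _).
apply: (@le_trans _ _ (\sum_(l <oo) (c * 2 ^+ n.+1 * 2^-1 ^+ j / (2 ^ l.+1)%:R)%:E)%E); last first.
  by apply: epsilon_trick0; apply: mulr_ge0; [apply: mulr_ge0|]; rewrite ?exprn_ge0.
apply: lee_nneseries => [l _ _|l _].
  apply: integral_ge0 => x _.
  by rewrite -EFinM lee_fin; apply: mulr_ge0 => //; apply: mulr_ge0.
rewrite ge0_integralZl_EFin//; first last.
- by apply: mulr_ge0.
- by apply/measurable_EFinP; exact: measurable_indic (measurable_cube _ _).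
rewrite integral_indic//; last exact: measurable_cube.
have p0 : 0 < (2^-1 : R) ^+ (j + l) by rewrite exprn_gt0.
rewrite setIT [X in (_ * X)%E](cube_volume 0 p0) -EFinM lee_fin.
have [a e] : exists a : R, a = 2^-1 ^+ (j + l) by exists (2^-1 ^+ (j + l)).
have a0 : 0 < a by rewrite e exprn_gt0.
have a1 : a <= 1 by rewrite e exprn_ile1//; lra.
have h : (j + l).+1%:R * a <= 1.
  rewrite e exprVn ler_pdivrMr ?exprn_gt0// mul1r -natrX ler_nat.
  exact: ltn_expl.
rewrite -e natrX [leRHS](_ : _ = c * 2 ^+ n * a); last first.
  by rewrite e exprD exprS !exprVn exprS; field; rewrite !expf_neq0.
rewrite -mulrA -mulrA ler_wpM2l// exprMn mulrCA ler_wpM2l ?exprn_ge0//.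
rewrite -(subnKC n2) exprD expr2 mulrA mulrA -[leRHS]mul1r.
rewrite [leRHS](_ : _ = 1 * a * 1); last by ring.
apply: ler_pM; rewrite ?exprn_ge0 ?exprn_ile1 ?(ltW a0)//.
  by apply: mulr_ge0; [apply: mulr_ge0|]; rewrite ?(ltW a0).
by rewrite ler_wpM2r ?(ltW a0).
Qed.

End cubes.

(** * Approximation of logarithmically singular radial functions *)

Section closure.
Context {R : realType} (N : nat) (U : R -> R) (c : R).
Hypotheses (N2 : (2 <= N)%N) (Ucont : continuous U) (U_ge0 : forall s, 0 <= U s).
Hypothesis U_mono : forall s t, s <= t -> U t <= U s.
Hypotheses (U0c : U 0 <= c) (U_log : forall m : nat, U (- m.+1%:R) <= c * m.+1%:R).
Hypothesis U_lip : forall a, exists2 K, 0 <= K &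
  forall s t, a <= s -> s <= t -> U s - U t <= K * (expR t - expR s).
Local Notation mu := (@lebesgue_rV R N).
Implicit Types x : 'rV[R]_N.

Let u x := U (lnorm x).

Let c_ge0 : 0 <= c. Proof. exact: le_trans (U_ge0 0) U0c. Qed.

Lemma ln_half_pow_ge (m : nat) : - m%:R <= ln (2^-1 ^+ m) :> R.
Proof.
rewrite lnXn// lnV ?posrE// mulNrn lerN2 -[leLHS]/(ln 2 *+ m) ler_wMn2r//.
by rewrite -[leRHS]expRK ler_ln ?posrE ?expR_gt0//; have := expR_ge1Dx (1 : R); lra.
Qed.

Lemma le_dyadic_singular j x (y : R) : cube 0 (2^-1 ^+ j) x ->
  (x != 0 -> y <= u x) -> (x = 0 -> y <= c * j.+1%:R) -> (y%:E <= dyadic_sum c j x)%E.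
Proof.
move=> xj yu y0; have [x0|x0] := eqVneq x 0.
  by apply: (@le_dyadic_sum _ _ c j x y 0); rewrite ?addn0//; exact: y0.
have nx : 0 < `|x| by rewrite normr_gt0.
(* For the least such [l], [x] still lies in the cube of level [j + l], while its norm is at least
   [2^-(j + l + 1)], which bounds [u x] by [c * (j + l + 1)]. *)
have ex : exists l, 2^-1 ^+ (j + l).+1 <= `|x|.
  have [l hl] := geo_small 1 nx; exists l; rewrite -addSn; have := hl (j.+1 + l)%N (leq_addl _ _).
  by rewrite mul1r.
have := ex_minnP ex; case: ex_minnP => l hl lmin _ {ex}.
apply: (@le_dyadic_sum _ _ c j x y l) => //.
  case: l lmin {hl} => [|l] lmin; first by rewrite addn0.
  apply/cubeP => i; rewrite mxE subr0; apply: (le_lt_trans (coord_le_norm x i)).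
  rewrite ltNge; apply/negP => h; have := lmin l; rewrite -addnS => /(_ h).
  by rewrite ltnn.
apply: (le_trans (yu x0)); apply: le_trans (U_log _); apply: U_mono.
rewrite lnormE//; apply: (le_trans (ln_half_pow_ge _)).
rewrite ler_ln ?posrE ?enorm_gt0 ?exprn_gt0//.
exact: le_trans hl (norm_le_enorm x).
Qed.

Lemma measurable_lnorm : measurable_fun [set: 'rV[R]_N] (@lnorm R N).
Proof.
apply: measurable_funM => //; apply: measurableT_comp; first exact: measurable_ln.
apply: measurable_sum => i; apply: measurable_funX; exact: measurable_coord.
Qed.

Lemma integral_singular_le (D : set 'rV[R]_N) z r : 0 < r -> D `<=` cube z r ->
  (\int[mu]_(x in D) `|u x|%:E <= (c * 2 ^+ N.+1 + c * (2 * r) ^+ N)%:E)%E.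
Proof.
move=> r0 Dz.
apply: (@le_trans _ _ (\int[mu]_(x in cube z r) (dyadic_sum c 0 x + c%:E))%E).
  apply: le_integral_restrict => [x _|x _|x Dx]; first by rewrite lee_fin.
    by apply: adde_ge0; [exact: dyadic_sum_ge0|rewrite lee_fin].
  split; first exact: Dz.
  rewrite (ger0_norm (U_ge0 _)).
  (* Inside the unit cube the dyadic sum dominates; outside, the radius is at least 1 and
     [u <= U 0 <= c]. *)
  have [x1|x1] := pselect (cube 0 (2^-1 ^+ 0) x).
    apply: le_trans (leeDl _ _); last by rewrite lee_fin.
    apply: le_dyadic_singular => // ->; rewrite mulr1.
    rewrite /u /lnorm /sqnorm big1; last by move=> i _; rewrite mxE expr0n.
    by rewrite ln0// mulr0.
  apply: le_trans (leeDr _ _); last exact: dyadic_sum_ge0.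
  rewrite lee_fin; apply: le_trans U0c; apply: U_mono.
  have [i xi] : exists i, 1 <= `|x ord0 i|.
    apply: contrapT => h; apply: x1; apply/cubeP => i; rewrite mxE subr0 expr0 ltNge.
    by apply/negP => h'; apply: h; exists i.
  have e1 : 1 <= enorm x := le_trans xi (coord_le_enorm x i).
  rewrite lnormE ?ln_ge0//.
  by rewrite -enorm_gt0; apply: lt_le_trans e1.
have mcube := measurable_cube z r.
have mdyadic : measurable_fun (cube z r) (dyadic_sum c 0).
  by apply: measurable_funTS; exact: measurable_dyadic_sum.
rewrite (ge0_integralD _ mcube _ mdyadic)//; last by move=> x _; exact: dyadic_sum_ge0.
rewrite EFinD; apply: leeD.
  apply: (@le_trans _ _ (\int[mu]_x dyadic_sum c 0 x)%E).
    by apply: le_integral_restrict => // x _; exact: dyadic_sum_ge0.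
  by apply: (le_trans (integral_dyadic_sum 0 N2 c_ge0)); rewrite expr0 mulr1.
rewrite integral_cst; last exact: measurable_cube.
by rewrite [X in (_ * X)%E](cube_volume z r0) -EFinM.
Qed.

(* Truncating [enorm] rather than [lnorm], whose value at 0 is junk, makes this
   continuous at 0. *)
Let trunc j x := U (ln (Num.max (enorm x) (2^-1 ^+ j))).

Let half_pow_gt0 j : 0 < (2^-1 : R) ^+ j. Proof. by rewrite exprn_gt0. Qed.

Let max_gt0 j x : 0 < Num.max (enorm x) (2^-1 ^+ j).
Proof. by rewrite lt_max half_pow_gt0 orbT. Qed.

Lemma trunc_BUC j : BUC (trunc j).
Proof.
split.
  exists (U (ln (2^-1 ^+ j))); split; first exact: num_real.
  move=> M hM x _; apply: le_trans (ltW hM); rewrite ger0_norm ?U_ge0//.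
  by apply: U_mono; rewrite ler_ln ?posrE ?max_gt0// le_max lexx orbT.
have [K K0 HK] := U_lip (ln (2^-1 ^+ j)).
apply/unif_continuousP => e e0; pose d := e / (K * N%:R + 1).
have KN : 0 < K * N%:R + 1 by have := mulr_ge0 K0 (ler0n R N); lra.
exists d; first by rewrite divr_gt0.
move=> [x y] /=; rewrite -!ball_normE /= => xy.
wlog h : x y xy / enorm x <= enorm y.
  move=> w; case: (lerP (enorm x) (enorm y)) => h; first exact: w.
  by rewrite distrC; apply: w; rewrite ?(ltW h) // distrC.
have m : Num.max (enorm x) (2^-1 ^+ j) <= Num.max (enorm y) (2^-1 ^+ j).
  by rewrite ge_max !le_max h lexx orbT.
have l : ln (Num.max (enorm x) (2^-1 ^+ j)) <= ln (Num.max (enorm y) (2^-1 ^+ j)).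
  by rewrite ler_ln ?posrE ?max_gt0.
rewrite ger0_norm ?subr_ge0 ?U_mono//.
have /HK/(_ l) : ln (2^-1 ^+ j) <= ln (Num.max (enorm x) (2^-1 ^+ j)).
  by rewrite ler_ln ?posrE ?max_gt0// le_max lexx orbT.
rewrite !lnK ?posrE ?max_gt0// => b; apply: (le_lt_trans b).
have D : Num.max (enorm y) (2^-1 ^+ j) - Num.max (enorm x) (2^-1 ^+ j) <= N%:R * `|x - y|.
  apply: (@le_trans _ _ (enorm y - enorm x)).
    by rewrite /Num.max; case: ltP => h1; case: ltP => h2; lra.
  apply: (le_trans (ler_norm _)); rewrite distrC; exact: enorm_lipschitz.
apply: (@le_lt_trans _ _ ((K * N%:R + 1) * `|x - y|)).
  have := ler_wpM2l K0 D; have := normr_ge0 (x - y); set t := Num.max _ _ - _; lra.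
by rewrite mulrC -ltr_pdivlMr.
Qed.

Lemma integral_trunc_le j (D : set 'rV[R]_N) :
  (\int[mu]_(x in D) `|(u \- trunc j)%R x|%:E <= (c * 2 ^+ N.+1 * 2^-1 ^+ j)%:E)%E.
Proof.
apply: (@le_trans _ _ (\int[mu]_x dyadic_sum c j x)%E); last exact: integral_dyadic_sum.
apply: le_integral_restrict => [x _|x _|x Dx]; [by rewrite lee_fin|exact: dyadic_sum_ge0|].
split=> //=; case: (lerP (2^-1 ^+ j) (enorm x)) => xj.
  rewrite /u /trunc max_l// lnormE ?subrr ?normr0 ?dyadic_sum_ge0//.
  by rewrite -enorm_gt0; exact: lt_le_trans xj.
have Ej : Num.max (enorm x) (2^-1 ^+ j) = 2^-1 ^+ j by rewrite max_r// ltW.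
apply: le_dyadic_singular => [|x0|x0].
- by apply/cubeP => i; rewrite mxE subr0; exact: le_lt_trans (coord_le_enorm x i) xj.
- have : trunc j x <= u x.
    by rewrite /trunc Ej; apply: U_mono; rewrite lnormE// ler_ln ?posrE ?enorm_gt0// ltW.
  move=> h; rewrite ger0_norm ?subr_ge0// lerBlDr lerDl; exact: U_ge0.
(* At the origin [lnorm] is 0, so the difference has the opposite sign and is bounded by the
   truncated value. *)
- have -> : u x = U 0.
    rewrite /u /lnorm x0 /sqnorm big1; last by move=> i _; rewrite mxE expr0n.
    by rewrite ln0// mulr0.
  rewrite /trunc Ej.
  have h : U 0 <= U (ln (2^-1 ^+ j)).
    by apply: U_mono; apply: ln_le0; rewrite exprn_ile1//; lra.
  rewrite distrC ger0_norm ?subr_ge0//; have := U_ge0 0.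
  suff : U (ln (2^-1 ^+ j)) <= c * j.+1%:R by lra.
  apply: le_trans (U_log _); apply: U_mono; apply: le_trans (ln_half_pow_ge _).
  by rewrite lerN2 ler_nat.
Qed.

Lemma closure_BUC_log_singular : L1_ul_closure_BUC u.
Proof.
split; [split; [split|]|].
- apply: (measurableT_comp _ measurable_lnorm); exact: continuous_measurable_fun.
- move=> K /compact_sub_cube[r r0 Kr].
  by apply: (le_lt_trans (integral_singular_le r0 Kr)); rewrite ltry.
- apply: (@le_lt_trans _ _ (c * 2 ^+ N.+1 + c * (2 * 1) ^+ N)%:E); last by rewrite ltry.
  apply: ge_ereal_sup => _ [z _ <-]; apply: integral_singular_le => //; exact: eball_sub_cube.
move=> e e0; have e2 : 0 < e / 2 by lra.
have [j hj] := geo_small (c * 2 ^+ N.+1) e2.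
exists (trunc j); first exact: trunc_BUC.
apply: (@le_lt_trans _ _ (e / 2)%:E); last by rewrite lte_fin; lra.
apply: ge_ereal_sup => _ [z _ <-]; apply: (le_trans (integral_trunc_le j _)).
by rewrite lee_fin; exact: hj.
Qed.

End closure.

Lemma closure_BUC_singular {R : realType} (N : nat) (k : R) (f f1 F Phi U P : R -> R) :
  (2 <= N)%N -> nonlinearity k f f1 F Phi -> (forall s, rsol k f U P s) ->
  (forall M : R, exists s0, forall s, s <= s0 -> M <= U s) ->
  L1_ul_closure_BUC (fun x : 'rV[R]_N => U (lnorm x)).
Proof.
move=> N2 NL rU Uoo.
have mono a t : a <= t -> U t <= U a by exact: (sing_nonincr NL rU Uoo).
have [t0 [A [B [A0 B0 grow]]]] := sing_growth NL rU Uoo.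
pose c := A + B * `|t0| + B.
have Bt : 0 <= B * `|t0| by rewrite mulr_ge0.
have log_bound (m : nat) : U (- m.+1%:R) <= c * m.+1%:R.
  have m1 : (1 : R) <= m.+1%:R by rewrite ler1n.
  have cm : c * 1 <= c * m.+1%:R by apply: ler_wpM2l => //; rewrite /c; lra.
  case: (lerP (- m.+1%:R) t0) => mt.
    have [_ h _ _] := grow _ mt.
    have := ler_wpM2l (addr_ge0 A0 Bt) m1; have := ler_wpM2l B0 (ler_norm t0).
    by rewrite /c; lra.
  have [_ h _ _] := grow _ (lexx t0); have := mono _ _ (ltW mt).
  by rewrite /c in cm *; lra.
apply: (@closure_BUC_log_singular _ _ _ c) => //.
- by move=> s; have [dU _] := rU s; exact: der_continuous dU.
- by move=> s; apply: ltW; exact: (sing_pos NL rU Uoo).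
- by have := log_bound 0%N; rewrite mulr1; apply: le_trans; apply: mono; rewrite oppr_le0.
move=> a; have [K K0 HK] := sing_lipschitz NL rU Uoo a; exists K => // s t as_ st.
have := @der_compare _ (fun x => (- K) * expR x) U (fun x => (- K) * expR x) P s t st.
have d (x : R) : is_derive x 1 (fun x => (- K) * expR x) ((- K) * expR x).
  exact: (derZ (- K) (is_derive_expR x)).
move=> /(_ (fun x _ => d x) (fun x _ => (rU x).1)) h.
suff : - K * expR t - - K * expR s <= U t - U s by lra.
by apply: h => x /andP[sx _]; rewrite mulNr; apply: HK; lra.
Qed.

Unset Implicit Arguments.

Theorem proposition1p2 (R : realType) (N : nat) (hN : (3 <= N)%N)
  (f : R -> R)
  (f_C1 : C1_within `[0, +oo[ f)
  (f_C2 : C2_line `]0, +oo[ f)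
  (f0 : f 0 = 0)
  (f'0 : derive_within `[0, +oo[ f 0 = 0)
  (f'_gt0 : forall u : R, 0 < u -> 0 < f^`() u)
  (f''_gt0 : forall u : R, 0 < u -> 0 < f^`(2) u)
  (g_convex : exists u0 : R, 0 < u0 /\
     @convex_function R R^o `[u0, +oo[ (fun u : R => ln (f u)))
  (g_lim : let g := fun u : R => ln (f u) in
     (g^`(2))%classic u / (g^`())%classic u ^+ 2 @[u --> +oo] --> (0 : R))
  (f_supercritical : forall u : R, 0 <= u ->
     0 <= u * f u - (sobolev_exponent R N + 1) *
                    \int[lebesgue_measure]_(s in `[0, u]) f s) :
  exists u : 'rV[R]_N -> R,
    [/\ singular_solution f u,
        forall v : 'rV[R]_N -> R, singular_solution f v ->
          forall x, x != 0 -> v x = u x,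
        L1_ul_closure_BUC u &
        exists2 o : 'rV[R]_N -> R,
          o x @[x --> (0 : 'rV[R]_N)^'] --> (0 : R) &
          \forall x \near (0 : 'rV[R]_N)^',
            u x = tail_integral_inv f
                    (enorm x ^+ 2 / (2 * N%:R - 4) * (1 + o x))].

Proof.
have [Phi NL] := sobolev_nonlinearity hN f_C1 f_C2 f0 f'_gt0 f''_gt0 g_convex g_lim f_supercritical.
have [U0 [C [U00 C0 tail]]] := nl_tail NL.
have [U [P [rU Uoo]]] := sing_exists NL U00 C0 tail.
exists (fun x => U (lnorm x)); split.
- exact: (radial_singular_solution NL rU Uoo).
- move=> v sv x x0; have [V [Q [rV Voo hV]]] := singular_solution_radial hN sv; rewrite hV //.
  exact: (sing_unique NL U00 C0 tail rV Voo rU Uoo).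
- exact: (closure_BUC_singular (ltnW hN) NL rU Uoo).
exact: (radial_asymptotics NL rU Uoo).
Qed.
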